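(* For every $n\in\mathbb{N}$, the cyclotomic quotient $\mathcal{A}_{n+1}^{\mathbf{C}}(F)$ is a Frobenius extension of $\mathcal{A}_n^{\mathbf{C}}(F)$ with trace map $\operatorname{tr}^{\mathbf{C}}_{n+1}$.
   Context: $\Bbbk$ is a commutative ring of characteristic not equal to $2$; $\mathbb{N}$ is the set of nonnegative integers. ''Algebra'' means associative unital $\mathbb{Z}$-graded $\Bbbk$-superalgebra, ''module'' means $\mathbb{Z}$-graded supermodule; $|a|$ is the degree and $\bar a$ the parity. Tensor products are over $\Bbbk$ unless indicated, with $(a_1\otimes a_2)(b_1\otimes b_2)=(-1)^{\bar a_2\bar b_1}a_1b_1\otimes a_2b_2$. Frobenius extension: for a subalgebra $R\subseteq A$, $A$ is a Frobenius extension of $R$ with (even) trace map $T\colon A\to R$ if $T$ is a homogeneous parity-preserving homomorphism of $(R,R)$-bimodules and there are finitely many homogeneous elements $u_i,v_i\in A$ with $a=\sum_iu_i\,T(v_ia)=\sum_iT(au_i)\,v_i$ for all $a\in A$. $F$ is an $\mathbb{N}$-graded Frobenius superalgebra, free of finite rank over $\Bbbk$: there is a parity-preserving linear trace map $\operatorname{tr}\colon F\to\Bbbk$, homogeneous in degree, such that $f\mapsto(g\mapsto(-1)^{\bar f\bar g}\operatorname{tr}(gf))$ is an isomorphism $F\to\operatorname{Hom}_\Bbbk(F,\Bbbk)$. The Nakayama automorphism $\psi$ is defined by $\operatorname{tr}(fg)=(-1)^{\bar f\bar g}\operatorname{tr}(g\psi(f))$. $\delta$ is the maximum degree of elements of $F$.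 It is assumed that $\psi$ has finite order $\theta$, that the characteristic of $\Bbbk$ does not divide $\theta$, and that $F$ has a basis of eigenvectors of $\psi$. $B$ is a homogeneous basis of $F$ and $\{b^\vee\}$ its left dual basis: $\operatorname{tr}(b^\vee c)=\delta_{b,c}$. For $f\in F$: $f_i=1^{\otimes(i-1)}\otimes f\otimes1^{\otimes(n-i)}\in F^{\otimes n}$ and $\psi_i=\operatorname{id}^{\otimes(i-1)}\otimes\psi\otimes\operatorname{id}^{\otimes(n-i)}$. $S_n$ acts on $F^{\otimes n}$ by superpermuting factors, written ${}^\pi\mathbf{f}$: ${}^{s_i}(f_1\otimes\cdots\otimes f_n)=(-1)^{\bar f_i\bar f_{i+1}}f_1\otimes\cdots\otimes f_{i+1}\otimes f_i\otimes\cdots\otimes f_n$, with $s_i$ the transposition of $i,i+1$. The affine wreath product algebra $\mathcal{A}_n(F)$ is the free product $\Bbbk[x_1,\dots,x_n]\star F^{\otimes n}\star\Bbbk S_n$ modulo the relations: $\mathbf{f}x_i=x_i\psi_i(\mathbf{f})$; $s_ix_j=x_js_i$ ($j\ne i,i+1$); $s_ix_i=x_{i+1}s_i-t_{i,i+1}$; $\pi\mathbf{f}={}^\pi\mathbf{f}\,\pi$ ($\pi\in S_n$), where $t_{i,j}=\sum_{b\in B}b_i(b^\vee)_j$ for $i\neq j$. Gradings: $|x_i|=\delta$, $\bar x_i=0$; $f_i$ has the degree and parity of $f$; $\pi\in S_n$ has degree and parity $0$. For $k\in\mathbb{Z}$: $F_\psi=\{f\in F\mid\psi(f)=f\}$,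 $F^{(k)}=\{f\in F\mid gf=(-1)^{\bar f\bar g}f\psi^k(g)\ \forall g\in F\}$, $F_\psi^{(k)}=F^{(k)}\cap F_\psi$. For $1\le k\le\theta$ choose $e_k\in\mathbb{N}$ and even elements $\mathbf{c}^{(k,1)},\dots,\mathbf{c}^{(k,e_k)}\in F_\psi^{(k)}$ of degree $k\delta$, where $F$ is identified with the first tensor factor $F\otimes\Bbbk^{\otimes(n-1)}\subseteq F^{\otimes n}$ for each $n\ge1$; $\mathbf{C}$ is the tuple of all these elements. Let $\chi_{\mathbf{C}}=\prod_{k=1}^\theta\prod_{j=1}^{e_k}(x_1^k-\mathbf{c}^{(k,j)})$. For $n\ge1$, $\mathcal{A}_n^{\mathbf{C}}(F)$ is the quotient of $\mathcal{A}_n(F)$ by the two-sided ideal generated by $\chi_{\mathbf{C}}$; $\mathcal{A}_0^{\mathbf{C}}(F)=\Bbbk$. The level is $d=d_{\mathbf{C}}=\sum_{k=1}^\theta ke_k$, assumed to be at least $1$. The subalgebra of $\mathcal{A}_{n+1}^{\mathbf{C}}(F)$ generated by $x_1,\dots,x_n$, $F^{\otimes n}\otimes1$ and $S_n$ is isomorphic to, and identified with, $\mathcal{A}_n^{\mathbf{C}}(F)$. With $F_{n+1}=\{f_{n+1}\mid f\in F\}\subseteq F^{\otimes(n+1)}$, there is a decomposition of $(\mathcal{A}_n^{\mathbf{C}}(F),\mathcal{A}_n^{\mathbf{C}}(F))$-bimodules $$\mathcal{A}_{n+1}^{\mathbf{C}}(F)=x_{n+1}^{d-1}F_{n+1}\mathcal{A}_n^{\mathbf{C}}(F)\oplus\bigoplus_{a=0}^{d-2}x_{n+1}^aF_{n+1}\mathcal{A}_n^{\mathbf{C}}(F)\oplus\mathcal{A}_n^{\mathbf{C}}(F)s_n\mathcal{A}_n^{\mathbf{C}}(F)$$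 (the last summand being absent for $n=0$). The map $\operatorname{tr}^{\mathbf{C}}_{n+1}\colon\mathcal{A}_{n+1}^{\mathbf{C}}(F)\to\mathcal{A}_n^{\mathbf{C}}(F)$ is the bimodule homomorphism given by projection onto the first summand followed by $x_{n+1}^{d-1}f_{n+1}y\mapsto\operatorname{tr}(f)y$ for $f\in F$, $y\in\mathcal{A}_n^{\mathbf{C}}(F)$. *)

(* Defs.v *)
From HB Require Import structures.
From mathcomp Require Import all_boot all_order all_fingroup all_algebra.
From mathcomp Require Import finmap.
From mathcomp Require Import boolp classical_sets.
From mathcomp.multinomials Require Import monalg.

Set Implicit Arguments.
Unset Strict Implicit.
Unset Printing Implicit Defensive.

Import GRing.Theory.
Local Open Scope ring_scope.
Local Open Scope quotient_scope.
Local Notation qrepr := generic_quotient.repr.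

(* Over [pzRingType], since such a quotient may be the zero ring. *)
Section IdealQuotient.
Variables (A : pzRingType) (S : A -> Prop).

Inductive ideal_gen : A -> Prop :=
| ideal_gen_in s : S s -> ideal_gen s
| ideal_gen0 : ideal_gen 0
| ideal_genD a b : ideal_gen a -> ideal_gen b -> ideal_gen (a + b)
| ideal_genMl a b : ideal_gen b -> ideal_gen (a * b)
| ideal_genMr a b : ideal_gen a -> ideal_gen (a * b).

Definition ideal_eq : rel A := fun a b => `[< ideal_gen (a - b) >].

Lemma ideal_genN a : ideal_gen a -> ideal_gen (- a).
Proof. by move=> Ia; rewrite -mulN1r; apply: ideal_genMl. Qed.

Lemma ideal_eq_equiv : equiv_class_of ideal_eq.
Proof.
split=> [a|a b|b a c].
- by apply/asboolP; rewrite subrr; apply: ideal_gen0.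
- by apply/idP/idP => /asboolP Iab; apply/asboolP; rewrite -opprB;
    apply: ideal_genN.
- move=> /asboolP Iab /asboolP Ibc; apply/asboolP.
  by rewrite -[a](subrK b) -addrA; apply: ideal_genD.
Qed.
Canonical ideal_eq_equiv_rel := EquivRelPack ideal_eq_equiv.

(* [A] modulo the two-sided ideal generated by [S]. *)
Definition quo : Type := {eq_quot ideal_eq}.
HB.instance Definition _ := Choice.on quo.
HB.instance Definition _ := EqQuotient.on quo.

Definition toquo (a : A) : quo := \pi_quo a.

Lemma toquoP a b : toquo a = toquo b <-> ideal_gen (a - b).
Proof.
split; first by move=> /eqP; rewrite /toquo eqmodE => /asboolP.
by move=> Iab; apply/eqP; rewrite /toquo eqmodE; apply/asboolP.
Qed.

Lemma toquo_repr (q : quo) : toquo (qrepr q) = q.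
Proof. exact: reprK. Qed.

Lemma repr_toquo a : ideal_gen (qrepr (toquo a) - a).
Proof. by apply/toquoP; rewrite toquo_repr. Qed.

Lemma quoW (P : quo -> Prop) : (forall a, P (toquo a)) -> forall q, P q.
Proof. by move=> Pa q; rewrite -[q]toquo_repr. Qed.

Definition quo_opp := locked (fun x : quo => toquo (- qrepr x)).
Definition quo_add := locked (fun x y : quo => toquo (qrepr x + qrepr y)).
Definition quo_mul := locked (fun x y : quo => toquo (qrepr x * qrepr y)).

Lemma toquoN a : quo_opp (toquo a) = toquo (- a).
Proof.
by rewrite /quo_opp -lock; apply/toquoP; rewrite -opprD; apply: ideal_genN; apply: repr_toquo.
Qed.

Lemma toquoD a b : quo_add (toquo a) (toquo b) = toquo (a + b).
Proof.
rewrite /quo_add -lock; apply/toquoP; rewrite opprD addrACA.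
by apply: ideal_genD; apply: repr_toquo.
Qed.

Lemma toquoM a b : quo_mul (toquo a) (toquo b) = toquo (a * b).
Proof.
rewrite /quo_mul -lock; apply/toquoP.
have -> : qrepr (toquo a) * qrepr (toquo b) - a * b
    = (qrepr (toquo a) - a) * qrepr (toquo b) + a * (qrepr (toquo b) - b).
  by rewrite mulrBl mulrBr addrA subrK.
by apply: ideal_genD; [apply: ideal_genMr|apply: ideal_genMl];
  apply: repr_toquo.
Qed.

Fact quo_addA : associative quo_add.
Proof.
by elim/quoW=> a; elim/quoW=> b; elim/quoW=> c; rewrite !toquoD addrA.
Qed.
Fact quo_addC : commutative quo_add.
Proof. by elim/quoW=> a; elim/quoW=> b; rewrite !toquoD addrC. Qed.
Fact quo_add0 : left_id (toquo 0) quo_add.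
Proof. by elim/quoW=> a; rewrite !toquoD add0r. Qed.
Fact quo_addN : left_inverse (toquo 0) quo_opp quo_add.
Proof. by elim/quoW=> a; rewrite toquoN toquoD addNr. Qed.
HB.instance Definition _ :=
  GRing.isZmodule.Build quo quo_addA quo_addC quo_add0 quo_addN.

Fact quo_mulA : associative quo_mul.
Proof.
by elim/quoW=> a; elim/quoW=> b; elim/quoW=> c; rewrite !toquoM mulrA.
Qed.
Fact quo_mul1l : left_id (toquo 1) quo_mul.
Proof. by elim/quoW=> a; rewrite toquoM mul1r. Qed.
Fact quo_mul1r : right_id (toquo 1) quo_mul.
Proof. by elim/quoW=> a; rewrite toquoM mulr1. Qed.
Fact quo_mulDl : left_distributive quo_mul quo_add.
Proof.
elim/quoW=> a; elim/quoW=> b; elim/quoW=> c.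
by rewrite !(toquoD, toquoM) mulrDl.
Qed.
Fact quo_mulDr : right_distributive quo_mul quo_add.
Proof.
elim/quoW=> a; elim/quoW=> b; elim/quoW=> c.
by rewrite !(toquoD, toquoM) mulrDr.
Qed.
HB.instance Definition _ := GRing.Zmodule_isPzRing.Build quo
  quo_mulA quo_mul1l quo_mul1r quo_mulDl quo_mulDr.

Fact toquo_zmod_morphism : zmod_morphism toquo.
Proof.
by move=> a b; rewrite [RHS]/GRing.add /= [X in quo_add _ X]toquoN toquoD.
Qed.
HB.instance Definition _ :=
  GRing.isZmodMorphism.Build A quo toquo toquo_zmod_morphism.
Fact toquo_monoid_morphism : monoid_morphism toquo.
Proof. by split=> // a b; rewrite [RHS]/GRing.mul /= toquoM. Qed.
HB.instance Definition _ :=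
  GRing.isMonoidMorphism.Build A quo toquo toquo_monoid_morphism.

Lemma toquo_eq0 s : S s -> toquo s = 0.
Proof. by move=> Ss; apply/toquoP; rewrite subr0; apply: ideal_gen_in. Qed.

(* The map induced on the quotient by a ring morphism killing [S]. *)
Definition quo_lift (B : pzRingType) (f : A -> B) (q : quo) : B := f (qrepr q).

Section QuoLift.
Variables (B : pzRingType) (f : {rmorphism A -> B}).
Hypothesis fS : forall s, S s -> f s = 0.

Lemma quo_liftE a : quo_lift f (toquo a) = f a.
Proof.
have fI s : ideal_gen s -> f s = 0.
  elim=> [||x y _ fx _ fy|x y _ fy|x y _ fx]; first exact: fS.
  - exact: rmorph0.
  - by rewrite rmorphD fx fy addr0.
  - by rewrite rmorphM fy mulr0.
  - by rewrite rmorphM fx mul0r.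
by apply/eqP; rewrite -subr_eq0 -rmorphB fI //; apply: repr_toquo.
Qed.

Fact quo_lift_zmod_morphism : zmod_morphism (quo_lift f).
Proof.
elim/quoW=> a; elim/quoW=> b.
by rewrite -(rmorphB toquo) !quo_liftE rmorphB.
Qed.
Fact quo_lift_monoid_morphism : monoid_morphism (quo_lift f).
Proof.
split; first by rewrite -(rmorph1 toquo) quo_liftE rmorph1.
elim/quoW=> a; elim/quoW=> b.
by rewrite -(rmorphM toquo) !quo_liftE rmorphM.
Qed.
End QuoLift.

End IdealQuotient.

Section CastLalg.
Variables (k : comNzRingType) (L L' : lalgType k) (e : L = L').

Definition cast_lalg (a : L) : L' := ecast A (GRing.Lalgebra.sort A) e a.

Fact cast_lalg_zmod_morphism : zmod_morphism cast_lalg.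
Proof. by rewrite /cast_lalg; case: _ / e. Qed.
Fact cast_lalg_monoid_morphism : monoid_morphism cast_lalg.
Proof. by rewrite /cast_lalg; case: _ / e. Qed.
Fact cast_lalg_scalable : scalable cast_lalg.
Proof. by rewrite /cast_lalg; case: _ / e. Qed.
HB.instance Definition _ :=
  GRing.isZmodMorphism.Build L L' cast_lalg cast_lalg_zmod_morphism.
HB.instance Definition _ :=
  GRing.isMonoidMorphism.Build L L' cast_lalg cast_lalg_monoid_morphism.
HB.instance Definition _ :=
  GRing.isScalable.Build k L L' *:%R cast_lalg cast_lalg_scalable.
End CastLalg.

Lemma cast_lalgK (k : comNzRingType) (L L' : lalgType k) (e : L = L') :
  cancel (cast_lalg e) (cast_lalg (esym e)).
Proof. by case: _ / e. Qed.

(* [freealg k X] is the free associative [k]-algebra on [X].  It is locked, with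
   casts [malg_of] and [of_malg], because unification unfolds the operations of
   [malg] at a prohibitive cost. *)
HB.lock Definition freealg (k : comNzRingType) (X : choiceType) : lalgType k :=
  {malg k[{fmonom X}]}.

Section FreeAlgebra.
Variables (k : comNzRingType) (X : choiceType).
Notation M := {malg k[{fmonom X}]}.

Definition freealg_malg : freealg k X = M :> lalgType k :=
  congr1 (fun A : forall k : comNzRingType, _ -> lalgType k => A k X) freealg.unlock.

Definition malg_of : freealg k X -> M := cast_lalg freealg_malg.
Definition of_malg : M -> freealg k X := cast_lalg (esym freealg_malg).
HB.instance Definition _ := GRing.LRMorphism.on malg_of.
HB.instance Definition _ := GRing.LRMorphism.on of_malg.

Lemma malg_ofK : cancel malg_of of_malg.
Proof. exact: cast_lalgK. Qed.

Lemma of_malgK : cancel of_malg malg_of.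
Proof. by move=> a; rewrite -[RHS](cast_lalgK (esym freealg_malg)) esymK. Qed.

Lemma malg_ofA (c : k) : malg_of c%:A = c%:MP.
Proof. by rewrite linearZ_LR rmorph1 -mul_malgC mulr1. Qed.

Lemma free_scalC (c : k) (a : freealg k X) : c%:A * a = a * c%:A.
Proof.
apply: (can_inj malg_ofK); rewrite !rmorphM /= !malg_ofA mul_malgC.
rewrite malgM_def fgmulgU malgZ_def.
by apply: eq_bigr => w _; rewrite mulm1 mulrC.
Qed.

Definition freegen (x : X) : freealg k X := of_malg << fmu x >>.

Section FreeLift.
Variables (B : pzRingType) (s : {rmorphism k -> B}) (h : X -> B).
Hypothesis sC : forall c b, s c * b = b * s c.

Let hw (w : {fmonom X}) : B := \prod_(x <- (w : seq X)) h x.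

(* The morphism of [k]-algebras sending each [x] to [h x], where [s] is the
   structure map of the [k]-algebra [B]. *)
Definition malg_lift (g : M) : B :=
  \sum_(w <- msupp g) s g@_w * \prod_(x <- (w : seq X)) h x.
Definition free_lift (a : freealg k X) : B := malg_lift (malg_of a).

Lemma malg_liftEw (d : {fset {fmonom X}}) (g : M) :
  (msupp g `<=` d)%fset -> malg_lift g = \sum_(w <- d) s g@_w * hw w.
Proof.
move=> le; rewrite [LHS](big_fset_incl _ le) => //= x xd /mcoeff_outdom ->.
by rewrite rmorph0 mul0r.
Qed.

Lemma malg_liftU (c : k) w : malg_lift << c *g w >> = s c * hw w.
Proof. by rewrite (malg_liftEw msuppU_le) big_seq_fset1 mcoeffUU. Qed.

Fact malg_lift_zmod_morphism : zmod_morphism malg_lift.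
Proof.
move=> g1 g2 /=; pose E := (msupp g1 `|` msupp g2)%fset.
have le1 : (msupp g1 `<=` E)%fset by apply: fsubsetUl.
have le2 : (msupp g2 `<=` E)%fset by apply: fsubsetUr.
have le : (msupp (g1 - g2) `<=` E)%fset by apply: msuppB_le.
rewrite (malg_liftEw le) (malg_liftEw le1) (malg_liftEw le2) -sumrB.
by apply/eq_bigr=> w _; rewrite mcoeffB rmorphB mulrBl.
Qed.
HB.instance Definition _ :=
  GRing.isZmodMorphism.Build M B malg_lift malg_lift_zmod_morphism.

Lemma hwM w1 w2 : hw (mmul w1 w2) = hw w1 * hw w2.
Proof. by rewrite /hw fmM big_cat. Qed.

Lemma malg_liftC c : malg_lift c%:MP = s c.
Proof. by rewrite malg_liftU /hw fm1 big_nil mulr1. Qed.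

Fact malg_lift_monoid_morphism : monoid_morphism malg_lift.
Proof.
split; first by rewrite -mpolyC1E malg_liftC rmorph1.
move=> g1 g2; rewrite malgME raddf_sum mulr_suml /=; apply: eq_bigr=> i _.
rewrite raddf_sum mulr_sumr /=; apply: eq_bigr=> j _.
rewrite malg_liftU rmorphM hwM -[RHS]mulrA -[LHS]mulrA; congr (_ * _).
by rewrite mulrA sC -mulrA sC mulrA.
Qed.

Fact free_lift_zmod_morphism : zmod_morphism free_lift.
Proof. by move=> a b; rewrite /free_lift rmorphB /= raddfB. Qed.

Fact free_lift_monoid_morphism : monoid_morphism free_lift.
Proof.
have [m1 mM] := malg_lift_monoid_morphism.
split; first by rewrite /free_lift rmorph1.
by move=> a b; rewrite /free_lift rmorphM /= mM.
Qed.

Lemma free_liftA c : free_lift c%:A = s c.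
Proof. by rewrite /free_lift malg_ofA malg_liftC. Qed.

Lemma free_lift_gen x : free_lift (freegen x) = h x.
Proof.
by rewrite /free_lift of_malgK malg_liftU /hw fmU big_seq1 rmorph1 mul1r.
Qed.
End FreeLift.

End FreeAlgebra.

Definition ring_char (k : comNzRingType) (p : nat) :=
  forall m : nat, (m%:R == 0 :> k) = (p %| m)%N.

Definition is_basis (k : comNzRingType) (V : lmodType k) r (b : 'I_r -> V) :=
  forall v, exists! c : {ffun 'I_r -> k}, v = \sum_(i < r) c i *: b i.

(* [comp m p] is the homogeneous component of degree [m] and parity [p], with
   [false] for even and [true] for odd. *)
Record gradedSuperalgebra (k : comNzRingType) := GradedSuperalgebra {
  gsa_sort :> algType k;
  comp : nat -> bool -> gsa_sort -> Prop;
  comp0 : forall m p, comp m p 0;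
  compP : forall m p (a : k) f g,
    comp m p f -> comp m p g -> comp m p (a *: f + g);
  comp1 : comp 0%N false 1;
  compM : forall m p m' p' f g,
    comp m p f -> comp m' p' g -> comp (m + m')%N (p (+) p') (f * g);
  comp_sum : forall f, exists N (g : nat -> bool -> gsa_sort),
    (forall m p, comp m p (g m p)) /\
    f = \sum_(m < N) \sum_(p : bool) g m p;
  comp_direct : forall N (g : nat -> bool -> gsa_sort),
    (forall m p, comp m p (g m p)) ->
    \sum_(m < N) \sum_(p : bool) g m p = 0 ->
    forall m p, (m < N)%N -> g m p = 0
}.

(* The map [f |-> (g |-> (-1)^(|f||g|) tr (g f))], extended bilinearly from
   homogeneous elements, is an isomorphism from [F] to its dual. *)
Definition frobenius_form (k : comNzRingType) (F : gradedSuperalgebra k)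
    (tr : {scalar F}) :=
  exists L : F -> F -> k,
  [/\ forall m p m' p' f g, comp m p f -> comp m' p' g ->
        L f g = (-1) ^+ (p && p') * tr (g * f),
      forall f (a : k) g h, L f (a *: g + h) = a * L f g + L f h,
      forall (a : k) f g h, L (a *: f + g) h = a * L f h + L g h
    & forall phi : {scalar F}, exists! f, forall g, L f g = phi g].

Record frobeniusSuperalgebra (k : comNzRingType) := FrobeniusSuperalgebra {
  fsa_gsa :> gradedSuperalgebra k;
  ftr : {scalar fsa_gsa};
  ftr_even : forall m (f : fsa_gsa), comp m true f -> ftr f = 0;
  ftr_homog : exists D, forall m p (f : fsa_gsa),
    comp m p f -> m <> D -> ftr f = 0;
  ftr_frobenius : frobenius_form ftr;
  nakayama : {lrmorphism fsa_gsa -> fsa_gsa};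
  nakayamaP : forall m p m' p' (f g : fsa_gsa),
    comp m p f -> comp m' p' g ->
    ftr (f * g) = (-1) ^+ (p && p') * ftr (g * nakayama f);
  maxdeg : nat;
  maxdeg_ex : exists p (f : fsa_gsa), comp maxdeg p f /\ f <> 0;
  maxdeg_max : forall m p (f : fsa_gsa),
    comp m p f -> f <> 0 -> (m <= maxdeg)%N;
  frank : nat;
  fbasis : 'I_frank -> fsa_gsa;
  fbasis_homog : forall b, exists m p, comp m p (fbasis b);
  fbasisP : is_basis fbasis;
  fdual : 'I_frank -> fsa_gsa;
  fdualP : forall b c, ftr (fdual b * fbasis c) = (b == c)%:R
}.

Section FrobeniusNotions.
Variables (k : comNzRingType) (F : frobeniusSuperalgebra k).

Definition nakayama_order (theta : nat) :=
  [/\ (0 < theta)%N,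
      forall f : F, iter theta (nakayama F) f = f
    & forall m, (0 < m < theta)%N ->
        ~ (forall f : F, iter m (nakayama F) f = f)].

Definition nakayama_diagonalizable :=
  exists r (e : 'I_r -> F),
    is_basis e /\ forall i, exists a : k, nakayama F (e i) = a *: e i.

(* Homogeneous elements [f] of parity [p] lying in $F^{(j)}$. *)
Definition twisted_central (j : nat) (p : bool) (f : F) :=
  (exists m, comp m p f) /\
  forall m q (g : F), comp m q g ->
    g * f = (-1) ^+ (p && q) *: (f * iter j (nakayama F) g).

(* The entries of [C j], for [1 <= j <= theta], are the elements
   $\mathbf{c}^{(j,1)}, \dots, \mathbf{c}^{(j,e_j)}$; the other values of [C]
   play no role. *)
Definition cyclotomic_datum (theta : nat) (C : nat -> seq F) :=
  forall j c, (0 < j <= theta)%N -> c \in C j ->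
    [/\ comp (j * maxdeg F)%N false c,
        twisted_central j false c
      & nakayama F c = c].

Definition level (theta : nat) (C : nat -> seq F) : nat :=
  (\sum_(1 <= j < theta.+1) j * size (C j))%N.

End FrobeniusNotions.

Section AffineWreath.
Variables (k : comNzRingType) (F : frobeniusSuperalgebra k).

(* The generators of [A_n(F)]: the [x_i], the pure tensors of $F^{\otimes n}$
   (given by their factors) and the permutations. *)
Definition gen (n : nat) : choiceType :=
  ('I_n + ({ffun 'I_n -> F} + {perm 'I_n}))%type.

Definition gen_x n (i : 'I_n) : gen n := inl i.
Definition gen_ten n (f : {ffun 'I_n -> F}) : gen n := inr (inl f).
Definition gen_perm n (s : {perm 'I_n}) : gen n := inr (inr s).

Definition upd n (f : {ffun 'I_n -> F}) (i : 'I_n) (u : F) :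
  {ffun 'I_n -> F} := [ffun l => if l == i then u else f l].

(* $f_i = 1^{\otimes (i-1)} \otimes f \otimes 1^{\otimes (n-i)}$ *)
Definition gen_at n (i : 'I_n) (f : F) : gen n :=
  gen_ten (upd [ffun => 1] i f).

(* The parities [p] and [q] of the factors of two pure tensors: the sign of
   moving each factor of the second past the later factors of the first. *)
Definition ten_sign n (p q : 'I_n -> bool) : k :=
  \prod_(i < n) \prod_(j < n | (i < j)%N) (-1) ^+ (p j && q i).

(* The sign with which [s] superpermutes factors of parities [p]. *)
Definition perm_sign n (s : {perm 'I_n}) (p : 'I_n -> bool) : k :=
  \prod_(i < n) \prod_(j < n | (i < j)%N && (s j < s i)%N)
     (-1) ^+ (p i && p j).

Definition parities n (p : 'I_n -> bool) (f : {ffun 'I_n -> F}) :=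
  forall i, exists m, comp m (p i) (f i).

Section Relators.
Variable n : nat.
Notation FA := (freealg k (gen n)).
Notation X i := (freegen k (gen_x i) : FA).
Notation T f := (freegen k (gen_ten f) : FA).
Notation P s := (freegen k (gen_perm s) : FA).
Notation at_ i f := (freegen k (gen_at i f) : FA).

Definition teleporter (i j : 'I_n) : FA :=
  \sum_(b < frank F) at_ i (fbasis b) * at_ j (fdual b).

(* Differences of the two sides of the defining relations.  [rel_xC] presents
   $k[x_1,\dots,x_n]$; [rel_tenL], [rel_ten1] and [rel_tenM] present
   $F^{\otimes n}$; [rel_perm1] and [rel_permM] present $k S_n$.  Products of
   permutations in the library are composed from left to right, so the product
   of [s] and [t] in $S_n$ is [(t * s)%g]. *)
Inductive affine_rel : FA -> Prop :=
| rel_xC i j : affine_rel (X i * X j - X j * X i)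
| rel_tenL f i (a : k) u v :
    affine_rel (T (upd f i (a *: u + v))
                - (a *: T (upd f i u) + T (upd f i v)))
| rel_ten1 : affine_rel (T [ffun => 1] - 1)
| rel_tenM p q f g : parities p f -> parities q g ->
    affine_rel (T f * T g - ten_sign p q *: T [ffun i => f i * g i])
| rel_perm1 : affine_rel (P 1%g - 1)
| rel_permM s t : affine_rel (P s * P t - P (t * s)%g)
| rel_ten_x f i : affine_rel (T f * X i - X i * T (upd f i (nakayama F (f i))))
| rel_sx_far (i i' j : 'I_n) : i' = i.+1 :> nat -> j != i -> j != i' ->
    affine_rel (P (tperm i i') * X j - X j * P (tperm i i'))
| rel_sx (i i' : 'I_n) : i' = i.+1 :> nat ->
    affine_rel (P (tperm i i') * X i
                - (X i' * P (tperm i i') - teleporter i i'))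
| rel_perm_ten s p f : parities p f ->
    affine_rel (P s * T f
                - perm_sign s p *: (T [ffun i => f (s^-1%g i)] * P s)).

End Relators.

Definition affine n := quo (@affine_rel n).
HB.instance Definition _ n := GRing.PzRing.on (affine n).

Definition affine_gen n (g : gen n) : affine n :=
  toquo (@affine_rel n) (freegen k g).

Variables (theta : nat) (C : nat -> seq F).

Definition chi n (i : 'I_n) : affine n :=
  \prod_(1 <= j < theta.+1) \prod_(c <- C j)
     (affine_gen (gen_x i) ^+ j - affine_gen (gen_at i c)).

(* For [n = 0] there is no relation, and the quotient is [A_0(F) = k]. *)
Definition cyc_rel n : affine n -> Prop :=
  fun a => exists2 i : 'I_n, i = 0 :> nat & a = chi i.

Definition cyclotomic n := quo (@cyc_rel n).
HB.instance Definition _ n := GRing.PzRing.on (cyclotomic n).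

Definition cyc_gen n (g : gen n) : cyclotomic n :=
  toquo (@cyc_rel n) (affine_gen g).

(* The structure map of the [k]-algebra [cyclotomic n]. *)
Definition cyc_scal n (a : k) : cyclotomic n :=
  toquo (@cyc_rel n) (toquo (@affine_rel n) (a%:A)).

(* The grading: the homogeneous components are the smallest additive subgroups
   containing the homogeneous generators and the scalars, and compatible with
   products. *)
Inductive cyc_comp n : int -> bool -> cyclotomic n -> Prop :=
| cyc_comp_x i : cyc_comp (maxdeg F)%:Z false (cyc_gen (gen_x i))
| cyc_comp_ten (m : 'I_n -> nat) p (f : {ffun 'I_n -> F}) :
    (forall i, comp (m i) (p i) (f i)) ->
    cyc_comp (\sum_(i < n) m i)%N%:Z (\big[addb/false]_(i < n) p i)
      (cyc_gen (gen_ten f))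
| cyc_comp_perm s : cyc_comp 0 false (cyc_gen (gen_perm s))
| cyc_comp_scal a : cyc_comp 0 false (cyc_scal n a)
| cyc_comp0 m p : cyc_comp m p 0
| cyc_compD m p a b : cyc_comp m p a -> cyc_comp m p b -> cyc_comp m p (a + b)
| cyc_compM m p m' p' a b : cyc_comp m p a -> cyc_comp m' p' b ->
    cyc_comp (m + m') (p (+) p') (a * b).

Definition ten_widen n (f : {ffun 'I_n -> F}) : {ffun 'I_n.+1 -> F} :=
  [ffun j => if unlift ord_max j is Some i then f i else 1].

Definition gen_widen n (g : gen n) : gen n.+1 :=
  match g with
  | inl i => gen_x (lift ord_max i)
  | inr (inl f) => gen_ten (ten_widen f)
  | inr (inr s) => gen_perm (lift_perm ord_max ord_max s)
  end.

Definition free_incl n : freealg k (gen n) -> freealg k (gen n.+1) :=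
  free_lift (in_alg (freealg k (gen n.+1))) (fun g => freegen k (gen_widen g)).

HB.instance Definition _ n := GRing.isZmodMorphism.Build _ _ (@free_incl n)
  (free_lift_zmod_morphism _ _).
HB.instance Definition _ n := GRing.isMonoidMorphism.Build _ _ (@free_incl n)
  (free_lift_monoid_morphism _ (@free_scalC k _ : forall c b, in_alg _ c * b = b * in_alg _ c)).

Lemma free_incl_gen n g : @free_incl n (freegen k g) = freegen k (gen_widen g).
Proof. exact: free_lift_gen. Qed.

Lemma free_inclA n (a : k) : @free_incl n a%:A = a%:A.
Proof. exact: free_liftA. Qed.

Lemma free_inclM n : {morph @free_incl n : a b / a * b}.
Proof. exact: rmorphM. Qed.

Lemma free_inclB n : {morph @free_incl n : a b / a - b}.
Proof. exact: rmorphB. Qed.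

Lemma free_inclD n : {morph @free_incl n : a b / a + b}.
Proof. exact: rmorphD. Qed.

Lemma free_incl1 n : @free_incl n 1 = 1.
Proof. exact: rmorph1. Qed.

Lemma free_inclZ n (a : k) b : @free_incl n (a *: b) = a *: free_incl b.
Proof. by rewrite -mulr_algl free_inclM free_inclA mulr_algl. Qed.

Lemma ten_widen_lift n (f : {ffun 'I_n -> F}) i :
  ten_widen f (lift ord_max i) = f i.
Proof. by rewrite ffunE liftK. Qed.

Lemma ten_widen_max n (f : {ffun 'I_n -> F}) : ten_widen f ord_max = 1.
Proof. by rewrite ffunE unlift_none. Qed.

Lemma eq_ten_widen n (f : {ffun 'I_n -> F}) (g : {ffun 'I_n.+1 -> F}) :
  (forall i, g (lift ord_max i) = f i) -> g ord_max = 1 -> ten_widen f = g.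
Proof.
move=> gl gm; apply/ffunP => j; case: (unliftP ord_max j) => [i ->|->].
  by rewrite ten_widen_lift gl.
by rewrite ten_widen_max gm.
Qed.

Lemma ten_widen_upd n (f : {ffun 'I_n -> F}) i u :
  ten_widen (upd f i u) = upd (ten_widen f) (lift ord_max i) u.
Proof.
apply: eq_ten_widen => [j|]; last first.
  by rewrite ffunE ten_widen_max (negPf (neq_lift _ _)).
by rewrite !ffunE liftK (inj_eq lift_inj).
Qed.

Lemma ten_widen1 n : ten_widen [ffun => 1 : F] = [ffun => 1] :> {ffun 'I_n.+1 -> F}.
Proof. by apply: eq_ten_widen => [j|]; rewrite !ffunE. Qed.

Lemma gen_widen_at n (i : 'I_n) (f : F) :
  gen_widen (gen_at i f) = gen_at (lift ord_max i) f.
Proof. by rewrite /gen_at /= ten_widen_upd ten_widen1. Qed.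

Definition par_widen n (p : 'I_n -> bool) (j : 'I_n.+1) : bool :=
  if unlift ord_max j is Some i then p i else false.

Lemma par_widen_lift n (p : 'I_n -> bool) i :
  par_widen p (lift ord_max i) = p i.
Proof. by rewrite /par_widen liftK. Qed.

Lemma par_widen_max n (p : 'I_n -> bool) : par_widen p ord_max = false.
Proof. by rewrite /par_widen unlift_none. Qed.

Lemma parities_widen n p (f : {ffun 'I_n -> F}) :
  parities p f -> parities (par_widen p) (ten_widen f).
Proof.
move=> pf j; case: (unliftP ord_max j) => [i ->|->].
  by rewrite par_widen_lift ten_widen_lift.
by exists 0%N; rewrite par_widen_max ten_widen_max; apply: comp1.
Qed.

Lemma big_lift_max n (P : pred 'I_n.+1) (E : 'I_n.+1 -> k) :
  \prod_(i < n.+1 | P i) E i =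
  (\prod_(i < n | P (lift ord_max i)) E (lift ord_max i)) *
  (if P ord_max then E ord_max else 1).
Proof.
rewrite big_mkcond big_ord_recr /= [in RHS]big_mkcond; congr (_ * _).
have w (i : 'I_n) : widen_ord (leqnSn n) i = lift ord_max i.
  by apply: val_inj; rewrite /= /bump leqNgt ltn_ord.
by apply: eq_bigr => i _; rewrite w.
Qed.

Lemma ltn_lift_max n (i j : 'I_n) :
  (lift ord_max i < lift ord_max j)%N = (i < j)%N.
Proof. by rewrite !lift_max. Qed.

Lemma ten_sign_widen n (p q : 'I_n -> bool) :
  ten_sign (par_widen p) (par_widen q) = ten_sign p q.
Proof.
rewrite /ten_sign big_lift_max /= [X in _ * X]big1 ?mulr1 => [|j _]; last first.
  by rewrite par_widen_max andbF.
apply: eq_bigr => i _; rewrite big_lift_max par_widen_max /=.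
rewrite (fun_if (fun x => _ * x)) mulr1 if_same.
by apply: eq_big => [j|j _]; rewrite ?ltn_lift_max ?par_widen_lift.
Qed.

Lemma perm_sign_widen n (s : {perm 'I_n}) (p : 'I_n -> bool) :
  perm_sign (lift_perm ord_max ord_max s) (par_widen p) = perm_sign s p.
Proof.
rewrite /perm_sign big_lift_max /= [X in _ * X]big1 ?mulr1 => [|j _]; last first.
  by rewrite par_widen_max.
apply: eq_bigr => i _; rewrite big_lift_max par_widen_max andbF /=.
rewrite (fun_if (fun x => _ * x)) mulr1 if_same.
by apply: eq_big => [j|j _]; rewrite ?lift_perm_lift ?ltn_lift_max ?par_widen_lift.
Qed.

Lemma lift_tperm_max n (i j : 'I_n) :
  lift_perm ord_max ord_max (tperm i j) =
  tperm (lift ord_max i) (lift ord_max j).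
Proof.
apply/permP => l; case: (unliftP ord_max l) => [m ->|->].
  by rewrite lift_perm_lift (inj_tperm _ _ _ (@lift_inj _ _)).
by rewrite lift_perm_id tpermD // eq_sym neq_lift.
Qed.

Lemma teleporter_widen n (i j : 'I_n) :
  free_incl (teleporter i j) = teleporter (lift ord_max i) (lift ord_max j).
Proof.
rewrite /teleporter rmorph_sum; apply: eq_bigr => b _.
by rewrite /= free_inclM !free_incl_gen !gen_widen_at.
Qed.

Lemma affine_rel_incl n a : @affine_rel n a -> affine_rel (free_incl a).
Proof.
case=> {a}.
- by move=> i j; rewrite free_inclB !free_inclM !free_incl_gen; apply: rel_xC.
- move=> f i a u v; rewrite free_inclB free_inclD free_inclZ !free_incl_gen /=.
  by rewrite !ten_widen_upd; apply: rel_tenL.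
- by rewrite free_inclB free_incl1 free_incl_gen /= ten_widen1; apply: rel_ten1.
- move=> p q f g pf qg.
  rewrite free_inclB free_inclM free_inclZ !free_incl_gen /= -ten_sign_widen.
  rewrite (_ : ten_widen [ffun i => f i * g i] =
    [ffun i => ten_widen f i * ten_widen g i]).
    by apply: rel_tenM; apply: parities_widen.
  apply: eq_ten_widen => [i|].
    by rewrite [LHS]ffunE !ten_widen_lift !ffunE.
  by rewrite ffunE !ten_widen_max mulr1.
- by rewrite free_inclB free_incl1 free_incl_gen /= lift_perm1; apply: rel_perm1.
- move=> s t; rewrite free_inclB free_inclM !free_incl_gen /=.
  by rewrite -(lift_permM _ ord_max); apply: rel_permM.
- move=> f i; rewrite free_inclB !free_inclM !free_incl_gen /= ten_widen_upd.
  by rewrite -(ten_widen_lift f i); apply: rel_ten_x.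
- move=> i i' j ii' ji ji'; rewrite free_inclB !free_inclM !free_incl_gen /=.
  by rewrite lift_tperm_max; apply: rel_sx_far;
    rewrite ?lift_max ?(inj_eq lift_inj).
- move=> i i' ii'; rewrite !free_inclB !free_inclM !free_incl_gen /=.
  rewrite lift_tperm_max teleporter_widen; apply: rel_sx.
  by rewrite !lift_max.
- move=> s p f pf; rewrite free_inclB free_inclM free_inclZ free_inclM.
  rewrite /= !free_incl_gen /= -perm_sign_widen.
  rewrite (_ : ten_widen [ffun i => f (s^-1%g i)] =
    [ffun i => ten_widen f ((lift_perm ord_max ord_max s)^-1%g i)]).
    by apply: rel_perm_ten; apply: parities_widen.
  apply: eq_ten_widen => [i|]; rewrite ffunE lift_permV.
    by rewrite lift_perm_lift ten_widen_lift ffunE.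
  by rewrite lift_perm_id ten_widen_max.
Qed.

Definition affine_incl n : affine n -> affine n.+1 :=
  quo_lift (toquo (@affine_rel n.+1) \o @free_incl n).

Lemma affine_incl_subproof n a :
  @affine_rel n a -> (toquo (@affine_rel n.+1) \o @free_incl n) a = 0.
Proof. by move=> Ra; apply/toquo_eq0/affine_rel_incl. Qed.

HB.instance Definition _ n := GRing.isZmodMorphism.Build _ _ (@affine_incl n)
  (quo_lift_zmod_morphism (@affine_incl_subproof n)).
HB.instance Definition _ n := GRing.isMonoidMorphism.Build _ _ (@affine_incl n)
  (quo_lift_monoid_morphism (@affine_incl_subproof n)).

Lemma affine_incl_gen n g :
  affine_incl (@affine_gen n g) = affine_gen (gen_widen g).
Proof.
rewrite /affine_incl (quo_liftE (@affine_incl_subproof n)) /=.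
by rewrite free_incl_gen.
Qed.

Lemma chi_incl n (i : 'I_n) : affine_incl (chi i) = chi (lift ord_max i).
Proof.
rewrite /chi rmorph_prod; apply: eq_bigr => j _; rewrite rmorph_prod.
apply: eq_bigr => c _; rewrite rmorphB rmorphXn /= !affine_incl_gen.
by rewrite gen_widen_at.
Qed.

Definition cyc_incl n : cyclotomic n -> cyclotomic n.+1 :=
  quo_lift (toquo (@cyc_rel n.+1) \o @affine_incl n).

Lemma cyc_incl_subproof n a :
  @cyc_rel n a -> (toquo (@cyc_rel n.+1) \o @affine_incl n) a = 0.
Proof.
move=> [i i0 ->]; apply: toquo_eq0; exists (lift ord_max i).
  by rewrite lift_max.
exact: chi_incl.
Qed.

HB.instance Definition _ n := GRing.isZmodMorphism.Build _ _ (@cyc_incl n)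
  (quo_lift_zmod_morphism (@cyc_incl_subproof n)).
HB.instance Definition _ n := GRing.isMonoidMorphism.Build _ _ (@cyc_incl n)
  (quo_lift_monoid_morphism (@cyc_incl_subproof n)).

Lemma cyc_incl_gen n g : cyc_incl (@cyc_gen n g) = cyc_gen (gen_widen g).
Proof.
rewrite /cyc_incl (quo_liftE (@cyc_incl_subproof n)) /=.
by rewrite affine_incl_gen.
Qed.

Lemma cyc_incl_scal n a : cyc_incl (cyc_scal n a) = cyc_scal n.+1 a.
Proof.
rewrite /cyc_incl (quo_liftE (@cyc_incl_subproof n)) /=.
rewrite /affine_incl (quo_liftE (@affine_incl_subproof n)) /=.
by rewrite free_inclA.
Qed.

Inductive add_span (V : nmodType) (P : V -> Prop) : V -> Prop :=
| add_span0 : add_span P 0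
| add_spanD u v : P u -> add_span P v -> add_span P (u + v).

Section Trace.
Variable n : nat.
Notation R := (cyclotomic n).
Notation A := (cyclotomic n.+1).
Notation x := (cyc_gen (gen_x ord_max) : A).
Notation at_ f := (cyc_gen (gen_at ord_max f) : A).
Notation iota := (@cyc_incl n).

(* $x_{n+1}^a F_{n+1} \mathcal{A}_n^{\mathbf{C}}(F)$ *)
Definition x_summand (a : nat) : A -> Prop :=
  add_span (fun z => exists (f : F) (y : R), z = x ^+ a * at_ f * iota y).

(* $\mathcal{A}_n^{\mathbf{C}}(F) s_n \mathcal{A}_n^{\mathbf{C}}(F)$; zero for
   [n = 0], since then there is no [i]. *)
Definition s_summand : A -> Prop :=
  add_span (fun z => exists (i : 'I_n.+1) (y y' : R), i.+1 = n :> nat /\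
    z = iota y * cyc_gen (gen_perm (tperm i ord_max)) * iota y').

(* [r] is obtained from [a] by projecting onto the summand of exponent [d - 1]
   of the decomposition of [A], followed by
   $x_{n+1}^{d-1} f_{n+1} y \mapsto \operatorname{tr}(f) y$. *)
Definition trace_graph (a : A) (r : R) : Prop :=
  let d := level theta C in
  exists (N : nat) (f : 'I_N -> F) (y : 'I_N -> R) (l : nat -> A) (w : A),
  [/\ forall b, (b < d.-1)%N -> x_summand b (l b),
      s_summand w,
      a = \sum_(i < N) x ^+ d.-1 * at_ (f i) * iota (y i)
          + \sum_(b < d.-1) l b + w
    & r = \sum_(i < N) cyc_scal n (ftr F (f i)) * y i].

(* $\operatorname{tr}^{\mathbf{C}}_{n+1}$, by choice of a value: the
   decomposition makes [trace_graph] the graph of a function. *)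
Definition cyc_trace (a : A) : R := xget 0 [set r | trace_graph a r]%classic.

End Trace.

End AffineWreath.

(* [A] is a Frobenius extension of its subalgebra [R] (embedded by [iota]) with
   trace map [T]; [algR] and [algA] are the structure maps of these graded
   [k]-superalgebras, and [compR] and [compA] their gradings. *)
Definition frobenius_extension (k : comNzRingType) (R A : pzRingType)
    (algR : k -> R) (algA : k -> A)
    (compR : int -> bool -> R -> Prop) (compA : int -> bool -> A -> Prop)
    (iota : {rmorphism R -> A}) (T : A -> R) : Prop :=
  [/\ [/\ injective iota,
          forall c, iota (algR c) = algA c
        & forall m p r, compR m p r -> compA m p (iota r)],
      (forall a b, T (a + b) = T a + T b) /\
      (forall r a s, T (iota r * a * iota s) = r * T a * s),
      exists e : int, forall m p a, compA m p a -> compR (m + e) p (T a)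
    & exists (N : nat) (u v : 'I_N -> A),
      [/\ forall i, exists m p, compA m p (u i),
          forall i, exists m p, compA m p (v i),
          forall a, a = \sum_(i < N) u i * iota (T (v i * a))
        & forall a, a = \sum_(i < N) iota (T (a * u i)) * v i]].

(* Main.v *)
From HB Require Import structures.
Require Import Defs.
From mathcomp Require Import all_boot all_order all_fingroup all_algebra.
From mathcomp Require Import finmap zify.
From mathcomp Require Import boolp classical_sets functions.
From mathcomp.multinomials Require Import monalg.

Set Implicit Arguments.
Unset Strict Implicit.
Unset Printing Implicit Defensive.

Import GRing.Theory.
Local Open Scope ring_scope.

(** Write [A_n] for the affine wreath product algebra on [n] strands, [R] for
    its cyclotomic quotient, [d] for the level, [delta] for the top degree of
    [F], and [tau_j] for the transposition of [j] and [n+1].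

    The main point is to construct an additive map [T] from [A_(n+1)] to [R]
    that is linear over [A_n] on both sides, kills the ideal generated by
    [chi], and satisfies [T (x_(n+1)^a f_(n+1)) = tr f] for [a = d - 1], [= 0]
    for [a < d - 1], and [T tau_j = 0] for [j <= n] ([affine_trace]). It
    induces a bimodule map on the cyclotomic quotient. The quotient is spanned
    as a bimodule by the elements [x_(n+1)^a f_(n+1)] with [a < d] and the
    [tau_j] ([bifil_d]); since [T] has the right values on them, the relation
    that defines the trace of the theorem is the graph of [T] ([cyc_traceE]).
    In particular this argument proves that the projection is well defined.

    Left linear maps out of [A_(n+1)] are matrix coefficients of a module.
    The symmetric group [S_(n+1)] acts on the functions [phi] from [S_(n+1)] to
    the linear maps from [k[x] (x) F] to [R]. On these functions there are
    operators [y_i] that are permuted by the group without correction terms,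
    and [y_i] minus a Jucys-Murphy element gives an action of [x_i]. The only
    relation that needs work is that the [x_i] commute. It amounts to a
    quadratic relation for the [y_i] ([mYY]), verified by an expansion that
    uses the relations between two teleporters. For an [S_n]-equivariant
    [phi], the evaluation of [a phi] at the identity and at [1 (x) 1] is linear
    over [A_n] in [a], and its value on [x_(n+1)^a f_(n+1) tau_j] is the value
    of [phi (tau_j)] at [x^a (x) f], which is arbitrary ([functional_top]). So
    these elements behave like a basis of [A_(n+1)] over [A_n], and by
    triangularity so does every family with the same leading terms ([solve]).

    The family used consists of the elements [tau_j x_j^a f_j] for [j <= n] or
    [a < d], and of [z_(a,f) = tau_1 chi x_1^a f_1 tau_1], which leads with
    [x_(n+1)^(d+a) f_(n+1)]. On the latter [T] is prescribed to be zero. Right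
    linearity is checked on the generators of [A_n]; permutations and tensors
    commute with [z_(a,f)] up to sign, and the commutator of [z_(a,f)] with
    [x_1] consists of teleporter terms on which [T] vanishes
    ([atrace_zgen_x]). As [T] vanishes on [z_(a,f)], it kills the ideal of
    [chi] ([atrace_ideal]).

    Dual bases come from the elements [u = tau_j b_(n+1) x_(n+1)^a] and
    [v = x_(n+1)^(d-1-a) b^vee_(n+1) tau_j], with [j <= n+1], [a < d] and [b] in
    the basis of [F]. The first family spans the quotient over [R] on one side,
    the second one on the other side, and the matrix of the elements [T (v u)]
    is unitriangular for the order of the exponents ([gram_unitriangular]).
    Inverting it turns the [v] into a family dual to the [u]. *)

(** * The Frobenius superalgebra *)

Section FrobeniusAlgebra.
Variables (k : comNzRingType) (F : frobeniusSuperalgebra k).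
Local Notation homog := (@Defs.comp k F).
Local Notation tr := (ftr F).
Local Notation r := (frank F).
Local Notation bas := (@fbasis k F).
Local Notation dual := (@fdual k F).
Local Notation psi := (nakayama F).
Local Notation delta := (maxdeg F).
Implicit Types (f g h : F) (b c : 'I_r) (m : nat) (p q : bool).

Definition coord b f : k := tr (dual b * f).

Lemma coordP f : f = \sum_b coord b f *: bas b.
Proof.
have [a [fE _]] := fbasisP f; rewrite {1}fE; apply: eq_bigr => b _.
congr (_ *: _); rewrite /coord fE mulr_sumr linear_sum (bigD1 b) //=.
rewrite -scalerAr linearZ /= fdualP eqxx mulr1 big1 ?addr0 // => c cb.
by rewrite -scalerAr linearZ /= fdualP eq_sym (negPf cb) mulr0.
Qed.

Fact coord_is_linear b : linear_for *%R (coord b).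
Proof. by move=> a f g; rewrite /coord mulrDr -scalerAr linearP. Qed.
HB.instance Definition _ b :=
  GRing.isLinear.Build k F k *%R (coord b) (coord_is_linear b).

Lemma coord_fbasis b c : coord c (bas b) = (c == b)%:R.
Proof. by rewrite /coord fdualP. Qed.

Lemma homogD m p f g : homog m p f -> homog m p g -> homog m p (f + g).
Proof. by move=> Hf Hg; rewrite -[f]scale1r; apply: compP. Qed.

Lemma homogZ m p (a : k) f : homog m p f -> homog m p (a *: f).
Proof. by move=> Hf; rewrite -[_ *: f]addr0; apply: compP (comp0 _ _ _). Qed.

Lemma homogN m p f : homog m p f -> homog m p (- f).
Proof. by move=> Hf; rewrite -scaleN1r; apply: homogZ. Qed.

Lemma homog_big m p (I : Type) (s : seq I) (P : pred I) (E : I -> F) :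
  (forall i, P i -> homog m p (E i)) -> homog m p (\sum_(i <- s | P i) E i).
Proof.
by move=> HE; elim/big_rec: _ => [|i x Pi Hx]; [apply: comp0|apply: homogD Hx; apply: HE].
Qed.

(** By [comp_sum] every element is a finite sum of homogeneous ones. *)
Lemma homog_ind (P : F -> Prop) :
  P 0 -> (forall m p f g, homog m p f -> P g -> P (f + g)) -> forall f, P f.
Proof.
move=> P0 PD f; have [N [g [Hg ->]]] := comp_sum f.
elim/big_rec: _ => [//|i x _ Px]; rewrite big_bool -addrA.
by apply: (PD _ _ _ _ (Hg _ _)); apply: (PD _ _ _ _ (Hg _ _)).
Qed.

Lemma ftr_parity m p m' p' f g :
  homog m p f -> homog m' p' g -> p != p' -> tr (f * g) = 0.
Proof.
move=> Hf Hg pp; apply: (@ftr_even _ F (m + m')%N).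
by have := compM Hf Hg; rewrite -[p (+) p']negbK -addNb; case: p p' pp {Hf Hg} => [] [].
Qed.

(** Because [tr] is even, the form [L] of the Frobenius condition satisfies [L
    f g = (-1) ^+ p * tr (g * f)] for [f] of parity [p] and all [g]. Hence [L
    f h = 0] for all [f], and [h] is zero because each of its coordinates is a
    functional of the form [L f]. *)
Lemma ftr_nondeg h : (forall f, tr (h * f) = 0) -> h = 0.
Proof.
move=> h0; have [L [LE LrP LlP Lex]] := ftr_frobenius F.
have Lr0 f : L f 0 = 0.
  by have := LrP f (-1) 0 0; rewrite scaler0 addr0 mulN1r addNr.
have LrD f g g' : L f (g + g') = L f g + L f g'.
  by rewrite -[g in LHS]scale1r LrP mul1r.
have Ll0 f : L 0 f = 0.
  by have := LlP (-1) 0 0 f; rewrite scaler0 addr0 mulN1r addNr.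
have LlD f f' g : L (f + f') g = L f g + L f' g.
  by rewrite -[f in LHS]scale1r LlP mul1r.
have LH m p f g : homog m p f -> L f g = (-1) ^+ p * tr (g * f).
  move=> Hf; elim/homog_ind: g => [|m' p' g g' Hg IH].
    by rewrite Lr0 mul0r linear0 mulr0.
  rewrite LrD IH (LE _ _ _ _ _ _ Hf Hg) mulrDl linearD mulrDr; congr (_ + _).
  have [->|np] := eqVneq p p'; first by rewrite andbb.
  by rewrite (ftr_parity Hg Hf) 1?eq_sym // !mulr0.
have Lh f : L f h = 0.
  elim/homog_ind: f => [|m p f f' Hf IH]; first exact: Ll0.
  by rewrite LlD IH (LH _ _ _ _ Hf) h0 mulr0 addr0.
rewrite (coordP h) big1 // => b _.
have [f [fE _]] := Lex (coord b); have := fE h; rewrite Lh => /esym /= c0.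
by rewrite (_ : coord b h = 0) ?scale0r.
Qed.

Lemma fbasis_neq0 b : bas b <> 0.
Proof.
move=> b0; have := fdualP b b; rewrite b0 mulr0 linear0 eqxx => /esym /eqP.
by rewrite oner_eq0.
Qed.

Lemma ftr_nondeg_homog f : f <> 0 ->
  exists m p g, homog m p g /\ tr (f * g) <> 0.
Proof.
move=> f0; apply: contrapT => ne; apply: f0; apply: ftr_nondeg => g.
elim/homog_ind: g => [|m p g g' Hg IH]; first by rewrite mulr0 linear0.
rewrite mulrDr linearD IH addr0; apply: contrapT => t0.
by apply: ne; exists m, p, g.
Qed.

(** The trace lives in the top degree: an element of top degree pairs
    nontrivially with something homogeneous, which must have degree [0] for
    the product to be nonzero. *)
Lemma ftr_maxdeg m p f : homog m p f -> m <> delta -> tr f = 0.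
Proof.
have [D HD] := ftr_homog F; suff -> : delta = D by apply: HD.
have [q [g [Hg /ftr_nondeg_homog[m' [p' [h [Hh t0]]]]]]] := maxdeg_ex F.
have Hgh := compM Hg Hh.
have ED : (delta + m')%N = D by apply: contrapT => /(HD _ _ _ Hgh).
rewrite -ED; suff -> : m' = 0%N by rewrite addn0.
have gh0 : g * h <> 0 by move=> gh0; apply: t0; rewrite gh0 linear0.
by have := maxdeg_max Hgh gh0; rewrite -{2}[delta]addn0 leq_add2l leqn0 => /eqP.
Qed.

Lemma ftr_pair m p m' p' f g : homog m p f -> homog m' p' g ->
  ~~ ((m + m' == delta)%N && (p == p')) -> tr (f * g) = 0.
Proof.
move=> Hf Hg; rewrite negb_and => /orP[/eqP ne|ne].
  exact: ftr_maxdeg (compM Hf Hg) ne.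
exact: ftr_parity Hf Hg ne.
Qed.

Lemma fbasis_homog_sig b : {mp : nat * bool | homog mp.1 mp.2 (bas b)}.
Proof.
by apply: cid; have [m [p Hb]] := fbasis_homog b; exists (m, p).
Qed.

Definition fdeg b : nat := (sval (fbasis_homog_sig b)).1.
Definition fpar b : bool := (sval (fbasis_homog_sig b)).2.

Lemma fbasisH b : homog (fdeg b) (fpar b) (bas b).
Proof. exact: svalP (fbasis_homog_sig b). Qed.

Lemma fdeg_le b : (fdeg b <= delta)%N.
Proof. exact: maxdeg_max (fbasisH b) (@fbasis_neq0 b). Qed.

Lemma ftr_eq f g : (forall b, tr (f * bas b) = tr (g * bas b)) -> f = g.
Proof.
move=> E; apply/eqP; rewrite -subr_eq0; apply/eqP/ftr_nondeg => h.
rewrite (coordP h) mulr_sumr linear_sum big1 // => b _.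
by rewrite -scalerAr linearZ /= mulrBl linearB E /= subrr mulr0.
Qed.

(** By nondegeneracy [dual b] equals its component of the degree and parity
    complementary to those of [b]. *)
Lemma fdualH b : homog (delta - fdeg b) (fpar b) (dual b).
Proof.
have [N [g [Hg gE]]] := comp_sum (dual b); set m := (delta - fdeg b)%N.
pose e := if (m < N)%N then g m (fpar b) else 0.
have He : homog m (fpar b) e.
  by rewrite /e; case: ifP => _; [apply: Hg|apply: comp0].
suff -> : dual b = e by [].
apply: ftr_eq => c.
case: (boolP ((fdeg c == fdeg b) && (fpar c == fpar b))) => [/andP[/eqP dc /eqP pc]|ne].
  rewrite gE mulr_suml linear_sum /=.
  have t0 i j : ~~ ((i == m) && (j == fpar b)) -> tr (g i j * bas c) = 0.
    move=> nij; apply: (ftr_pair (Hg i j) (fbasisH c)).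
    apply: contra nij; rewrite pc => /andP[/eqP si ->]; rewrite andbT.
    by apply/eqP; rewrite /m -si dc addnK.
  rewrite /e; case: ltnP => mN.
    rewrite (bigD1 (Ordinal mN)) //= [X in _ + X]big1 ?addr0 => [|i /eqP im].
      rewrite mulr_suml linear_sum (bigD1 (fpar b)) //= big1 ?addr0 // => j jb.
      by apply: t0; rewrite eqxx.
    rewrite mulr_suml linear_sum big1 // => j _; apply: t0.
    apply/negP => /andP[/eqP E _]; apply: im; exact: val_inj.
  rewrite big1 ?mul0r ?linear0 // => i _.
  rewrite mulr_suml linear_sum big1 // => j _; apply: t0.
  apply/negP => /andP[/eqP E _]; by have := ltn_ord i; rewrite E ltnNge mN.
have cb : c != b by apply: contra ne => /eqP->; rewrite !eqxx.
rewrite fdualP eq_sym (negPf cb) (ftr_pair He (fbasisH c)) //.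
apply: contra ne => /andP[/eqP E /eqP->]; rewrite eqxx andbT.
by rewrite -(eqn_add2l m) E /m subnK ?fdeg_le.
Qed.

Lemma coord_homog m p f b : homog m p f ->
  ~~ ((fdeg b == m) && (fpar b == p)) -> coord b f = 0.
Proof.
move=> Hf ne; apply: (ftr_pair (fdualH b) Hf); apply: contra ne => /andP[/eqP E ->].
by rewrite andbT -(eqn_add2l (delta - fdeg b)) E subnK ?fdeg_le.
Qed.

Lemma dual_expand f : f = \sum_b tr (f * bas b) *: dual b.
Proof.
apply: ftr_eq => c; rewrite mulr_suml linear_sum (bigD1 c) //=.
rewrite -scalerAl linearZ /= fdualP eqxx mulr1 big1 ?addr0 // => b bc.
by rewrite -scalerAl linearZ /= fdualP (negPf bc) mulr0.
Qed.

(** The coordinates of [psi f] are, up to sign, traces of products of [f] with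
    the dual basis, and these vanish outside the degree and parity of [f]. *)
Lemma nakayama_homog m p f : homog m p f -> homog m p (psi f).
Proof.
move=> Hf; rewrite (coordP (psi f)); apply: homog_big => b _.
case: (boolP ((fdeg b == m) && (fpar b == p))) => [/andP[/eqP<- /eqP<-]|ne].
  by apply: homogZ; apply: fbasisH.
rewrite /coord.
have := nakayamaP Hf (fdualH b); rewrite (ftr_pair Hf (fdualH b)).
  move=> /esym /(congr1 (fun x => (-1) ^+ (p && fpar b) * x)).
  by rewrite mulrA -signr_addb addbb mul1r mulr0 => ->; rewrite scale0r; apply: comp0.
apply: contra ne => /andP[/eqP E /eqP<-]; rewrite eqxx andbT.
by rewrite -(eqn_add2r (delta - fdeg b)) E subnKC ?fdeg_le.
Qed.

(** The sign that arises when [f] crosses an element of parity [p], made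
    linear in [f] by means of the homogeneous basis. *)
Definition epar p f : F := \sum_b ((-1) ^+ (p && fpar b) * coord b f) *: bas b.

Fact epar_is_linear p : linear (epar p).
Proof.
move=> a f g; rewrite /epar scaler_sumr -big_split /=; apply: eq_bigr => b _.
by rewrite linearP mulrDr scalerDl scalerA [a * _]mulrCA.
Qed.
HB.instance Definition _ p := GRing.isLinear.Build k F F *:%R (epar p) (epar_is_linear p).

Lemma eparE q m p f : homog m p f -> epar q f = (-1) ^+ (q && p) *: f.
Proof.
move=> Hf; rewrite {2}(coordP f) scaler_sumr; apply: eq_bigr => b _.
case: (boolP ((fdeg b == m) && (fpar b == p))) => [/andP[_ /eqP->]|ne].
  by rewrite scalerA.
by rewrite (coord_homog Hf ne) mulr0 !scale0r scaler0.
Qed.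

Lemma epar_homog q m p f : homog m p f -> homog m p (epar q f).
Proof. by move=> Hf; rewrite (eparE q Hf); apply: homogZ. Qed.

Lemma epar0 f : epar false f = f.
Proof. by rewrite [RHS]coordP; apply: eq_bigr => b _; rewrite mul1r. Qed.

Lemma epar1 q : epar q 1 = 1.
Proof. by rewrite (eparE q (@comp1 _ _)) andbF scale1r. Qed.

Lemma nakayama_epar q f : psi (epar q f) = epar q (psi f).
Proof.
elim/homog_ind: f => [|m p f g Hf IH]; first by rewrite !linear0.
rewrite [epar q (f + g)]linearD [psi (f + g)]linearD !linearD /= IH.
by rewrite (eparE q Hf) (eparE q (nakayama_homog Hf)) linearZ.
Qed.

(** The component of parity [p]. *)
Definition pproj p f : F := \sum_(b | fpar b == p) coord b f *: bas b.

Fact pproj_is_linear p : linear (pproj p).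
Proof.
move=> a f g; rewrite /pproj scaler_sumr -big_split /=; apply: eq_bigr => b _.
by rewrite linearP scalerDl scalerA.
Qed.
HB.instance Definition _ p := GRing.isLinear.Build k F F *:%R (pproj p) (pproj_is_linear p).

Lemma pprojE q m p f : homog m p f -> pproj q f = if q == p then f else 0.
Proof.
move=> Hf; case: eqVneq => [->|ne].
  rewrite [RHS]coordP [RHS](bigID (fun b => fpar b == p)) /= [X in _ + X]big1 ?addr0 //.
  by move=> b pb; rewrite (coord_homog Hf) ?scale0r // negb_and pb orbT.
rewrite /pproj big1 // => b /eqP pb.
by rewrite (coord_homog Hf) ?scale0r // pb (negPf ne) andbF.
Qed.

End FrobeniusAlgebra.

(** * Pure tensors *)

Section Multilinear.
Variables (k : comNzRingType) (F : frobeniusSuperalgebra k).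
Local Notation homog := (@Defs.comp k F).

(** Parities of the factors of a tensor that has [1] everywhere except at [i]. *)
Definition single n (i : 'I_n) (p : bool) (l : 'I_n) : bool := (l == i) && p.

Lemma parities_single n (i : 'I_n) m p f :
  homog m p f -> parities (single i p) (upd [ffun=> 1] i f).
Proof.
move=> Hf l; rewrite !ffunE /single; case: eqVneq => _; first by exists m.
by exists 0%N; apply: comp1.
Qed.

Lemma ten_sign_single n (i j : 'I_n) p q :
  ten_sign k (single i p) (single j q) = if (j < i)%N then (-1) ^+ (p && q) else 1.
Proof.
rewrite /ten_sign /single; case: ifP => ji.
  rewrite (bigD1 j) //= [X in _ * X]big1 ?mulr1 => [|a /negPf aj]; last first.
    by rewrite big1 // => b _; rewrite aj andbF.
  rewrite (bigD1 i) //= !eqxx big1 ?mulr1 // => b /andP[_ /negPf bi].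
  by rewrite bi.
rewrite big1 // => a _; rewrite big1 // => b ab.
have [bi|] //= := eqVneq b i; have [aj|] := eqVneq a j; rewrite ?andbF //.
by move: ab; rewrite bi aj ji.
Qed.

Lemma upd_id n (f : {ffun 'I_n -> F}) i : upd f i (f i) = f.
Proof. by apply/ffunP => l; rewrite ffunE; case: eqP => [->|]. Qed.

(** The relations that carry signs are stated for homogeneous factors. A
    property that is compatible with linear combinations in each factor can be
    checked there. *)
Lemma multilinear_ind n (E : {ffun 'I_n -> F} -> Prop) :
  (forall f i u v (a : k), E (upd f i u) -> E (upd f i v) ->
     E (upd f i (a *: u + v))) ->
  (forall p f, parities p f -> E f) -> forall f, E f.
Proof.
move=> EL EH.
suff H (s : seq 'I_n) : forall f : {ffun 'I_n -> F}, (forall i, i \notin s ->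
    exists m p, homog m p (f i)) -> E f.
  by move=> f; apply: (H (enum 'I_n)) => i; rewrite mem_enum.
elim: s => [|i s IH] f Hf.
  have /boolp.choice[p Hp] : forall i, exists q m, homog m q (f i).
    by move=> i; have [m [q Hq]] := Hf i isT; exists q, m.
  exact: EH Hp.
rewrite -(upd_id f i); elim/homog_ind: (f i) => [|m p u v Hu IHv].
  apply: IH => j js; rewrite ffunE; case: eqVneq => [_|ji].
    by exists 0%N, false; apply: comp0.
  by apply: Hf; rewrite inE negb_or ji.
rewrite -[u]scale1r; apply: EL IHv; apply: IH => j js; rewrite ffunE.
case: eqVneq => [_|ji]; first by exists m, p.
by apply: Hf; rewrite inE negb_or ji.
Qed.

End Multilinear.

(** * Realizations of the generators and relations *)

Section Laws.
Variables (k : comNzRingType) (F : frobeniusSuperalgebra k).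
Local Notation homog := (@Defs.comp k F).
Local Notation psi := (nakayama F).

(** A choice of elements that the generators could be sent to. The relations
    are grouped below into four records, as the constructions that follow
    satisfy some groups before the others. *)
Record gdata n (A : pzRingType) := Gdata {
  gsc : {rmorphism k -> A};
  gx : 'I_n -> A;
  gT : {ffun 'I_n -> F} -> A;
  gP : {perm 'I_n} -> A
}.

Section Elements.
Variables (n : nat) (A : pzRingType) (D : gdata n A).

Definition gat i f : A := gT D (upd [ffun=> 1] i f).
Definition gtel i j : A := \sum_b gat i (fbasis b) * gat j (fdual b).

Record tlaws : Prop := Tlaws {
  gscC : forall c a, gsc D c * a = a * gsc D c;
  gTL : forall f i a u v,
    gT D (upd f i (a *: u + v)) = gsc D a * gT D (upd f i u) + gT D (upd f i v);
  gT1 : gT D [ffun=> 1] = 1;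
  gTM : forall p q f g, parities p f -> parities q g ->
    gT D f * gT D g = gsc D (ten_sign k p q) * gT D [ffun i => f i * g i]
}.

Record xlaws : Prop := Xlaws {
  gxC : forall i j, gx D i * gx D j = gx D j * gx D i;
  gTx : forall f i, gT D f * gx D i = gx D i * gT D (upd f i (psi (f i)))
}.

Record plaws : Prop := Plaws {
  gP1 : gP D 1%g = 1;
  gPM : forall s t, gP D s * gP D t = gP D (t * s)%g;
  gPT : forall s p f, parities p f ->
    gP D s * gT D f = gsc D (perm_sign k s p)
                      * (gT D [ffun i => f (s^-1%g i)] * gP D s)
}.

Record sxlaws : Prop := Sxlaws {
  gPx_far : forall i i' j : 'I_n, i' = i.+1 :> nat -> j != i -> j != i' ->
    gP D (tperm i i') * gx D j = gx D j * gP D (tperm i i');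
  gPx : forall i i' : 'I_n, i' = i.+1 :> nat ->
    gP D (tperm i i') * gx D i = gx D i' * gP D (tperm i i') - gtel i i'
}.

End Elements.

Section TensorLaws.
Variables (n : nat) (A : pzRingType) (D : gdata n A) (HT : tlaws D).
Local Notation sc := (gsc D).
Local Notation T := (gT D).
Local Notation at_ := (gat D).
Implicit Types (i j l : 'I_n) (a : k).

Lemma gT_upd0 (f : {ffun 'I_n -> F}) i : T (upd f i 0) = 0.
Proof.
have := gTL HT f i (-1) 0 0.
by rewrite scaler0 addr0 rmorphN1 mulN1r addNr.
Qed.

Lemma gT0 (f : {ffun 'I_n -> F}) i : f i = 0 -> T f = 0.
Proof. by move=> f0; rewrite -(upd_id f i) f0 gT_upd0. Qed.

Lemma gT_updZ (f : {ffun 'I_n -> F}) i a u : T (upd f i (a *: u)) = sc a * T (upd f i u).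
Proof. by rewrite -[_ *: u]addr0 (gTL HT) gT_upd0 addr0. Qed.

Lemma gT_updD (f : {ffun 'I_n -> F}) i u v : T (upd f i (u + v)) = T (upd f i u) + T (upd f i v).
Proof. by rewrite -[u in LHS]scale1r (gTL HT) rmorph1 mul1r. Qed.

Lemma gT_scale (a : 'I_n -> k) (f : {ffun 'I_n -> F}) :
  T [ffun i => a i *: f i] = sc (\prod_i a i) * T f.
Proof.
suff H (s : seq 'I_n) : uniq s ->
    T [ffun i => if i \in s then a i *: f i else f i]
    = sc (\prod_(i <- s) a i) * T f.
  rewrite -big_enum /= -H ?enum_uniq //; congr (T _).
  by apply/ffunP => i; rewrite !ffunE mem_enum.
elim: s => [|i s IH] /= => [_|/andP[is_ us]].
  by rewrite big_nil rmorph1 mul1r; congr (T _); apply/ffunP => i; rewrite ffunE.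
rewrite big_cons rmorphM -mulrA -IH //.
set g := [ffun l => if l \in s then _ else _].
have gi : g i = f i by rewrite ffunE (negPf is_).
rewrite -[g in RHS](upd_id g i) gi -gT_updZ; congr (T _).
by apply/ffunP => l; rewrite !ffunE inE; case: eqP => // ->.
Qed.

Lemma gat_linear i a u v : at_ i (a *: u + v) = sc a * at_ i u + at_ i v.
Proof. exact: gTL. Qed.

Lemma gat0 i : at_ i 0 = 0. Proof. exact: gT_upd0. Qed.
Lemma gatZ i a u : at_ i (a *: u) = sc a * at_ i u. Proof. exact: gT_updZ. Qed.
Lemma gatD i u v : at_ i (u + v) = at_ i u + at_ i v. Proof. exact: gT_updD. Qed.
Lemma gatN i u : at_ i (- u) = - at_ i u.
Proof. by rewrite -scaleN1r gatZ rmorphN1 mulN1r. Qed.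
Lemma gat_sum i (I : Type) (s : seq I) (P : pred I) (E : I -> F) :
  at_ i (\sum_(l <- s | P l) E l) = \sum_(l <- s | P l) at_ i (E l).
Proof. by rewrite (big_morph (at_ i) (gatD i) (gat0 i)). Qed.

Lemma gat_coord i f : at_ i f = \sum_b sc (coord b f) * at_ i (fbasis b).
Proof. by rewrite {1}(coordP f) gat_sum; apply: eq_bigr => b _; rewrite gatZ. Qed.

Lemma gat1 i : at_ i 1 = 1.
Proof.
rewrite -(gT1 HT); congr (T _).
by apply/ffunP => l; rewrite !ffunE if_same.
Qed.

Lemma gatM i f g : at_ i f * at_ i g = at_ i (f * g).
Proof.
elim/homog_ind: f => [|m p f f' Hf IH]; first by rewrite mul0r gat0 mul0r.
rewrite gatD mulrDl {}IH mulrDl gatD; congr (_ + _).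
elim/homog_ind: g => [|m' p' g g' Hg IHg]; first by rewrite mulr0 gat0 mulr0.
rewrite gatD mulrDr IHg mulrDr gatD; congr (_ + _).
rewrite (gTM HT (parities_single i Hf) (parities_single i Hg)).
rewrite ten_sign_single ltnn rmorph1 mul1r; congr (T _).
by apply/ffunP => l; rewrite !ffunE; case: eqP; rewrite // mulr1.
Qed.

Lemma gat_comm i j m p f m' p' g : i != j -> homog m p f -> homog m' p' g ->
  at_ i f * at_ j g = sc ((-1) ^+ (p && p')) * (at_ j g * at_ i f).
Proof.
move=> ij Hf Hg.
rewrite (gTM HT (parities_single i Hf) (parities_single j Hg)).
rewrite (gTM HT (parities_single j Hg) (parities_single i Hf)).
rewrite !ten_sign_single mulrA -rmorphM.
congr (sc _ * T _).
  have ij' : i != j :> nat by [].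
  case: (ltngtP i j) ij' => // _ _; rewrite ?mulr1 //.
  by rewrite andbC -signr_addb addbb.
apply/ffunP => l; rewrite !ffunE; case: eqVneq => [->|_].
  by rewrite (negPf ij) mulr1 mul1r.
by case: eqVneq; rewrite ?mulr1 ?mul1r.
Qed.

(** No sign arises, because the factors already stand in increasing order. *)
Lemma gT_prod (f : {ffun 'I_n -> F}) : T f = \prod_(l <- enum 'I_n) at_ l (f l).
Proof.
elim/multilinear_ind: f => [f i u v a Eu Ev|p f Hp].
  rewrite (gTL HT) Eu Ev.
  have := enum_uniq 'I_n; have : i \in enum 'I_n by rewrite mem_enum.
  case/splitPr: (enum _) / => s1 s2.
  rewrite cat_uniq /= => /and3P[_ /norP[is1 _] /andP[is2 _]].
  have spl w : \prod_(l <- s1 ++ i :: s2) at_ l (upd f i w l) =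
      (\prod_(l <- s1) at_ l (f l)) * (at_ i w * (\prod_(l <- s2) at_ l (f l))).
    rewrite big_cat big_cons /= ffunE eqxx; congr (_ * (_ * _)).
      by apply: eq_big_seq => l ls; rewrite ffunE; case: eqP => // li; rewrite -li ls in is1.
    by apply: eq_big_seq => l ls; rewrite ffunE; case: eqP => // li; rewrite -li ls in is2.
  rewrite !spl gat_linear mulrDl mulrDr -[sc a * _ * _]mulrA; congr (_ + _).
  by rewrite mulrA (gscC HT) -mulrA.
suff H (s : seq 'I_n) : sorted (fun a b : 'I_n => (a < b)%N) s ->
    T [ffun i => if i \in s then f i else 1] = \prod_(l <- s) at_ l (f l).
  rewrite -H; last by have := iota_ltn_sorted 0 n; rewrite -val_enum_ord sorted_map.
  by congr (T _); apply/ffunP => i; rewrite !ffunE mem_enum.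
have tr_lt : transitive (fun a b : 'I_n => (a < b)%N) by move=> ? ? ?; apply: ltn_trans.
elim: s => [|i s IH].
  by move=> _; rewrite big_nil -(gT1 HT); congr (T _); apply/ffunP => i; rewrite !ffunE.
move=> ss; have ss' := path_sorted ss.
have is_ : all (fun j : 'I_n => (i < j)%N) s := order_path_min tr_lt ss.
have iNs : i \notin s by apply/negP => /(allP is_); rewrite ltnn.
rewrite big_cons -IH //.
have [m Hm] := Hp i.
(* The parities of the tensor with [1] outside [s]. *)
pose q l := (l \in s) && p l.
have Hq : parities q [ffun i => if i \in s then f i else 1].
  move=> l; rewrite ffunE /q; case: ifP => _; first exact: Hp.
  by exists 0%N; apply: comp1.
rewrite (gTM HT (parities_single i Hm) Hq).
rewrite (_ : ten_sign _ _ _ = 1) ?rmorph1 ?mul1r.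
  congr (T _); apply/ffunP => l; rewrite !ffunE inE.
  by case: eqVneq => [->|_]; rewrite /= ?(negPf iNs) ?mulr1 ?mul1r.
rewrite /ten_sign big1 // => a _; rewrite big1 // => b ab.
rewrite /single /q; have [bi|] //= := eqVneq b i.
have [/(allP is_)|] := boolP (a \in s); last by rewrite andbF.
by move: ab; rewrite bi => h1 h2; move: (ltn_trans h1 h2); rewrite ltnn.
Qed.

End TensorLaws.
End Laws.

(** * Teleporters *)

Section Teleporters.
Variables (k : comNzRingType) (F : frobeniusSuperalgebra k).
Local Notation homog := (@Defs.comp k F).
Local Notation psi := (nakayama F).
Local Notation bas := (@fbasis k F).
Local Notation dual := (@fdual k F).
Local Notation tr := (ftr F).
Variables (n : nat) (A : pzRingType) (D : gdata F n A) (HT : tlaws D).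
Local Notation sc := (gsc D).
Local Notation T := (gT D).
Local Notation X := (gx D).
Local Notation P := (gP D).
Local Notation at_ := (gat D).
Local Notation tel := (gtel D).
Implicit Types (i j l : 'I_n) (a : k).

Lemma scCA (c : k) (a b : A) : a * (sc c * b) = sc c * (a * b).
Proof. by rewrite mulrA -(gscC HT) mulrA. Qed.

Lemma sc_signK (p : bool) : sc ((-1) ^+ p) * sc ((-1) ^+ p) = 1.
Proof. by rewrite -rmorphM -signr_addb addbb rmorph1. Qed.

Lemma gat_comm_even i j f m g : i != j -> homog m false f ->
  at_ i f * at_ j g = at_ j g * at_ i f.
Proof.
move=> ij Hf; elim/homog_ind: g => [|m' p g g' Hg IH].
  by rewrite (gat0 HT) mul0r mulr0.
by rewrite (gatD HT) mulrDr mulrDl IH (gat_comm HT ij Hf Hg) rmorph1 mul1r.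
Qed.

(** Left multiplication by [f] on the basis and right multiplication by [f] on
    the dual basis have the same matrix. *)
Lemma gtel_at_l i j f : at_ i f * tel i j = tel i j * at_ j f.
Proof.
rewrite /gtel mulr_sumr mulr_suml.
transitivity (\sum_b \sum_c sc (tr (dual c * (f * bas b))) * (at_ i (bas c) * at_ j (dual b))).
  apply: eq_bigr => b _; rewrite mulrA (gatM HT) (gat_coord HT i (f * bas b)).
  by rewrite mulr_suml; apply: eq_bigr => c _; rewrite mulrA.
rewrite exchange_big /=; apply: eq_bigr => c _.
rewrite -mulrA (gatM HT) (dual_expand (dual c * f)) (gat_sum HT) mulr_sumr.
by apply: eq_bigr => b _; rewrite (gatZ HT) scCA -[dual c * f * _]mulrA.
Qed.

(** Here the token passes through the trace, where the Nakayama automorphism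
    comes from. *)
Lemma gtel_at_r i j f : i != j -> at_ j f * tel i j = tel i j * at_ i (psi f).
Proof.
move=> ij; elim/homog_ind: f => [|m p f g Hf IH].
  by rewrite linear0 !(gat0 HT) mul0r mulr0.
rewrite linearD !(gatD HT) mulrDl mulrDr {}IH; congr (_ + _).
have ji : j != i by rewrite eq_sym.
rewrite /gtel mulr_sumr mulr_suml.
transitivity (\sum_b \sum_c sc ((-1) ^+ (p && fpar b) * tr (f * dual b * bas c))
    * (at_ i (bas b) * at_ j (dual c))).
  apply: eq_bigr => b _; rewrite mulrA (gat_comm HT ji Hf (fbasisH b)) -!mulrA.
  rewrite (gatM HT) {1}(dual_expand (f * dual b)) (gat_sum HT) !mulr_sumr.
  by apply: eq_bigr => c _; rewrite (gatZ HT) scCA !rmorphM !mulrA.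
rewrite exchange_big /=; apply: eq_bigr => c _.
rewrite -mulrA (gat_comm HT ji (fdualH c) (nakayama_homog Hf)) scCA.
rewrite [at_ i _ * (_ * _)]mulrA (gatM HT) (gat_coord HT i (bas c * _)).
rewrite mulr_suml mulr_sumr; apply: eq_bigr => b _.
rewrite !mulrA -rmorphM; congr (sc _ * _ * _).
have Hbc := compM (fdualH b) (fbasisH c).
rewrite -mulrA (nakayamaP Hf Hbc) mulrA -mulrA mulrA /coord mulrA; congr (_ * _).
by case: p (fpar b) (fpar c) {Hf Hbc} => [] [] []; rewrite //= ?mulr1 ?mul1r -?expr2 ?sqrr_sign ?mulN1r ?opprK.
Qed.

Lemma gtel_at i j l f : l != i -> l != j -> at_ l f * tel i j = tel i j * at_ l f.
Proof.
move=> li lj; elim/homog_ind: f => [|m p f g Hf IH].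
  by rewrite !(gat0 HT) mul0r mulr0.
rewrite !(gatD HT) mulrDl mulrDr {}IH; congr (_ + _).
rewrite /gtel mulr_sumr mulr_suml; apply: eq_bigr => b _.
rewrite mulrA (gat_comm HT li Hf (fbasisH b)) -!mulrA.
by rewrite (gat_comm HT lj Hf (fdualH b)) scCA !mulrA sc_signK mul1r.
Qed.

(** The elements [psi (dual b)] form, up to sign, the right dual basis. *)
Lemma gtel_psi i j : i != j ->
  \sum_b at_ i (bas b) * at_ j (psi (dual b)) = tel j i.
Proof.
move=> ij; have ji : j != i by rewrite eq_sym.
transitivity (\sum_b \sum_c sc (tr (dual c * psi (dual b))) * (at_ i (bas b) * at_ j (bas c))).
  apply: eq_bigr => b _; rewrite (gat_coord HT j (psi _)) mulr_sumr.
  by apply: eq_bigr => c _; rewrite scCA.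
rewrite exchange_big /=; apply: eq_bigr => c _.
rewrite (gat_coord HT i (dual c)) mulr_sumr; apply: eq_bigr => b _.
rewrite scCA (gat_comm HT ji (fbasisH c) (fbasisH b)) [RHS]mulrA -rmorphM.
congr (sc _ * _); rewrite /coord (nakayamaP (fdualH b) (fdualH c)).
by rewrite mulrAC andbC -signr_addb addbb mul1r.
Qed.

Lemma gtel_tel_disjoint i j i' j' : i != i' -> i != j' -> j != i' -> j != j' ->
  tel i j * tel i' j' = tel i' j' * tel i j.
Proof.
move=> h1 h2 h3 h4; rewrite {1 4}/gtel mulr_suml mulr_sumr; apply: eq_bigr => b _.
by rewrite -mulrA gtel_at // mulrA gtel_at // mulrA.
Qed.

(** A token of one teleporter is carried along the other one, which turns the
    end [p] into [q]. *)
Lemma gtel_tel_l q p r : q != p -> r != p -> r != q ->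
  tel q p * tel r p = tel r q * tel q p.
Proof.
move=> qp rp rq; rewrite {2 3}/gtel mulr_suml mulr_sumr; apply: eq_bigr => b _.
by rewrite mulrA -gtel_at // -mulrA -gtel_at_l mulrA.
Qed.

Lemma gtel_tel_r q p r : q != p -> r != p -> r != q ->
  tel q p * tel r p = tel r p * tel r q.
Proof.
move=> qp rp rq; have qr : q != r by rewrite eq_sym.
rewrite -(gtel_psi qr) {1}/gtel mulr_suml mulr_sumr; apply: eq_bigr => b _.
by rewrite -mulrA gtel_at_r // mulrA gtel_at // mulrA.
Qed.

(** The part of [xlaws] about single factors; it implies the part about all
    tensors. *)
Definition at_law := forall i j f,
  at_ i f * X j = X j * at_ i (if i == j then psi f else f).

Lemma xlaws_at : xlaws D -> at_law.
Proof.
move=> HX i j f.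
rewrite /gat (gTx HX); congr (_ * T _); apply/ffunP => l; rewrite !ffunE.
have [->|ij] := eqVneq i j; first by case: eqP.
by have [->|//] := eqVneq l j; rewrite eq_sym (negPf ij) rmorph1.
Qed.

Section WithX.
Hypothesis HX : at_law.

Lemma gat_x_far i j f : i != j -> at_ i f * X j = X j * at_ i f.
Proof. by move=> /negPf ij; rewrite HX ij. Qed.

Lemma gat_x_same i f : at_ i f * X i = X i * at_ i (psi f).
Proof. by rewrite HX eqxx. Qed.

Lemma gT_x f i : T f * X i = X i * T (upd f i (psi (f i))).
Proof.
rewrite !(gT_prod HT); elim: (enum _) => [|l s IH].
  by rewrite !big_nil mul1r mulr1.
rewrite !big_cons -mulrA IH !mulrA HX ffunE eq_sym; congr (_ * _ * _).
by case: eqVneq => // ->.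
Qed.

Lemma gtel_x i j l : l != i -> l != j -> tel i j * X l = X l * tel i j.
Proof.
rewrite ![l == _]eq_sym => il jl.
rewrite /gtel mulr_sumr mulr_suml; apply: eq_bigr => b _.
by rewrite -mulrA gat_x_far // mulrA gat_x_far // mulrA.
Qed.

Lemma gtel_x_r i j : i != j -> tel i j * X j = X j * tel j i.
Proof.
move=> ij; rewrite -(gtel_psi ij) {1}/gtel mulr_sumr mulr_suml.
by apply: eq_bigr => b _; rewrite -mulrA gat_x_same mulrA gat_x_far // mulrA.
Qed.

End WithX.

Section WithP.
Hypothesis HP : plaws D.

Lemma gPV s : P s * P s^-1%g = 1.
Proof. by rewrite (gPM HP) mulVg (gP1 HP). Qed.

Lemma gPtt i j : P (tperm i j) * P (tperm i j) = 1.
Proof. by rewrite -{2}(tpermV i j) gPV. Qed.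

Lemma gP_at s i f : P s * at_ i f = at_ (s i) f * P s.
Proof.
elim/homog_ind: f => [|m p f g Hf IH]; first by rewrite !(gat0 HT) mul0r mulr0.
rewrite !(gatD HT) mulrDl mulrDr {}IH; congr (_ + _).
rewrite (gPT HP _ (parities_single i Hf)).
rewrite (_ : perm_sign k s _ = 1) ?rmorph1 ?mul1r.
  congr (T _ * _); apply/ffunP => l; rewrite !ffunE.
  by rewrite -(inj_eq (@perm_inj _ s)) permKV.
rewrite /perm_sign big1 // => a _; rewrite big1 // => b /andP[ab _].
rewrite /single; have [ai|] //= := eqVneq a i; have [bi|] := eqVneq b i; rewrite ?andbF //.
by move: ab; rewrite ai bi ltnn.
Qed.

Lemma gP_tel s i j : P s * tel i j = tel (s i) (s j) * P s.
Proof.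
rewrite /gtel mulr_sumr mulr_suml; apply: eq_bigr => b _.
by rewrite mulrA gP_at -mulrA gP_at mulrA.
Qed.

End WithP.
End Teleporters.

(** * A change of polynomial generators *)

Section Drinfeld.
Variables (k : comNzRingType) (F : frobeniusSuperalgebra k).
Local Notation psi := (nakayama F).
Variables (n : nat) (A : pzRingType) (D : gdata F n A).
Hypotheses (HT : tlaws D) (HP : plaws D) (Hat : at_law D).
Local Notation sc := (gsc D).
Local Notation T := (gT D).
Local Notation Y := (gx D).
Local Notation P := (gP D).
Local Notation at_ := (gat D).
Local Notation tel := (gtel D).
Implicit Types (i j l : 'I_n).

Hypothesis HPY : forall s i, P s * Y i = Y (s i) * P s.
Hypothesis HYY : forall i j, i != j ->
  Y i * Y j - Y j * Y i = (Y i * tel i j - Y j * tel j i) * P (tperm i j).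

(** A Jucys-Murphy element with teleporters as coefficients. *)
Definition jucys_murphy i : A := \sum_(l < n | (i < l)%N) tel l i * P (tperm l i).
Local Notation J := jucys_murphy.

(** Generators [Y i] that the symmetric group permutes without any correction
    become generators of the affine wreath product algebra after subtraction
    of the Jucys-Murphy elements. The differences commute exactly when the
    commutators of the [Y i] are those assumed in [HYY]. *)
Definition drinfeld_data : gdata F n A := Gdata sc (fun i => Y i - J i) T P.

Lemma gP_tperm (s : {perm 'I_n}) l i : P s * P (tperm l i) = P (tperm (s l) (s i)) * P s.
Proof. by rewrite !(gPM HP) -tpermJ conjgC. Qed.

Lemma jm_at l i f : at_ l f * J i = J i * at_ l (if l == i then psi f else f).
Proof.
rewrite /J mulr_sumr mulr_suml; apply: eq_bigr => m im.
have mi : m != i by rewrite -val_eqE /= gtn_eqF.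
have [->|li] := eqVneq l i.
  by rewrite mulrA (gtel_at_r HT) // -!mulrA (gP_at HT HP) tpermR.
have [->|lm] := eqVneq l m.
  by rewrite mulrA (gtel_at_l HT) -!mulrA (gP_at HT HP) tpermL.
by rewrite mulrA (gtel_at HT) // -!mulrA (gP_at HT HP) tpermD // eq_sym.
Qed.

Lemma jm_perm (s : {perm 'I_n}) i : s i = i -> (forall l, (i < s l)%N = (i < l)%N) ->
  P s * J i = J i * P s.
Proof.
move=> si sl; rewrite /J mulr_sumr mulr_suml.
rewrite [RHS](reindex_inj (@perm_inj _ s)) /=; apply: eq_big => [l|l _].
  by rewrite sl.
by rewrite mulrA (gP_tel HT HP) -mulrA gP_tperm si mulrA.
Qed.

(** [J j] involves only tensors and permutations of indices larger than [i],
    all of which commute with [J i]. *)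
Lemma jm_comm i j : (i < j)%N -> J i * J j = J j * J i.
Proof.
move=> ij; rewrite {2 3}/J mulr_sumr mulr_suml; apply: eq_bigr => l jl.
have il : (i < l)%N by apply: ltn_trans jl.
have Ji (m : 'I_n) f : (i < m)%N -> at_ m f * J i = J i * at_ m f.
  by move=> im; rewrite jm_at -val_eqE /= gtn_eqF.
have -> : J i * (tel l j * P (tperm l j)) = tel l j * J i * P (tperm l j).
  rewrite mulrA; congr (_ * _); rewrite /gtel mulr_sumr mulr_suml.
  by apply: eq_bigr => b _; rewrite -mulrA Ji // mulrA -Ji // mulrA.
rewrite -mulrA -jm_perm ?mulrA // => [|m]; first by rewrite tpermD // -val_eqE /= gtn_eqF.
by case: tpermP => [->|->|//]; rewrite ij il.
Qed.

Lemma jm_Y_lt i j : (i < j)%N -> Y i * J j = J j * Y i.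
Proof.
move=> ij; rewrite /J mulr_sumr mulr_suml; apply: eq_bigr => l jl.
have il : (i < l)%N by apply: ltn_trans jl.
have nij : i != j by rewrite -val_eqE /= ltn_eqF.
have nil : i != l by rewrite -val_eqE /= ltn_eqF.
by rewrite mulrA -(gtel_x Hat) // -!mulrA HPY tpermD // eq_sym.
Qed.

(** In [J i] only the summand with index [j] fails to commute with [Y j]. *)
Lemma jm_Y_gt i j : (i < j)%N ->
  J i * Y j - Y j * J i = (Y i * tel i j - Y j * tel j i) * P (tperm i j).
Proof.
move=> ij; have nij : j != i by rewrite -val_eqE /= gtn_eqF.
have nij' : i != j by rewrite eq_sym.
rewrite /J mulr_sumr mulr_suml (bigD1 j) //= [X in _ - X](bigD1 j) //=.
rewrite opprD addrACA -sumrB big1 ?addr0 => [|l /andP[il lj]]; last first.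
  have nli : i != l by rewrite -val_eqE /= ltn_eqF.
  rewrite -mulrA HPY tpermD // mulrA (gtel_x Hat) ?mulrA ?subrr //.
  by rewrite eq_sym.
rewrite -mulrA HPY tpermL mulrA (gtel_x_r HT Hat) // mulrBl (tpermC j).
by rewrite !mulrA.
Qed.

Lemma drinfeld_xlaws : xlaws drinfeld_data.
Proof.
have C (i j : 'I_n) : (i < j)%N -> (Y i - J i) * (Y j - J j) = (Y j - J j) * (Y i - J i).
  move=> ij; have nij : i != j by rewrite -val_eqE /= ltn_eqF.
  have := HYY nij; rewrite -(jm_Y_gt ij) => E.
  have {}E : Y i * Y j - J i * Y j = Y j * Y i - Y j * J i.
    by rewrite -[Y i * Y j](subrK (Y j * Y i)) E addrAC [_ - _ - _]addrAC subrr sub0r addrC.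
  rewrite !mulrBl !mulrBr (jm_comm ij) (jm_Y_lt ij) !opprB.
  by rewrite ![J j * J i - _]addrC addrACA E addrACA.
split=> [i j|f i] /=.
  case: (ltngtP i j) => [||/val_inj-> //]; first exact: C.
  by move=> /C.
apply: (gT_x (D := drinfeld_data)) => [|l m g]; first by split; case: HT.
by rewrite mulrBr mulrBl jm_at Hat.
Qed.

Lemma drinfeld_sxlaws : sxlaws drinfeld_data.
Proof.
split=> [i i' j ii' ji ji'|i i' ii'] /=.
  have tj : tperm i i' j = j by rewrite tpermD // eq_sym.
  rewrite mulrBr mulrBl HPY tj jm_perm // => l.
  case: tpermP => [->|->|//].
    by rewrite ii' ltnS leq_eqVlt val_eqE (negPf ji).
  by rewrite ii' ltnS [RHS]leq_eqVlt val_eqE (negPf ji).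
have ilt : (i < i')%N by rewrite ii'.
have nii : i' != i by rewrite -val_eqE /= gtn_eqF.
rewrite mulrBr mulrBl HPY tpermL -addrA; congr (_ + _); rewrite -opprD; congr (- _).
rewrite /J mulr_sumr (bigD1 i') //= addrC; congr (_ + _); last first.
  rewrite mulrA (gP_tel HT HP) tpermL tpermR (tpermC i' i) -mulrA (gPtt HP).
  by rewrite mulr1.
rewrite mulr_suml; apply: eq_big => [l|l /andP[il li']].
  by rewrite ii' [RHS]ltn_neqAle -ii' eq_sym andbC val_eqE.
have nil : i != l by rewrite -val_eqE /= ltn_eqF.
rewrite mulrA (gP_tel HT HP) tpermL -mulrA gP_tperm tpermL tpermD ?mulrA //.
by rewrite eq_sym.
Qed.

End Drinfeld.

(** * Linear endomorphisms *)

Section LinearEndomorphisms.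
Variables (k : comNzRingType) (U : lmodType k).

(** Bundled endomorphisms, so that a representation on [U] is a ring morphism
    into [lend U]. *)
Record lend := Lend { lapp :> U -> U; lapp_linear : linear lapp }.

HB.instance Definition _ (f : lend) :=
  GRing.isLinear.Build k U U *:%R (lapp f) (lapp_linear f).
HB.instance Definition _ := gen_eqMixin lend.
HB.instance Definition _ := gen_choiceMixin lend.

Lemma lendP (f g : lend) : (forall u, f u = g u) -> f = g.
Proof.
case: f g => [f lf] [g lg] /= /funext E; case: _ / E lg => lg.
by congr Lend; apply: Prop_irrelevance.
Qed.

Fact lend0_subproof : linear (fun _ : U => 0 : U).
Proof. by move=> a u v; rewrite scaler0 addr0. Qed.
Fact lend1_subproof : linear (fun u : U => u).
Proof. by []. Qed.
Fact lendD_subproof (f g : lend) : linear (fun u => f u + g u).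
Proof. by move=> a u v; rewrite !linearP scalerDr addrACA. Qed.
Fact lendN_subproof (f : lend) : linear (fun u => - f u).
Proof. by move=> a u v; rewrite linearP opprD scalerN. Qed.
Fact lendM_subproof (f g : lend) : linear (fun u => f (g u)).
Proof. by move=> a u v; rewrite !linearP. Qed.

Let lend_add f g := Lend (lendD_subproof f g).
Let lend_opp f := Lend (lendN_subproof f).
Let lend_mul f g := Lend (lendM_subproof f g).

Fact lend_addA : associative lend_add.
Proof. by move=> f g h; apply: lendP => u /=; rewrite addrA. Qed.
Fact lend_addC : commutative lend_add.
Proof. by move=> f g; apply: lendP => u /=; rewrite addrC. Qed.
Fact lend_add0 : left_id (Lend lend0_subproof) lend_add.
Proof. by move=> f; apply: lendP => u /=; rewrite add0r. Qed.
Fact lend_addN : left_inverse (Lend lend0_subproof) lend_opp lend_add.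
Proof. by move=> f; apply: lendP => u /=; rewrite addNr. Qed.
HB.instance Definition _ :=
  GRing.isZmodule.Build lend lend_addA lend_addC lend_add0 lend_addN.

Fact lend_mulA : associative lend_mul.
Proof. by move=> f g h; apply: lendP. Qed.
Fact lend_mul1l : left_id (Lend lend1_subproof) lend_mul.
Proof. by move=> f; apply: lendP. Qed.
Fact lend_mul1r : right_id (Lend lend1_subproof) lend_mul.
Proof. by move=> f; apply: lendP. Qed.
Fact lend_mulDl : left_distributive lend_mul lend_add.
Proof. by move=> f g h; apply: lendP. Qed.
Fact lend_mulDr : right_distributive lend_mul lend_add.
Proof. by move=> f g h; apply: lendP => u /=; rewrite linearD. Qed.
HB.instance Definition _ := GRing.Zmodule_isPzRing.Build lend
  lend_mulA lend_mul1l lend_mul1r lend_mulDl lend_mulDr.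

Lemma lendE0 u : (0 : lend) u = 0. Proof. by []. Qed.
Lemma lendE1 u : (1 : lend) u = u. Proof. by []. Qed.
Lemma lendD (f g : lend) u : (f + g) u = f u + g u. Proof. by []. Qed.
Lemma lendN (f : lend) u : (- f) u = - f u. Proof. by []. Qed.
Lemma lendM (f g : lend) u : (f * g) u = f (g u). Proof. by []. Qed.
Lemma lend_sum (I : Type) (s : seq I) (P : pred I) (E : I -> lend) u :
  (\sum_(i <- s | P i) E i) u = \sum_(i <- s | P i) E i u.
Proof. by rewrite (big_morph (fun f : lend => f u) (fun f g => lendD f g u) (lendE0 u)). Qed.

Lemma lappD (f : lend) u v : f (u + v) = f u + f v. Proof. exact: linearD. Qed.
Lemma lappN (f : lend) u : f (- u) = - f u. Proof. exact: linearN. Qed.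
Lemma lappZ (f : lend) a u : f (a *: u) = a *: f u. Proof. exact: linearZ. Qed.
Lemma lapp_sum (I : Type) (s : seq I) (P : pred I) (E : I -> U) (f : lend) :
  f (\sum_(i <- s | P i) E i) = \sum_(i <- s | P i) f (E i).
Proof. exact: linear_sum. Qed.

Fact lscal_subproof (c : k) : linear (fun u : U => c *: u).
Proof. by move=> a u v; rewrite scalerDr !scalerA mulrC. Qed.
Definition lscal c : lend := Lend (lscal_subproof c).

Fact lscal_zmod : zmod_morphism lscal.
Proof. by move=> a b; apply: lendP => u /=; rewrite scalerBl. Qed.
Fact lscal_monoid : monoid_morphism lscal.
Proof.
split; first by apply: lendP => u /=; rewrite scale1r.
by move=> a b; apply: lendP => u /=; rewrite scalerA.
Qed.
HB.instance Definition _ := GRing.isZmodMorphism.Build k lend lscal lscal_zmod.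
HB.instance Definition _ := GRing.isMonoidMorphism.Build k lend lscal lscal_monoid.

Lemma lscalC c f : lscal c * f = f * lscal c.
Proof. by apply: lendP => u; rewrite !lendM /= linearZ. Qed.

End LinearEndomorphisms.

(** * Signs of permuted tensors *)

Section Signs.
Variable (k : comNzRingType).

(** Signs are products over increasing pairs of indices. Rewritten as products
    over all ordered pairs, they can be reindexed by a permutation. *)
Lemma prod_neq_pairs n (G : 'I_n -> 'I_n -> k) :
  \prod_(i < n) \prod_(j < n | j != i) G i j =
  \prod_(i < n) \prod_(j < n | (i < j)%N) (G i j * G j i).
Proof.
rewrite (eq_bigr (fun i : 'I_n => (\prod_(j < n | (j != i) && (i < j)%N) G i j) *
    \prod_(j < n | (j != i) && ~~ (i < j)%N) G i j)); last first.
  by move=> i _; rewrite (bigID (fun j : 'I_n => (i < j)%N)).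
rewrite big_split /=; under [RHS]eq_bigr => i _ do rewrite big_split /=.
rewrite [RHS]big_split /=; congr (_ * _).
  apply: eq_bigr => i _; apply: eq_bigl => j; rewrite -val_eqE /=.
  by case: ltngtP.
rewrite [RHS](exchange_big_dep xpredT) //=; apply: eq_bigr => i _.
by apply: eq_bigl => j; rewrite -val_eqE /=; case: ltngtP.
Qed.

Lemma prod_neq_perm n (s : {perm 'I_n}) (G : 'I_n -> 'I_n -> k) :
  \prod_(i < n) \prod_(j < n | j != i) G i j = \prod_(i < n) \prod_(j < n | j != i) G (s i) (s j).
Proof.
rewrite (reindex_inj (@perm_inj _ s)) /=; apply: eq_bigr => i _.
rewrite (reindex_inj (@perm_inj _ s)) /=; apply: eq_bigl => j.
by rewrite (inj_eq perm_inj).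
Qed.

Lemma prod_lt_mkcond n (Q : 'I_n -> 'I_n -> bool) (G : 'I_n -> 'I_n -> k) :
  (forall i j, Q i j -> j != i) ->
  \prod_(i < n) \prod_(j < n | Q i j) G i j =
  \prod_(i < n) \prod_(j < n | j != i) (if Q i j then G i j else 1).
Proof.
move=> HQ; apply: eq_bigr => i _; rewrite big_mkcond [RHS]big_mkcond /=.
apply: eq_bigr => j _; case: ifP => [/HQ ->//|]; by case: ifP.
Qed.

Lemma sgrC (b c : bool) : (-1) ^+ b * (-1) ^+ c = (-1) ^+ (b (+) c) :> k.
Proof. by rewrite signr_addb. Qed.

(** Compared pair by pair: a pair is inverted by [s * t] when exactly one of
    [s] and [t] inverts it in turn, and otherwise the sign occurs twice or not
    at all. *)
Lemma perm_signM n (s t : {perm 'I_n}) (p : 'I_n -> bool) :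
  perm_sign k (s * t)%g p = perm_sign k s p * perm_sign k t (fun i => p (s^-1%g i)).
Proof.
have lt_neq (i j : 'I_n) : (i < j)%N -> j != i by rewrite -val_eqE /=; case: ltngtP.
rewrite /perm_sign [X in _ * X]prod_lt_mkcond; last by move=> i j /andP[/lt_neq].
rewrite (prod_neq_perm s) prod_neq_pairs -big_split /=.
apply: eq_bigr => i _; rewrite big_mkcondr [X in X * _]big_mkcondr /=.
rewrite -big_split /=; apply: eq_bigr => j ij; rewrite !permK !permM.
have := lt_neq _ _ ij; rewrite -(inj_eq (@perm_inj _ s)) => sij.
have tsij : t (s j) != t (s i) by rewrite (inj_eq perm_inj).
move: sij tsij; rewrite -!val_eqE /=.
case: (ltngtP (s i) (s j)) => // _ _; case: (ltngtP (t (s i)) (t (s j))) => // _ _;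
  by rewrite /= ?mulr1 ?mul1r // 1?andbC // sgrC andbC addbb.
Qed.

(** Compared pair by pair: for a pair [i < j] inverted by [s], the sign [p j
    && q i] on the right cancels one of the two cross terms of [p i (+) q i]
    and [p j (+) q j], leaving the sign [p i && q j] of the permuted tensors. *)
Lemma ten_sign_perm n (s : {perm 'I_n}) (p q : 'I_n -> bool) :
  perm_sign k s p * perm_sign k s q *
    ten_sign k (fun i => p (s^-1%g i)) (fun i => q (s^-1%g i)) =
  ten_sign k p q * perm_sign k s (fun i => p i (+) q i).
Proof.
have lt_neq (i j : 'I_n) : (i < j)%N -> j != i by rewrite -val_eqE /=; case: ltngtP.
rewrite /perm_sign /ten_sign [X in _ * X = _]prod_lt_mkcond //.
rewrite (prod_neq_perm s) prod_neq_pairs -!big_split /=.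
apply: eq_bigr => i _; rewrite !big_mkcondr -!big_split /=.
apply: eq_bigr => j ij; rewrite !permK.
have := lt_neq _ _ ij; rewrite -(inj_eq (@perm_inj _ s)) -val_eqE /=.
case: (ltngtP (s i) (s j)) => // _ _; rewrite /= ?mulr1 ?mul1r // !sgrC; congr (_ ^+ _).
by case: (p i) (p j) (q i) (q j) => [] [] [] [].
Qed.

Lemma perm_sign_single n (s : {perm 'I_n}) (i : 'I_n) p :
  perm_sign k s (single i p) = 1.
Proof.
rewrite /perm_sign big1 // => a _; rewrite big1 // => b /andP[ab _].
rewrite /single; have [ai|] //= := eqVneq a i; have [bi|] := eqVneq b i; rewrite ?andbF //.
by move: ab; rewrite ai bi ltnn.
Qed.

Lemma perm_sign0 n (s : {perm 'I_n}) : perm_sign k s (fun _ => false) = 1.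
Proof. by rewrite /perm_sign big1 // => a _; rewrite big1. Qed.

End Signs.

(** * Functions on the symmetric group *)

Section CoinducedModule.
Variables (k : comNzRingType) (F : frobeniusSuperalgebra k).
Variables (n : nat) (U : lmodType k) (D : gdata F n (lend U)).
Hypotheses (scE : forall c u, gsc D c u = c *: u).
Hypotheses (HT : tlaws D) (HX : xlaws D).
Local Notation G := {perm 'I_n}.
Local Notation M := (G -> U).
Local Notation X := (gx D).
Local Notation tel := (gtel D).
Implicit Types (i j l p q r : 'I_n) (s t : G) (phi : M).

Lemma mfunD phi phi' s : (phi + phi') s = phi s + phi' s. Proof. by []. Qed.
Lemma mfunN phi s : (- phi) s = - phi s. Proof. by []. Qed.
Lemma mfunZ a phi s : (a *: phi) s = a *: phi s. Proof. by []. Qed.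
Lemma mfun_sum (I : Type) (S : seq I) (P : pred I) (E : I -> M) s :
  (\sum_(i <- S | P i) E i) s = \sum_(i <- S | P i) E i s.
Proof. by rewrite fct_sumE. Qed.

(** The sign of a permuted tensor makes sense for homogeneous factors only,
    hence the decomposition of [f] according to all parity patterns [e]. *)
Definition sten (e : {ffun 'I_n -> bool}) s (f : {ffun 'I_n -> F}) : {ffun 'I_n -> F} :=
  [ffun i => pproj (e (s^-1%g i)) (f (s^-1%g i))].

Definition mT_fun (f : {ffun 'I_n -> F}) phi : M := fun s =>
  \sum_(e : {ffun 'I_n -> bool}) perm_sign k s e *: gT D (sten e s f) (phi s).

Fact mT_linear f : linear (mT_fun f).
Proof.
move=> a u v; apply/funext => s; rewrite mfunD mfunZ /mT_fun scaler_sumr -big_split /=.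
by apply: eq_bigr => e _; rewrite mfunD mfunZ linearP scalerDr !scalerA mulrC.
Qed.
Definition mT f : lend M := Lend (mT_linear f).

Fact mP_linear s : linear (fun phi : M => (fun t => phi (s * t)%g) : M).
Proof. by []. Qed.
Definition mP s : lend M := Lend (mP_linear s).

(** Were the sum over [r] absent, the symmetric group would still permute the
    [mY i], but these would commute. The sum is a Jucys-Murphy element
    computed at the point [s]; it makes [mY i] minus the Jucys-Murphy element
    act at the identity through [X i]. *)
Definition mY_fun i phi : M := fun s =>
  X (s i) (phi s) + \sum_(r < n | (s i < r)%N) tel r (s i) (phi (s * tperm r (s i))%g).

Fact mY_linear i : linear (mY_fun i).
Proof.
move=> a u v; apply/funext => s; rewrite mfunD mfunZ /mY_fun !(mfunD, mfunZ).
rewrite linearP scalerDr addrACA; congr (_ + _).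
rewrite scaler_sumr -big_split /=; apply: eq_bigr => r _.
by rewrite !(mfunD, mfunZ) linearP.
Qed.
Definition mY i : lend M := Lend (mY_linear i).

(** The coinduced module on functions from the symmetric group: tensors act at
    [s] with their indices moved by [s], and permutations act by translation. *)
Definition mD : gdata F n (lend M) :=
  Gdata (@lscal k M : {rmorphism k -> lend M}) mY mT mP.

Lemma mscE c phi s : gsc mD c phi s = c *: phi s. Proof. by []. Qed.

Lemma mPE s phi t : gP mD s phi t = phi (s * t)%g. Proof. by []. Qed.

Lemma mYE i phi s : gx mD i phi s =
  X (s i) (phi s) + \sum_(r < n | (s i < r)%N) tel r (s i) (phi (s * tperm r (s i))%g).
Proof. by []. Qed.

Lemma mT_homog e (f : {ffun 'I_n -> F}) phi s : parities e f ->
  gT mD f phi s = perm_sign k s e *: gT D [ffun i => f (s^-1%g i)] (phi s).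
Proof.
move=> Hf; rewrite [LHS]/= /mT_fun (bigD1 (finfun e)) //= big1 ?addr0.
  congr (_ *: _).
    by rewrite /perm_sign; apply: eq_bigr => i _; apply: eq_bigr => j _; rewrite !ffunE.
  congr (gT D _ _); apply/ffunP => i; rewrite !ffunE.
  by have [m Hm] := Hf (s^-1%g i); rewrite (pprojE _ Hm) eqxx.
move=> e' /eqP ne.
have [i ei] : exists i, e' i != e i.
  apply: contrapT => H; apply: ne; apply/ffunP => i; rewrite ffunE.
  by apply: contrapT => /eqP h; apply: H; exists i.
rewrite (gT0 HT (i := s i)) ?lendE0 ?scaler0 //.
by rewrite ffunE permK; have [m Hm] := Hf i; rewrite (pprojE _ Hm) (negPf ei).
Qed.

Lemma mtlaws : tlaws mD.
Proof.
split.
- exact: lscalC.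
- move=> f i a u v; apply: lendP => phi; apply/funext => s.
  rewrite lendD lendM mfunD [gsc mD _ _]/= mfunZ /= /mT_fun.
  rewrite scaler_sumr -big_split /=; apply: eq_bigr => e _.
  have E w : sten e s (upd f i w) = upd (sten e s f) (s i) (pproj (e i) w).
    apply/ffunP => l; rewrite !ffunE -(inj_eq (@perm_inj _ s)) permKV.
    by case: eqP => // ->; rewrite permK.
  rewrite !E linearP (gTL HT) lendD lendM scE scalerDr !scalerA.
  by rewrite mulrC.
- apply: lendP => phi; apply/funext => s.
  rewrite (@mT_homog (fun=> false)) => [|i]; last first.
    by exists 0%N; rewrite ffunE; apply: comp1.
  rewrite perm_sign0 scale1r (_ : [ffun i => _] = [ffun=> 1]) ?(gT1 HT) //.
  by apply/ffunP => i; rewrite !ffunE.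
- move=> p q f g Hf Hg; apply: lendP => phi; apply/funext => s.
  have Hfg : parities (fun i => p i (+) q i) [ffun i => f i * g i].
    move=> i; have [m Hm] := Hf i; have [m' Hm'] := Hg i.
    by exists (m + m')%N; rewrite ffunE; apply: compM.
  rewrite !lendM mscE.
  rewrite (mT_homog _ _ Hf) (mT_homog _ _ Hg) (mT_homog _ _ Hfg).
  rewrite linearZ /= !scalerA -lendM.
  have Hf' : parities (fun i => p (s^-1%g i)) [ffun i => f (s^-1%g i)].
    by move=> i; rewrite ffunE; apply: Hf.
  have Hg' : parities (fun i => q (s^-1%g i)) [ffun i => g (s^-1%g i)].
    by move=> i; rewrite ffunE; apply: Hg.
  rewrite (gTM HT Hf' Hg') lendM scE scalerA ten_sign_perm.
  by congr (_ *: gT D _ _); apply/ffunP => i; rewrite !ffunE.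
Qed.

Lemma mplaws : plaws mD.
Proof.
split.
- by apply: lendP => phi; apply/funext => s; rewrite /= mul1g.
- by move=> s t; apply: lendP => phi; apply/funext => u; rewrite /= mulgA.
- move=> s p f Hf; apply: lendP => phi; apply/funext => t.
  rewrite !lendM mscE.
  have Hf' : parities (fun i => p (s^-1%g i)) [ffun i => f (s^-1%g i)].
    by move=> i; rewrite ffunE; apply: Hf.
  rewrite mPE (mT_homog _ _ Hf) (mT_homog _ _ Hf') mPE scalerA perm_signM.
  congr (_ *: gT D _ _); apply/ffunP => i; rewrite !ffunE.
  by rewrite invMg permM.
Qed.

Lemma mat_E i f phi s : gat mD i f phi s = gat D (s i) f (phi s).
Proof.
elim/homog_ind: f => [|m p f g Hf IH].
  by rewrite (gat0 mtlaws) (gat0 HT).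
rewrite (gatD mtlaws) (gatD HT) !lendD mfunD {}IH; congr (_ + _).
rewrite (mT_homog _ _ (parities_single i Hf)) perm_sign_single scale1r.
congr (gT D _ _); apply/ffunP => l; rewrite !ffunE.
by rewrite -(inj_eq (@perm_inj _ s)) permKV.
Qed.

Lemma mtel_E i j phi s : gtel mD i j phi s = tel (s i) (s j) (phi s).
Proof.
rewrite /gtel !lend_sum mfun_sum; apply: eq_bigr => b _.
by rewrite !lendM !mat_E.
Qed.

Lemma mat_law : at_law mD.
Proof.
have HA := xlaws_at HX.
move=> l i f; apply: lendP => phi; apply/funext => s.
rewrite !lendM mat_E !mYE lappD lapp_sum mat_E.
have -> : (l == i) = (s l == s i) by rewrite (inj_eq perm_inj).
rewrite -[lapp (gat D _ _) (lapp (X _) _)]lendM HA lendM; congr (_ + _); apply: eq_bigr => r sr.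
have rs : r != s i by rewrite -val_eqE /= gtn_eqF.
rewrite mat_E -!lendM permM; congr (lapp _ _).
have [->|li] := eqVneq (s l) (s i); first by rewrite tpermR (gtel_at_r HT).
have [->|lr] := eqVneq (s l) r; first by rewrite tpermL (gtel_at_l HT).
by rewrite tpermD 1?eq_sym // (gtel_at HT).
Qed.

Lemma mPY s i : mP s * mY i = mY (s i) * mP s.
Proof.
apply: lendP => phi; apply/funext => t; rewrite !lendM /= /mY_fun permM.
by congr (_ + _); apply: eq_bigr => r _; rewrite mulgA.
Qed.

Lemma tperm_mulC i j s : (tperm i j * s = s * tperm (s i) (s j))%g.
Proof. by rewrite -tpermJ conjgC. Qed.

Section QuadraticRelation.
Variables (w : M) (p q : 'I_n).
Hypothesis pq : (p < q)%N.

Let HA := xlaws_at HX.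
Let qNp : q != p. Proof. by rewrite -val_eqE /= gtn_eqF. Qed.
Let pNq : p != q. Proof. by rewrite eq_sym qNp. Qed.

(** With [w] the function [phi] translated by [s], and [p], [q] the images of
    [i], [j] under [s], this is the value at [s] of [mY i (mY j phi)]. *)
Definition yy (p q : 'I_n) : U :=
  X p (X q (w 1%g)) + \sum_(r < n | (q < r)%N) X p (tel r q (w (tperm r q)))
  + \sum_(r < n | (p < r)%N) (tel r p (X (tperm r p q) (w (tperm r p)))
      + \sum_(r' < n | (tperm r p q < r')%N)
          tel r p (tel r' (tperm r p q) (w (tperm r p * tperm r' (tperm r p q))%g))).

(** In the same notation, the value at [s] of [mY i] applied to the teleporter
    of [i] and [j] applied to [tperm i j] applied to [phi]. *)
Definition yt (p q : 'I_n) : U :=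
  X p (tel p q (w (tperm p q)))
  + \sum_(r < n | (p < r)%N)
      tel r p (tel r (tperm r p q) (w (tperm p q * tperm r p)%g)).

Let sum_gt_split (f : 'I_n -> U) : \sum_(r < n | (p < r)%N) f r =
  f q + (\sum_(r < n | (q < r)%N) f r + \sum_(r < n | (p < r)%N && (r < q)%N) f r).
Proof.
rewrite (bigD1 q) //=; congr (_ + _); rewrite (bigID (fun r : 'I_n => (q < r)%N)) /=.
congr (_ + _); apply: eq_bigl => r.
  by rewrite -val_eqE /=; case: (ltngtP q r) => qr; rewrite ?andbF // (ltn_trans pq qr).
by rewrite -val_eqE /= -andbA; congr (_ && _); case: ltngtP.
Qed.

Let lapp2 (f g f' g' : lend U) u : f * g = f' * g' -> f (g u) = f' (g' u).
Proof. by rewrite -!lendM => ->. Qed.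

(** Both sides are expanded according to the position of the summation indices
    relative to [p < q]; the terms then match by the relations between two
    teleporters. *)
Lemma yy_comm : yy p q + yt q p = yy q p + yt p q.
Proof.
have gt_neq (r r' : 'I_n) : (r < r')%N -> r' != r by rewrite -val_eqE /=; case: ltngtP.
have gt_neq' (r r' : 'I_n) : (r < r')%N -> r != r' by rewrite -val_eqE /=; case: ltngtP.
pose A0 := X p (X q (w 1%g)).
pose Aq := \sum_(r < n | (q < r)%N) X p (tel r q (w (tperm r q))).
pose Cc := X p (tel p q (w (tperm p q))).
pose Dq := tel q p (tel q p (w 1%g)).
pose E1 := \sum_(r < n | (q < r)%N) tel q p (tel r p (w (tperm q p * tperm r p)%g)).
pose E2 := \sum_(r < n | (p < r)%N && (r < q)%N)
  tel q p (tel r p (w (tperm q p * tperm r p)%g)).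
pose Bp := \sum_(r < n | (p < r)%N && (r != q)) X q (tel r p (w (tperm r p))).
pose G1 := \sum_(r < n | (q < r)%N) tel r p (tel r q (w (tperm r p * tperm r q)%g)).
pose G2 := \sum_(r < n | (q < r)%N) \sum_(r' < n | [&& (p < r')%N, r' != q & r' != r])
  tel r q (tel r' p (w (tperm r q * tperm r' p)%g)).
pose H := X q (tel q p (w (tperm q p))).
pose Mm := \sum_(r < n | (q < r)%N) tel r q (tel r p (w (tperm q p * tperm r q)%g)).
have yypq : yy p q = A0 + Aq + (Cc + (Dq + (E1 + E2)) + (Bp + (G1 + G2))).
  rewrite /yy; congr (_ + _); rewrite (bigD1 q) //=; congr (_ + _).
    rewrite tpermL (lapp2 _ (gtel_x_r HT HA qNp)) (tpermC q p); congr (_ + _).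
    rewrite sum_gt_split; congr (_ + _).
      by rewrite (tpermC p q) tperm2.
    by rewrite /E1 /E2 tpermC.
  rewrite (eq_bigr (fun r : 'I_n => X q (tel r p (w (tperm r p)))
      + \sum_(r' < n | (q < r')%N) tel r p (tel r' q (w (tperm r p * tperm r' q)%g)))).
    rewrite big_split /=; congr (_ + _).
    rewrite (exchange_big_dep (fun r' : 'I_n => (q < r')%N)) //= /G1 /G2.
    rewrite -big_split /=; apply: eq_bigr => r qr.
    rewrite (bigD1 r) /=; last by rewrite (ltn_trans pq qr) gt_neq.
    congr (_ + _); apply: eq_big => [r'|r' /andP[/andP[/andP[pr' r'q] _] r'r]].
      by rewrite qr andbT -andbA.
    rewrite (lapp2 (f' := tel r q) (g' := tel r' p)); last first.
      rewrite (gtel_tel_disjoint HT) // ?gt_neq' //; exact: ltn_trans pq qr.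
    congr (lapp _ (lapp _ (w _))).
    have rp : r != p by rewrite gt_neq // (ltn_trans pq qr).
    have [rr' qr'] : r != r' /\ q != r' by rewrite ![_ == r']eq_sym.
    by rewrite [LHS]tperm_mulC (tpermD rr' qr') (tpermD rp qNp).
  move=> r /andP[pr rq]; rewrite tpermD // 1?eq_sym //.
  by congr (_ + _); apply: lapp2; rewrite (gtel_x HA) // eq_sym.
have yyqp : yy q p = A0 + (H + Bp) + (Aq + (E1 + (Mm + G2))).
  rewrite /yy; congr (_ + _ + _).
  - by apply: lapp2; apply: gxC.
  - by rewrite (bigD1 q).
  rewrite big_split /=; congr (_ + _).
    apply: eq_bigr => r qr; rewrite tpermD ?gt_neq //; last exact: ltn_trans pq qr.
    by apply: lapp2; rewrite (gtel_x HA) // gt_neq' // (ltn_trans pq qr).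
  rewrite /E1 /Mm /G2 -!big_split /=; apply: eq_bigr => r qr.
  have pr := ltn_trans pq qr.
  have [rNq rNp] := (gt_neq _ _ qr, gt_neq _ _ pr).
  rewrite tpermD // (bigD1 q) //=; congr (_ + _).
    rewrite (lapp2 (f' := tel q p) (g' := tel r p)); last by rewrite (gtel_tel_l HT).
    congr (lapp _ (lapp _ (w _))).
    by rewrite tperm_mulC tpermL tpermD // eq_sym.
  rewrite (bigD1 r) /=; last by rewrite pr rNq.
  congr (_ + _).
    congr (lapp _ (lapp _ (w _))).
    by rewrite [RHS]tperm_mulC tpermR tpermD.
  by apply: eq_bigl => r'; rewrite -andbA.
have ytpq : yt p q = Cc + (Dq + (G1 + E2)).
  rewrite /yt; congr (_ + _); rewrite sum_gt_split; congr (_ + (_ + _)).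
  - by rewrite tpermL (tpermC p q) tperm2.
  - apply: eq_bigr => r qr; have pr := ltn_trans pq qr.
    have [rNq rNp] := (gt_neq _ _ qr, gt_neq _ _ pr).
    rewrite tpermD //; congr (lapp _ (lapp _ (w _))).
    by rewrite tperm_mulC tpermR tpermD // eq_sym.
  apply: eq_bigr => r /andP[pr rq].
  have [rNq rNp] := (gt_neq' _ _ rq, gt_neq _ _ pr).
  rewrite tpermD // (tpermC p q); apply: lapp2.
  by rewrite (gtel_tel_r HT).
have ytqp : yt q p = H + Mm.
  rewrite /yt; congr (_ + _); apply: eq_bigr => r qr; have pr := ltn_trans pq qr.
  by rewrite tpermD // ?gt_neq //.
rewrite yypq yyqp ytpq ytqp !addrA.
(* Both sides are sums of the same eleven terms. *)
by rewrite [LHS](ACl (1*10*7*2*5*11*9*3*4*8*6)%AC).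
Qed.

End QuadraticRelation.

(** The commutation hypothesis of the change of generators, checked at each
    point of the group. *)
Lemma mYY i j : i != j -> mY i * mY j - mY j * mY i =
  (mY i * gtel mD i j - mY j * gtel mD j i) * mP (tperm i j).
Proof.
move=> ij; apply: lendP => phi; apply/funext => s.
pose w : M := fun t => phi (s * t)%g.
have yyE i' j' : gx mD i' (gx mD j' phi) s = yy w (s i') (s j').
  rewrite mYE mYE /yy; congr (_ + _).
    rewrite lappD /w mulg1 lapp_sum; congr (_ + _).
  apply: eq_bigr => r _; rewrite mYE permM lappD lapp_sum; congr (_ + _).
  by apply: eq_bigr => r' _; rewrite /w mulgA.
have ytE i' j' : gx mD i' (gtel mD i' j' (gP mD (tperm i' j') phi)) s
    = yt w (s i') (s j').
  rewrite mYE mtel_E mPE /yt /w -(tperm_mulC i' j'); congr (_ + _).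
  apply: eq_bigr => r _; rewrite mtel_E mPE !permM tpermR.
  by congr (lapp _ (lapp _ (phi _))); rewrite !mulgA tperm_mulC.
rewrite mulrBl !(lendD, lendN, lendM).
suff: yy w (s i) (s j) + yt w (s j) (s i) = yy w (s j) (s i) + yt w (s i) (s j).
  rewrite -!yyE -!ytE (tpermC j i) => E; apply/eqP.
  rewrite subr_eq addrAC eq_sym subr_eq; apply/eqP.
  by rewrite E addrC.
have : s i != s j by rewrite (inj_eq perm_inj).
rewrite -val_eqE /=; case: (ltngtP (s i) (s j)) => // [lt _|lt _].
  exact: yy_comm.
by symmetry; apply: yy_comm.
Qed.

End CoinducedModule.

(** * Presentations *)

Section FreeInduction.
Variables (k : comNzRingType) (X : choiceType).

Lemma malg_word (c : k) (w : {fmonom X}) :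
  of_malg << c *g w >> = (c%:A : freealg k X) * \prod_(x <- (w : seq X)) freegen k x.
Proof.
have <- : of_malg (c%:MP : {malg k[{fmonom X}]}) = (c%:A : freealg k X).
  by rewrite -(malg_ofA X c) malg_ofK.
have -> : \prod_(x <- (w : seq X)) freegen k x = of_malg << w >>.
  case: w => s; elim: s => [|x s IH] /=.
    rewrite big_nil -(rmorph1 (@of_malg k X)); congr of_malg.
    by rewrite -mpolyC1E; congr << _ >>; apply/eqP; rewrite fmP fm1.
  rewrite big_cons IH /freegen -rmorphM /= ; congr of_malg.
  rewrite malgM_def fgmulUU mulr1; congr << _ >>; apply/eqP; rewrite fmP.
  by rewrite fmM fmU.
rewrite -rmorphM /= mul_malgC; congr of_malg; apply/malgP => x.
by rewrite mcoeffZ !mcoeffU mulrnAr mulr1.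
Qed.

Lemma freealg_ind (Q : freealg k X -> Prop) :
  (forall c : k, Q c%:A) -> (forall x, Q (freegen k x)) ->
  (forall a b, Q a -> Q b -> Q (a + b)) ->
  (forall a b, Q a -> Q b -> Q (a * b)) -> forall a, Q a.
Proof.
move=> QA Qx QD QM a; rewrite -[a]malg_ofK [malg_of a]monalgE rmorph_sum /=.
elim/big_rec: _ => [|w x _ Qx']; first by rewrite -(scale0r (1 : freealg k X)).
apply: QD Qx'; rewrite malg_word; apply: (QM _ _ (QA _)).
by elim/big_rec: _ => [|y z _ Qz]; [rewrite -(scale1r (1 : freealg k X))|apply: QM].
Qed.

End FreeInduction.

Section Presentations.
Variables (k : comNzRingType) (F : frobeniusSuperalgebra k).

Record afflaws n (A : pzRingType) (D : gdata F n A) : Prop := Afflaws {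
  al_T : tlaws D;
  al_X : xlaws D;
  al_P : plaws D;
  al_SX : sxlaws D
}.

(** Generation as an algebra, in the form of an induction principle. *)
Definition generated n (A : pzRingType) (D : gdata F n A) : Prop :=
  forall Q : A -> Prop,
    (forall c, Q (gsc D c)) -> (forall i, Q (gx D i)) ->
    (forall f, Q (gT D f)) -> (forall s, Q (gP D s)) ->
    (forall a b, Q a -> Q b -> Q (a + b)) ->
    (forall a b, Q a -> Q b -> Q (a * b)) -> forall a, Q a.

Section MapData.
Variables (n : nat) (A B : pzRingType) (D : gdata F n A) (h : {rmorphism A -> B}).

Definition map_data : gdata F n B :=
  Gdata (h \o gsc D) (h \o gx D) (h \o gT D) (h \o gP D).

Lemma map_tel i j : gtel map_data i j = h (gtel D i j).
Proof. by rewrite /gtel rmorph_sum; apply: eq_bigr => b _; rewrite rmorphM. Qed.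

Hypothesis hC : forall c b, h (gsc D c) * b = b * h (gsc D c).

Lemma map_afflaws : afflaws D -> afflaws map_data.
Proof.
case=> HT HX HP HS; split; split.
- exact: hC.
- by move=> f i a u v; rewrite /= (gTL HT) rmorphD rmorphM.
- by rewrite /= (gT1 HT) rmorph1.
- by move=> p q f g Hf Hg; rewrite /= -rmorphM (gTM HT Hf Hg) rmorphM.
- by move=> i j; rewrite /= -!rmorphM (gxC HX).
- by move=> f i; rewrite /= -!rmorphM (gTx HX).
- by rewrite /= (gP1 HP) rmorph1.
- by move=> s t; rewrite /= -rmorphM (gPM HP).
- by move=> s p f Hf; rewrite /= -!rmorphM (gPT HP _ Hf).
- by move=> i i' j ii ji ji'; rewrite /= -!rmorphM (gPx_far HS).
- by move=> i i' ii; rewrite map_tel /= -!rmorphM -rmorphB (gPx HS).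
Qed.

Lemma map_generated : (forall b, exists a, b = h a) ->
  generated D -> generated map_data.
Proof.
move=> hS HG Q Qs Qx QT QP QD QM b; have [a ->] := hS b.
by apply: (HG (fun a => Q (h a))) => //= {}a c Ha Hc;
   rewrite ?rmorphD ?rmorphM; [apply: QD|apply: QM].
Qed.
End MapData.

Section Affine.
Variable n : nat.

Definition affine_sc : {rmorphism k -> affine F n} :=
  toquo (@affine_rel k F n) \o in_alg (freealg k (gen F n)).

Definition aff_data : gdata F n (affine F n) :=
  Gdata affine_sc (fun i => affine_gen (gen_x F i))
    (fun f => affine_gen (gen_ten f)) (fun s => affine_gen (gen_perm F s)).

Let tqB a b : affine_rel (a - b) ->
  toquo (@affine_rel k F n) a = toquo (@affine_rel k F n) b.
Proof. by move=> R; apply/toquoP; apply: ideal_gen_in. Qed.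

Let tqZ (a : k) (b : freealg k (gen F n)) : toquo (@affine_rel k F n) (a *: b) = affine_sc a * toquo _ b.
Proof. by rewrite -mulr_algl rmorphM. Qed.

Lemma aff_afflaws : afflaws aff_data.
Proof.
split; split.
- move=> c; elim/quoW => a; rewrite /= -!rmorphM; congr toquo.
  exact: free_scalC.
- move=> f i a u v; have := tqB (rel_tenL f i a u v).
  by rewrite rmorphD /= tqZ.
- by have := tqB (rel_ten1 F n); rewrite rmorph1.
- move=> p q f g Hf Hg; have := tqB (rel_tenM Hf Hg).
  by rewrite rmorphM tqZ.
- by move=> i j; have := tqB (rel_xC F i j); rewrite !rmorphM.
- by move=> f i; have := tqB (rel_ten_x f i); rewrite !rmorphM.
- by have := tqB (rel_perm1 F n); rewrite rmorph1.
- by move=> s t; have := tqB (rel_permM F s t); rewrite rmorphM.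
- move=> s p f Hf; have := tqB (rel_perm_ten s Hf).
  by rewrite tqZ !rmorphM.
- by move=> i i' j ii ji ji'; have := tqB (rel_sx_far F ii ji ji'); rewrite !rmorphM.
- move=> i i' ii; have := tqB (rel_sx F ii); rewrite rmorphB !rmorphM /= => ->.
  congr (_ - _); rewrite /teleporter rmorph_sum; apply: eq_bigr => b _.
  by rewrite rmorphM.
Qed.

Lemma aff_generated : generated aff_data.
Proof.
move=> Q Qs Qx QT QP QD QM; elim/quoW; elim/freealg_ind.
- by move=> c; apply: Qs.
- by move=> [i|[f|s]]; [apply: Qx|apply: QT|apply: QP].
- by move=> a b Qa Qb; rewrite rmorphD; apply: QD.
- by move=> a b Qa Qb; rewrite rmorphM; apply: QM.
Qed.

Section Lift.
Variables (A : pzRingType) (D : gdata F n A).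
Hypothesis HD : afflaws D.

Definition gen_image (g : gen F n) : A :=
  match g with inl i => gx D i | inr (inl f) => gT D f | inr (inr s) => gP D s end.

Let fl := free_lift (gsc D) gen_image.

HB.instance Definition _ := GRing.isZmodMorphism.Build _ _ fl
  (free_lift_zmod_morphism _ _).
HB.instance Definition _ := GRing.isMonoidMorphism.Build _ _ fl
  (free_lift_monoid_morphism _ (gscC (al_T HD))).

Let flZ (c : k) (a : freealg k (gen F n)) : fl (c *: a) = gsc D c * fl a.
Proof. by rewrite -mulr_algl rmorphM /= [fl c%:A]free_liftA. Qed.

Let flg x : fl (freegen k x) = gen_image x.
Proof. exact: free_lift_gen. Qed.

Lemma affine_rel_lift a : affine_rel a -> fl a = 0.
Proof.
have [HT HX HP HS] := HD.
case=> {a} *; rewrite rmorphB ?rmorphB ?rmorphD ?rmorph1 /= ?flZ ?rmorphM /= ?flg /=;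
  apply/eqP; rewrite subr_eq0; apply/eqP.
- by apply: (gxC HX).
- by apply: (gTL HT).
- by apply: (gT1 HT).
- by apply: (gTM HT).
- by apply: (gP1 HP).
- by apply: (gPM HP).
- by apply: (gTx HX).
- by apply: (gPx_far HS).
- rewrite (gPx HS) //; congr (_ - _).
  rewrite /teleporter rmorph_sum; apply: eq_bigr => b _.
  by rewrite rmorphM /= !flg.
- by apply: (gPT HP).
Qed.

Lemma affine_lift_ex : exists rho : {rmorphism affine F n -> A},
  [/\ forall c, rho (gsc aff_data c) = gsc D c,
      forall i, rho (gx aff_data i) = gx D i,
      forall f, rho (gT aff_data f) = gT D f
    & forall s, rho (gP aff_data s) = gP D s].
Proof.
pose rho := quo_lift fl : affine F n -> A.
pose rz := GRing.isZmodMorphism.Build _ _ rho (quo_lift_zmod_morphism affine_rel_lift).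
pose rm := GRing.isMonoidMorphism.Build _ _ rho (quo_lift_monoid_morphism affine_rel_lift).
pose rhoM : {rmorphism affine F n -> A} := HB.pack rho rz rm.
have rhoE a : rhoM (toquo _ a) = fl a by apply: quo_liftE; apply: affine_rel_lift.
exists rhoM; split=> *.
- by rewrite [LHS]rhoE; exact: free_liftA.
- by rewrite [LHS]rhoE; exact: flg.
- by rewrite [LHS]rhoE; exact: flg.
- by rewrite [LHS]rhoE; exact: flg.
Qed.

End Lift.
End Affine.

Section Cyclotomic.
Variables (theta : nat) (C : nat -> seq F) (n : nat).
Local Notation cyc := (cyclotomic theta C n).

Definition cyc_data : gdata F n cyc := map_data (aff_data n) (toquo (@cyc_rel k F theta C n)).

Lemma cyc_afflaws : afflaws cyc_data.
Proof.
apply: map_afflaws (aff_afflaws n); move=> c; elim/quoW => a.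
by rewrite -!rmorphM (gscC (al_T (aff_afflaws n))).
Qed.

Lemma cyc_generated : generated cyc_data.
Proof.
apply: map_generated; last exact: aff_generated.
by elim/quoW => a; exists a.
Qed.

End Cyclotomic.
End Presentations.

(** * Linear maps on polynomials in the last variable *)

Section DerivedRelations.
Variables (k : comNzRingType) (F : frobeniusSuperalgebra k).
Variables (n : nat) (A : pzRingType) (D : gdata F n A) (HD : afflaws D).
Local Notation X := (gx D).
Local Notation P := (gP D).
Local Notation tel := (gtel D).
Let HT := al_T HD.
Let HP := al_P HD.
Let HS := al_SX HD.

Lemma gPx_succ (i i' : 'I_n) : i' = i.+1 :> nat ->
  P (tperm i i') * X i' = X i * P (tperm i i') + tel i' i.
Proof.
move=> ii; set s := tperm i i'.
have E : X i' = P s * X i * P s + tel i i' * P s.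
  by rewrite (gPx HS ii) mulrBl subrK -mulrA (gPtt HP) mulr1.
rewrite E mulrDr !mulrA (gPtt HP) mul1r; congr (_ + _).
by rewrite (gP_tel HT HP) tpermL tpermR -mulrA (gPtt HP) mulr1.
Qed.

End DerivedRelations.

Section Twist.
Variables (k : comNzRingType) (F : frobeniusSuperalgebra k).
Variables (n : nat) (R : pzRingType) (DR : gdata F n R).

(** A new type, since the module structure comes from the structure map in
    [DR]. *)
Definition kmod of gdata F n R : Type := R.
HB.instance Definition _ := GRing.Zmodule.on (kmod DR).

Fact kmod_scaleA a b (v : kmod DR) : gsc DR a * (gsc DR b * v) = gsc DR (a * b) * v.
Proof. by rewrite rmorphM mulrA. Qed.
Fact kmod_scale1 (v : kmod DR) : gsc DR 1 * v = v.
Proof. by rewrite rmorph1 mul1r. Qed.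
Fact kmod_scaleDr a (u v : kmod DR) :
  gsc DR a * (u + v : R) = (gsc DR a * u : R) + gsc DR a * v :> kmod DR.
Proof. by rewrite mulrDr. Qed.
Fact kmod_scaleDl (v : kmod DR) a b :
  gsc DR (a + b) * v = (gsc DR a * v : R) + gsc DR b * v :> kmod DR.
Proof. by rewrite rmorphD mulrDl. Qed.
HB.instance Definition _ := GRing.Zmodule_isLmodule.Build k (kmod DR)
  kmod_scaleA kmod_scale1 kmod_scaleDr kmod_scaleDl.

End Twist.

Section DualModule.
Variables (k : comNzRingType) (F : frobeniusSuperalgebra k).
Local Notation homog := (@Defs.comp k F).
Local Notation psi := (nakayama F).
Local Notation bas := (@fbasis k F).
Local Notation r := (frank F).
Variables (n : nat) (R : pzRingType) (DR : gdata F n R) (HR : afflaws DR).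
Let HT := al_T HR.
Let HX := al_X HR.
Let HP := al_P HR.
Let HS := al_SX HR.
Local Notation sc := (gsc DR).

(** A vector [v] stands for the [k]-linear map from the tensor product of
    [k[x]] and [F] to [R] that sends [x ^+ a * bas b] to [v a b]. *)
Definition dvec : Type := nat -> 'I_r -> kmod DR.
HB.instance Definition _ := GRing.Lmodule.on dvec.
Implicit Types (v : dvec) (a : nat) (b c : 'I_r).

(** The value at [x ^+ a * f]. *)
Definition dval v a (f : F) : R := \sum_b sc (coord b f) * v a b.

Lemma dval_linear v a (e : k) f g : dval v a (e *: f + g) = sc e * dval v a f + dval v a g.
Proof.
rewrite /dval mulr_sumr -big_split /=; apply: eq_bigr => b _.
by rewrite linearP rmorphD rmorphM mulrDl mulrA.
Qed.
Lemma dval0 v a : dval v a 0 = 0.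
Proof. by rewrite /dval big1 // => b _; rewrite linear0 rmorph0 mul0r. Qed.
Lemma dvalD v a f g : dval v a (f + g) = dval v a f + dval v a g.
Proof. by rewrite -[f in LHS]scale1r dval_linear rmorph1 mul1r. Qed.
Lemma dvalZ v a (e : k) f : dval v a (e *: f) = sc e * dval v a f.
Proof. by rewrite -[_ *: f]addr0 dval_linear dval0 addr0. Qed.
Lemma dval_sum v a (I : Type) (s : seq I) (Q : pred I) (E : I -> F) :
  dval v a (\sum_(i <- s | Q i) E i) = \sum_(i <- s | Q i) dval v a (E i).
Proof. by rewrite (big_morph (dval v a) (dvalD v a) (dval0 v a)). Qed.

Lemma dval_bas v a b : dval v a (bas b) = v a b.
Proof.
rewrite /dval (bigD1 b) //= coord_fbasis eqxx rmorph1 mul1r big1 ?addr0 // => c cb.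
by rewrite coord_fbasis (negPf cb) rmorph0 mul0r.
Qed.

Lemma dval_vlinear (e : k) u v a f : dval (e *: u + v) a f = sc e * dval u a f + dval v a f.
Proof.
rewrite /dval mulr_sumr -big_split /=; apply: eq_bigr => b _.
by rewrite [(_ + v) a b]/(_ + _) /= mulrDr (scCA HT).
Qed.

Lemma dval_ext u a (E : F -> R) :
  (forall e f g, E (e *: f + g) = sc e * E f + E g) ->
  (forall b, u a b = E (bas b)) -> forall f, dval u a f = E f.
Proof.
move=> El Eb f; rewrite [in RHS](coordP f) /dval.
have E0 : E 0 = 0 by have := El (-1) 0 0; rewrite scaler0 addr0 rmorphN1 mulN1r addNr.
have ED g h : E (g + h) = E g + E h by rewrite -[g in LHS]scale1r El rmorph1 mul1r.
rewrite (big_morph E ED E0); apply: eq_bigr => b _.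
by rewrite Eb -[_ *: _]addr0 El E0 addr0.
Qed.

Definition lmul_fun (y : R) v : dvec := fun a b => y * v a b.
Fact lmul_linear y : linear (lmul_fun y).
Proof.
move=> e u v; apply/funext => a; apply/funext => b.
rewrite /lmul_fun [LHS]mulrDr; congr (_ + _); exact: (scCA HT).
Qed.
Definition lmul y : lend dvec := Lend (lmul_linear y).

Lemma lmulE y v a b : lmul y v a b = y * v a b. Proof. by []. Qed.

Lemma dval_lmul y v a f : dval (lmul y v) a f = y * dval v a f.
Proof. by rewrite /dval mulr_sumr; apply: eq_bigr => b _; rewrite (scCA HT). Qed.

(** The transpose of right multiplication by [x]; moving [x] to the left of
    [bas b] produces [psi]. *)
Definition shift_fun v : dvec := fun a b => dval v a.+1 (psi (bas b)).
Fact shift_linear : linear shift_fun.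
Proof.
move=> e u v; apply/funext => a; apply/funext => b.
by rewrite /shift_fun dval_vlinear.
Qed.

Definition dX (i : 'I_n.+1) : lend dvec :=
  if unlift ord_max i is Some j then lmul (gx DR j) else Lend shift_linear.

Lemma dX_lift j : dX (lift ord_max j) = lmul (gx DR j).
Proof. by rewrite /dX liftK. Qed.

Lemma dX_max v a b : dX ord_max v a b = dval v a.+1 (psi (bas b)).
Proof. by rewrite /dX unlift_none. Qed.

Lemma dval_dX_max v a f : dval (dX ord_max v) a f = dval v a.+1 (psi f).
Proof.
apply: (@dval_ext _ _ (fun f => dval v a.+1 (psi f))) => [e g h|b]; last by rewrite dX_max.
by rewrite linearP dval_linear.
Qed.

Definition tail (p : bool) (f : {ffun 'I_n.+1 -> F}) : {ffun 'I_n -> F} :=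
  [ffun i => epar p (f (lift ord_max i))].

(** The last factor acts through right multiplication on the argument, the
    other ones through [R]. They cross the argument, whence the parity twist
    in [tail]. *)
Definition dT_fun (f : {ffun 'I_n.+1 -> F}) v : dvec :=
  fun a b => gT DR (tail (fpar b) f) * dval v a (bas b * f ord_max).

Fact dT_linear f : linear (dT_fun f).
Proof.
move=> e u v; apply/funext => a; apply/funext => b.
rewrite /dT_fun dval_vlinear [LHS]mulrDr; congr (_ + _); exact: (scCA HT).
Qed.
Definition dT f : lend dvec := Lend (dT_linear f).

Lemma dTE f v a b : dT f v a b = gT DR (tail (fpar b) f) * dval v a (bas b * f ord_max).
Proof. by []. Qed.

Lemma dval_dT f v a m p (h : F) : homog m p h ->
  dval (dT f v) a h = gT DR (tail p f) * dval v a (h * f ord_max).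
Proof.
move=> Hh; rewrite {2}(coordP h) mulr_suml dval_sum mulr_sumr [LHS]/dval.
apply: eq_bigr => b _; rewrite -scalerAl dvalZ (scCA HT) dTE.
case: (boolP ((fdeg b == m) && (fpar b == p))) => [/andP[_ /eqP->] //|ne].
by rewrite (coord_homog Hh ne) rmorph0 !mul0r.
Qed.

(** Permutations of all [n.+1] indices act only after coinduction; those of
    the first [n] act through [dP]. *)
Definition ddata : gdata F n.+1 (lend dvec) :=
  Gdata (@lscal k dvec : {rmorphism k -> lend dvec}) dX dT (fun _ => 1).

Lemma dsc_E (c : k) (u : dvec) : gsc ddata c u = c *: u. Proof. by []. Qed.
Lemma dvecZ (c : k) v a b : (c *: v) a b = sc c * v a b. Proof. by []. Qed.
Lemma dvecD u v a b : (u + v) a b = u a b + v a b. Proof. by []. Qed.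

Lemma dvec_sum (I : Type) (S : seq I) (Q : pred I) (E : I -> dvec) a b :
  (\sum_(i <- S | Q i) E i) a b = \sum_(i <- S | Q i) (E i a b : R).
Proof. exact: (big_morph (fun v : dvec => v a b : R) (fun u v => dvecD u v a b)). Qed.

Lemma epar_addb p q m q' f : homog m q' f ->
  epar (p (+) q) f = (-1) ^+ (q && q') *: epar p f :> F.
Proof.
move=> Hf; rewrite !(eparE _ Hf) scalerA -signr_addb; congr (_ ^+ _ *: _).
by case: p q q' {Hf} => [] [] [].
Qed.

Lemma eparM p m q m' q' f g : homog m q f -> homog m' q' g ->
  epar p f * epar p g = epar p (f * g).
Proof.
move=> Hf Hg; rewrite (eparE _ Hf) (eparE _ Hg) (eparE _ (compM Hf Hg)).
rewrite -scalerAl -scalerAr scalerA -signr_addb; congr (_ ^+ _ *: _).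
by case: p q q' {Hf Hg} => [] [] [].
Qed.

Lemma ten_sign_last p q : ten_sign k p q =
  ten_sign k (fun i => p (lift ord_max i)) (fun i => q (lift ord_max i))
  * \prod_(i < n) (-1) ^+ (p ord_max && q (lift ord_max i)).
Proof.
rewrite /ten_sign big_lift_max /= [X in _ * X]big1 ?mulr1; last first.
  by move=> j; rewrite ltnNge leq_ord.
rewrite -big_split; apply: eq_bigr => i _; rewrite big_lift_max.
have -> : (lift ord_max i < @ord_max n)%N by rewrite lift_max ltn_ord.
by congr (_ * _); apply: eq_big => [j|//]; rewrite ltn_lift_max.
Qed.

Lemma dtlaws : tlaws ddata.
Proof.
split.
- exact: lscalC.
- move=> f i e u w; apply: lendP => v; apply/funext => a; apply/funext => b.
  rewrite lendD lendM dsc_E dvecD dvecZ !dTE.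
  case: (unliftP ord_max i) => [j ->|->].
    have E x : tail (fpar b) (upd f (lift ord_max j) x)
        = upd (tail (fpar b) f) j (epar (fpar b) x).
      by apply/ffunP => l; rewrite !ffunE (inj_eq lift_inj); case: eqP.
    have E' x : upd f (lift ord_max j) x ord_max = f ord_max.
      by rewrite ffunE (negPf (neq_lift _ _)).
    by rewrite !E !E' linearP (gTL HT) mulrDl mulrA.
  have E x : tail (fpar b) (upd f ord_max x) = tail (fpar b) f.
    by apply/ffunP => l; rewrite !ffunE eq_sym (negPf (neq_lift _ _)).
  have E' x : upd f ord_max x ord_max = x by rewrite ffunE eqxx.
  by rewrite !E !E' mulrDr -scalerAr dval_linear mulrDr (scCA HT).
- apply: lendP => v; apply/funext => a; apply/funext => b.
  rewrite dTE ffunE mulr1 dval_bas (_ : tail _ _ = [ffun=> 1]) ?(gT1 HT) ?mul1r //.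
  by apply/ffunP => i; rewrite !ffunE epar1.
- move=> p q f g Hf Hg; apply: lendP => v; apply/funext => a; apply/funext => b.
  rewrite !lendM dsc_E dvecZ !dTE.
  have [mN HfN] := Hf ord_max.
  rewrite (dval_dT _ _ _ (compM (fbasisH b) HfN)) ffunE !mulrA; congr (_ * _).
  have Hf' : parities (fun i => p (lift ord_max i)) (tail (fpar b) f).
    by move=> i; have [m Hm] := Hf (lift ord_max i); exists m; rewrite ffunE; apply: epar_homog.
  have Hg' : parities (fun i => q (lift ord_max i)) (tail (fpar b) g).
    by move=> i; have [m Hm] := Hg (lift ord_max i); exists m; rewrite ffunE; apply: epar_homog.
  have -> : tail (fpar b (+) p ord_max) g =
    [ffun i => (-1) ^+ (p ord_max && q (lift ord_max i)) *: tail (fpar b) g i].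
    apply/ffunP => i; rewrite !ffunE; have [m Hm] := Hg (lift ord_max i).
    exact: epar_addb Hm.
  rewrite (gT_scale HT) mulrA -(gscC HT) -mulrA (gTM HT Hf' Hg') mulrA -rmorphM.
  rewrite ten_sign_last mulrC; congr (_ * gT DR _).
  apply/ffunP => i; rewrite !ffunE.
  have [m Hm] := Hf (lift ord_max i); have [m' Hm'] := Hg (lift ord_max i).
  by rewrite (eparM _ Hm Hm').
Qed.

Lemma one_lift i f : upd [ffun=> 1 : F] (lift ord_max i) f (@ord_max n) = 1.
Proof. by rewrite ffunE (negPf (neq_lift _ _)) ffunE. Qed.

Lemma tail_lift p i f : tail p (upd [ffun=> 1] (lift ord_max i) f) = upd [ffun=> 1] i (epar p f).
Proof.
by apply/ffunP => l; rewrite !ffunE (inj_eq lift_inj); case: eqP; rewrite // epar1.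
Qed.

Lemma tail_max p f : tail p (upd [ffun=> 1] ord_max f) = [ffun=> 1].
Proof.
by apply/ffunP => i; rewrite !ffunE eq_sym (negPf (neq_lift _ _)) epar1.
Qed.

Lemma dat_lift i f v a b :
  gat ddata (lift ord_max i) f v a b = gat DR i (epar (fpar b) f) * v a b.
Proof.
by rewrite dTE one_lift mulr1 dval_bas tail_lift. Qed.

Lemma dval_dat_lift i f v a m p (h : F) : homog m p h ->
  dval (gat ddata (lift ord_max i) f v) a h = gat DR i (epar p f) * dval v a h.
Proof.
by move=> Hh; rewrite (dval_dT _ _ _ Hh) one_lift mulr1 tail_lift. Qed.

Lemma dat_max f v a b : gat ddata ord_max f v a b = dval v a (bas b * f).
Proof.
by rewrite dTE tail_max (gT1 HT) mul1r ffunE eqxx. Qed.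

Lemma dval_dat_max f v a h : dval (gat ddata ord_max f v) a h = dval v a (h * f).
Proof.
apply: (@dval_ext _ _ (fun h => dval v a (h * f))) => [e g g'|b]; last by rewrite dat_max.
by rewrite mulrDl -scalerAl dval_linear.
Qed.

Lemma dat_law : at_law ddata.
Proof.
have HA := xlaws_at HX.
move=> i j f; apply: lendP => v; apply/funext => a; apply/funext => b.
rewrite !lendM.
case: (unliftP ord_max i) => [i' ->|->]; case: (unliftP ord_max j) => [j' ->|->].
- rewrite dat_lift ![gx ddata _]dX_lift !lmulE dat_lift !mulrA HA (inj_eq lift_inj).
  by congr (_ * gat _ _ _ * _); case: eqP => // _; rewrite nakayama_epar.
- rewrite eq_sym (negPf (neq_lift _ _)) dat_lift ![gx ddata _ _ _ _]dX_max.
  by rewrite (dval_dat_lift _ _ _ _ (nakayama_homog (fbasisH b))).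
- rewrite (negPf (neq_lift _ _)) dat_max ![gx ddata _]dX_lift dval_lmul lmulE.
  by rewrite dat_max.
- rewrite eqxx dat_max [gx ddata _]/= dval_dX_max dX_max dval_dat_max.
  by rewrite rmorphM.
Qed.

Lemma dxlaws : xlaws ddata.
Proof.
split; last exact: (gT_x dtlaws dat_law).
move=> i j; apply: lendP => v; apply/funext => a; apply/funext => b.
rewrite !lendM.
case: (unliftP ord_max i) => [i' ->|->]; case: (unliftP ord_max j) => [j' ->|->] //.
- by rewrite ![gx ddata _]dX_lift !lmulE !mulrA (gxC HX).
- by rewrite ![gx ddata _]/= !dX_lift lmulE !dX_max dval_lmul.
- by rewrite ![gx ddata _]/= !dX_lift lmulE !dX_max dval_lmul.
Qed.

Definition dP (s : {perm 'I_n}) : lend dvec := lmul (gP DR s).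

Lemma dP_at s q f :
  dP s * gat ddata q f = gat ddata (lift_perm ord_max ord_max s q) f * dP s.
Proof.
apply: lendP => v; apply/funext => a; apply/funext => b; rewrite !lendM.
case: (unliftP ord_max q) => [q' ->|->].
  rewrite lift_perm_lift lmulE !dat_lift lmulE !mulrA.
  by rewrite (gP_at HT HP).
by rewrite lift_perm_id lmulE !dat_max dval_lmul.
Qed.

Lemma dP_tel s p q : dP s * gtel ddata p q =
  gtel ddata (lift_perm ord_max ord_max s p) (lift_perm ord_max ord_max s q) * dP s.
Proof.
rewrite /gtel mulr_sumr mulr_suml; apply: eq_bigr => b _.
by rewrite mulrA dP_at -!mulrA dP_at.
Qed.

Lemma dPtt i j : dP (tperm i j) * dP (tperm i j) = 1.
Proof.
apply: lendP => v; apply/funext => a; apply/funext => b.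
by rewrite lendM !lmulE mulrA (gPtt HP) mul1r.
Qed.

Lemma dtel_lift i j v : gtel ddata (lift ord_max i) (lift ord_max j) v = lmul (gtel DR i j) v.
Proof.
apply/funext => a; apply/funext => b; rewrite lmulE /gtel lend_sum dvec_sum mulr_suml.
apply: eq_bigr => c _; rewrite lendM !dat_lift mulrA; congr (_ * _).
rewrite (eparE _ (fbasisH c)) (eparE _ (fdualH c)) !(gatZ HT).
by rewrite (scCA HT) !mulrA (sc_signK DR) mul1r.
Qed.

Lemma dP_x (i i' : 'I_n) : i' = i.+1 :> nat ->
  dP (tperm i i') * dX (lift ord_max i) =
  dX (lift ord_max i') * dP (tperm i i') - gtel ddata (lift ord_max i) (lift ord_max i').
Proof.
move=> ii; apply: lendP => v; rewrite lendD lendN !lendM dtel_lift !dX_lift.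
apply/funext => a; apply/funext => b; rewrite dvecD [(- _) a b]/(- _) /= /lmul_fun.
by rewrite !mulrA (gPx HS ii) mulrBl.
Qed.

Lemma dP_x_succ (i i' : 'I_n) : i' = i.+1 :> nat ->
  dP (tperm i i') * dX (lift ord_max i') =
  dX (lift ord_max i) * dP (tperm i i') + gtel ddata (lift ord_max i') (lift ord_max i).
Proof.
move=> ii; apply: lendP => v; rewrite lendD !lendM dtel_lift !dX_lift.
apply/funext => a; apply/funext => b; rewrite dvecD /= /lmul_fun.
by rewrite !mulrA (gPx_succ HR ii) mulrDl.
Qed.

Lemma dP_x_far (i i' : 'I_n) q : i' = i.+1 :> nat ->
  q != lift ord_max i -> q != lift ord_max i' ->
  dP (tperm i i') * dX q = dX q * dP (tperm i i').
Proof.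
move=> ii; case: (unliftP ord_max q) => [q' ->|->]; last first.
  move=> _ _; apply: lendP => v; apply/funext => a; apply/funext => b.
  by rewrite !lendM lmulE !dX_max dval_lmul.
rewrite !(inj_eq lift_inj) => qi qi'.
apply: lendP => v; apply/funext => a; apply/funext => b.
by rewrite !lendM !dX_lift !lmulE !mulrA (gPx_far HS).
Qed.

End DualModule.

(** * Permutations and their cosets *)

Section Permutations.
Variable n : nat.

(** Adjacent transpositions generate the symmetric group. *)
Lemma perm_adj_ind (Q : {perm 'I_n} -> Prop) : Q 1%g ->
  (forall (i i' : 'I_n) s, i' = i.+1 :> nat -> Q s -> Q (tperm i i' * s)%g) ->
  forall s, Q s.
Proof.
move=> Q1 QM.
have Qlt m (i j : 'I_n) s : j = (i + m).+1 :> nat -> Q s -> Q (tperm i j * s)%g.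
  elim: m j s => [|m IH] j s ijm Qs; first by apply: QM => //; rewrite ijm addn0.
  have lt : ((i + m).+1 < n)%N.
    by apply: leq_ltn_trans (ltn_ord j); rewrite ijm addnS.
  pose l := Ordinal lt.
  have lj : j = l.+1 :> nat by rewrite ijm /= addnS.
  have -> : (tperm i j = tperm l j * tperm i l * tperm l j)%g.
    rewrite -mulgA -{1}(tpermV l j) -conjgE tpermJ tpermL tpermD //.
      by rewrite -val_eqE /= neq_ltn ltnS leq_addr orbT.
    by rewrite -val_eqE /= ijm neq_ltn ltnS leq_addr orbT.
  by rewrite -!mulgA; apply: (QM) => //; apply: IH => //; apply: (QM).
have Qt (i j : 'I_n) s : Q s -> Q (tperm i j * s)%g.
  move=> Qs; case: (ltngtP i j) => [lt|lt|/val_inj->]; last by rewrite tperm1 mul1g.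
    by apply: (Qlt (j - i.+1)%N) => //; rewrite -addSn subnKC.
  by rewrite tpermC; apply: (Qlt (i - j.+1)%N) => //; rewrite -addSn subnKC.
move=> s; have [ts -> _] := prod_tpermP s.
by elim/big_rec: _ => // t u _ Qu; apply: Qt.
Qed.

Lemma unlift_perm_ex (i0 : 'I_n.+1) (s : {perm 'I_n.+1}) : s i0 = i0 ->
  exists h : {perm 'I_n}, lift_perm i0 i0 h = s.
Proof.
move=> sm.
have sl i : s (lift i0 i) != i0.
  by rewrite -[X in _ != X]sm (inj_eq perm_inj) eq_sym neq_lift.
pose g i := odflt i (unlift i0 (s (lift i0 i))).
have gE i : lift i0 (g i) = s (lift i0 i).
  rewrite /g; case: unliftP => [j ->//|E].
  by have := sl i; rewrite E eqxx.
have gI : injective g.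
  move=> i j gij; apply: (@lift_inj _ i0); apply: (@perm_inj _ s).
  by rewrite -!gE gij.
exists (perm gI); apply/permP => i; case: (unliftP i0 i) => [j ->|->].
  by rewrite lift_perm_lift permE gE.
by rewrite lift_perm_id sm.
Qed.

Definition unlift_perm (s : {perm 'I_n.+1}) : {perm 'I_n} :=
  odflt 1%g [pick h | lift_perm ord_max ord_max h == s].

Lemma unlift_permK (s : {perm 'I_n.+1}) : s ord_max = ord_max ->
  lift_perm ord_max ord_max (unlift_perm s) = s.
Proof.
move=> /unlift_perm_ex[h hs]; rewrite /unlift_perm.
by case: pickP => [h' /eqP //|/(_ h)]; rewrite hs eqxx.
Qed.

Lemma lift_permK (h : {perm 'I_n}) : unlift_perm (lift_perm ord_max ord_max h) = h.
Proof.
have := unlift_permK (lift_perm_id ord_max ord_max h) => E.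
apply/permP => i; apply: (@lift_inj _ ord_max).
by rewrite -!(lift_perm_lift ord_max ord_max) E.
Qed.

(** Representatives of the cosets of [S_n] in [S_(n+1)]. *)
Definition tau (j : 'I_n.+1) : {perm 'I_n.+1} := tperm j ord_max.

Lemma tau_coset (s : {perm 'I_n.+1}) (j := s^-1%g ord_max) :
  (tau j * s)%g ord_max = ord_max.
Proof. by rewrite permM tpermR permKV. Qed.

End Permutations.

(** * Functionals on the affine algebra *)

Section Functional.
Variables (k : comNzRingType) (F : frobeniusSuperalgebra k).
Local Notation psi := (nakayama F).
Variables (n : nat) (R : pzRingType) (DR : gdata F n R) (HR : afflaws DR).
Local Notation V := (dvec DR).
Local Notation D := (ddata HR).
Local Notation G := {perm 'I_n.+1}.
Local Notation M := (G -> V).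
Local Notation lft := (lift ord_max).
Local Notation lftp := (lift_perm ord_max ord_max).

Let HT := dtlaws HR.
Let HX := dxlaws HR.
Let MD := mD D.
Let MT : tlaws MD := mtlaws (dsc_E HR) HT.
Let MP : plaws MD := mplaws HT.
Let MA : at_law MD := mat_law (dsc_E HR) HT HX.
(** The representation of the affine algebra on functions from [S_(n+1)] to
    linear maps from the tensor product of [k[x]] and [F] to [R]. *)
Definition coind_data : gdata F n.+1 (lend M) := drinfeld_data MD.

Lemma coind_afflaws : afflaws coind_data.
Proof.
have MY := mYY (dsc_E HR) HT HX.
split; first by case: MT; split.
- exact: (drinfeld_xlaws MT MP MA (@mPY _ _ _ _ D) MY).
- by case: MP; split.
- exact: (drinfeld_sxlaws MT MP (@mPY _ _ _ _ D)).
Qed.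

(** At the identity the sum in [mY i] is the Jucys-Murphy element, so the two
    cancel. *)
Lemma coind_x_at1 i (phi : M) : gx coind_data i phi 1%g = gx D i (phi 1%g).
Proof.
rewrite [gx coind_data i]/= lendD lendN mfunD mYE perm1 -addrA.
rewrite [X in _ + X](_ : _ = 0) ?addr0 //; apply/eqP; rewrite subr_eq0; apply/eqP.
rewrite /jucys_murphy lend_sum mfun_sum; apply: eq_bigr => r _.
rewrite lendM (mtel_E (dsc_E HR) HT) mPE !perm1.
by rewrite mulg1 mul1g.
Qed.

(** Compatibility with the subgroup [S_n], which acts on the values through
    [R]. Such functions form a submodule, and there evaluation at the identity
    is linear over the affine algebra on [n] strands. *)
Definition equivariant (phi : M) : Prop :=
  forall (i i' : 'I_n) s, i' = i.+1 :> nat ->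
    phi (s * lftp (tperm i i'))%g = dP HR (tperm i i') (phi s).

Lemma equiv_sum (I : Type) (S : seq I) (Q : pred I) (E : I -> M) :
  (forall i, Q i -> equivariant (E i)) -> equivariant (\sum_(i <- S | Q i) E i).
Proof.
move=> HE i i' s ii; rewrite !mfun_sum lapp_sum; apply: eq_bigr => l Ql.
exact: HE.
Qed.

Lemma equivD phi phi' : equivariant phi -> equivariant phi' -> equivariant (phi + phi').
Proof. by move=> H H' i i' s ii; rewrite !mfunD H // H' // lappD. Qed.

Lemma equivN phi : equivariant phi -> equivariant (- phi).
Proof.
by move=> H i i' s ii; rewrite !mfunN H // lappN.
Qed.

Lemma equivP s phi : equivariant phi -> equivariant (gP MD s phi).
Proof. by move=> H i i' t ii; rewrite !mPE mulgA H. Qed.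

Lemma equiv_at l f phi : equivariant phi -> equivariant (gat MD l f phi).
Proof.
move=> H i i' s ii; rewrite !(mat_E (dsc_E HR) HT) H // -!lendM.
by rewrite (dP_at HR) permM.
Qed.

Lemma equivT f phi : equivariant phi -> equivariant (gT MD f phi).
Proof.
move=> H; rewrite (gT_prod MT); elim: (enum _) => [|l s IH].
  by rewrite big_nil lendE1.
by rewrite big_cons lendM; apply: equiv_at.
Qed.

(** For a simple transposition [h] of [i] and [i'], the sum in [mY] loses or
    gains one term exactly when [q] is exchanged by [h]. That term is the
    correction in the relation between [h] and the polynomial generator. *)
Lemma equivY l phi : equivariant phi -> equivariant (gx MD l phi).
Proof.
move=> H i i' s ii; rewrite !mYE permM; set q := s l; set h := lftp _.
set S := tperm i i'.
have hE : h = tperm (lft i) (lft i') by rewrite /h lift_tperm_max.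
have hK x : h (h x) = x by rewrite hE tpermK.
rewrite (reindex_inj (@perm_inj _ h)).
rewrite (eq_bigr (fun r => dP HR S (gtel D r q (phi (s * tperm r q)%g)))); last first.
  move=> r _; rewrite -!mulgA -tperm_mulC mulgA H // -!lendM.
  by rewrite (dP_tel HR).
rewrite H // -[gx D]/(dX HR) lappD lapp_sum -!lendM.
have lti : (lft i < lft i')%N by rewrite ltn_lift_max ii.
have [q1|q1] := eqVneq q (lft i).
  rewrite q1 hE tpermL (dP_x HR ii) lendD lendN -addrA; congr (_ + _).
  rewrite [X in _ = _ + X](bigD1 (lft i')) // addrA.
  have -> : phi (s * tperm (lft i') (lft i))%g = dP HR S (phi s).
    by rewrite tpermC -lift_tperm_max H.
  rewrite -!lendM dP_tel -/h hE tpermR tpermL -mulrA dPtt mulr1 addNr add0r.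
  apply: eq_bigl => r.
  have ii'' : lft i' = (lft i).+1 :> nat by rewrite !lift_max.
  case: tpermP => [->|->|r1 r2]; first by rewrite !ltnn.
    by rewrite eqxx andbF ltnNge (ltnW lti).
  by rewrite andbC [r == _]eq_sym -val_eqE [LHS]ltn_neqAle; congr (_ && _); rewrite ii''.
have [q2|q2] := eqVneq q (lft i').
  rewrite q2 hE tpermR (dP_x_succ HR ii) lendD -addrA; congr (_ + _).
  rewrite (bigD1 (lft i)); last by rewrite tpermL.
  have -> : phi (s * tperm (lft i) (lft i'))%g = dP HR S (phi s).
    by rewrite -lift_tperm_max H.
  rewrite -!lendM dP_tel -/h hE tpermR tpermL -mulrA dPtt mulr1.
  congr (_ + _).
  apply: eq_bigl => r.
  have ii'' : lft i' = (lft i).+1 :> nat by rewrite !lift_max.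
  case: tpermP => [->|->|/eqP r1 /eqP r2]; first by rewrite eqxx andbF ltnNge (ltnW lti).
    by rewrite !ltnn.
  by rewrite r1 andbT [RHS]ltn_neqAle val_eqE [_ == r]eq_sym r2 ii''.
rewrite hE tpermD 1?eq_sym // (dP_x_far HR ii) //; congr (_ + _).
apply: eq_bigl => r; have ii'' : lft i' = (lft i).+1 :> nat by rewrite !lift_max.
case: tpermP => [->|->|//].
  by rewrite ii'' ltnS [LHS]leq_eqVlt val_eqE (negPf q1).
by rewrite ii'' ltnS [RHS]leq_eqVlt val_eqE (negPf q1).
Qed.

Lemma equivJ l phi : equivariant phi -> equivariant (jucys_murphy MD l phi).
Proof.
move=> H; rewrite /jucys_murphy lend_sum; apply: equiv_sum => r _.
rewrite lendM /gtel lend_sum; apply: equiv_sum => b _.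
by rewrite lendM; do 2!apply: equiv_at; apply: equivP.
Qed.

Definition coind_rep : {rmorphism affine F n.+1 -> lend M} :=
  sval (cid (affine_lift_ex coind_afflaws)).
Local Notation rho := coind_rep.
Local Notation AD := (aff_data F n.+1).

Lemma rho_sc c : rho (gsc AD c) = gsc MD c.
Proof. by rewrite /coind_rep; case: cid => h [] /=. Qed.
Lemma rho_x i : rho (gx AD i) = gx coind_data i.
Proof. by rewrite /coind_rep; case: cid => h [] /=. Qed.
Lemma rho_T f : rho (gT AD f) = gT MD f.
Proof. by rewrite /coind_rep; case: cid => h [] /=. Qed.
Lemma rho_P s : rho (gP AD s) = gP MD s.
Proof. by rewrite /coind_rep; case: cid => h [] /=. Qed.

Lemma rho_equiv a phi : equivariant phi -> equivariant (rho a phi).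
Proof.
elim/(@aff_generated k F n.+1): a phi => [c|i|f|s|a b Ha Hb|a b Ha Hb] phi H.
- by rewrite rho_sc => i i' s ii; rewrite !mscE H // lappZ.
- rewrite rho_x [gx _ _]/= lendD lendN; apply: equivD; first exact: equivY.
  by apply: equivN; apply: equivJ.
- by rewrite rho_T; apply: equivT.
- by rewrite rho_P; apply: equivP.
- by rewrite rmorphD lendD; apply: equivD; [apply: Ha|apply: Hb].
- by rewrite rmorphM lendM; apply: Ha; apply: Hb.
Qed.

(** Evaluation at the identity, then at [1] in the tensor product of [k[x]]
    and [F]. *)
Definition functional (phi : M) (a : affine F n.+1) : R := dval (rho a phi 1%g) 0 1.

Lemma functionalD phi a b : functional phi (a + b) = functional phi a + functional phi b.
Proof.
rewrite /functional rmorphD lendD mfunD -[X in X + _]scale1r dval_vlinear //.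
by rewrite rmorph1 mul1r.
Qed.

Lemma functional_x phi i a :
  functional phi (gx AD (lft i) * a) = gx DR i * functional phi a.
Proof.
rewrite /functional rmorphM lendM rho_x coind_x_at1 [gx D _]/= dX_lift.
exact: dval_lmul.
Qed.

Lemma mT_at1 f (phi : M) : gT MD f phi 1%g = gT D f (phi 1%g).
Proof.
rewrite (gT_prod MT) (gT_prod HT); elim: (enum _) => [|l s IH].
  by rewrite !big_nil.
by rewrite !big_cons !lendM (mat_E (dsc_E HR) HT) perm1 IH.
Qed.

Lemma functional_T phi f a :
  functional phi (gT AD (ten_widen f) * a) = gT DR f * functional phi a.
Proof.
rewrite /functional rmorphM lendM rho_T mT_at1 (dval_dT _ _ _ _ (@comp1 _ F)).
rewrite ten_widen_max mul1r; congr (gT DR _ * _).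
by apply/ffunP => i; rewrite ffunE epar0 ten_widen_lift.
Qed.

Lemma functional_sc phi c a : functional phi (gsc AD c * a) = gsc DR c * functional phi a.
Proof.
rewrite /functional rmorphM lendM rho_sc mscE -[_ *: _]addr0 dval_vlinear //.
rewrite [X in _ + X](_ : _ = 0) ?addr0 //.
by rewrite /dval big1 // => b _; rewrite mulr0.
Qed.

Lemma functional_P phi s a : equivariant phi ->
  functional phi (gP AD (lftp s) * a) = gP DR s * functional phi a.
Proof.
move=> H; elim/perm_adj_ind: s a => [|i i' s ii IH] a.
  by rewrite lift_perm1 (gP1 (al_P (aff_afflaws F n.+1))) (gP1 (al_P HR)) !mul1r.
rewrite -(lift_permM _ ord_max) -(gPM (al_P (aff_afflaws F n.+1))) -(gPM (al_P HR)).
rewrite -!mulrA IH; congr (_ * _).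
rewrite /functional rmorphM lendM rho_P mPE mulg1.
have := rho_equiv a H 1%g ii; rewrite mul1g => ->.
exact: dval_lmul.
Qed.

Lemma dval_Xn_max u m f : dval ((gx D ord_max ^+ m) u) 0 f = dval u m (iter m psi f).
Proof.
elim: m u f => [|m IH] u f; first by rewrite expr0.
rewrite exprSr lendM IH [gx D _]/= dval_dX_max; congr dval.
Qed.

(** This is what makes the values of a functional on these elements arbitrary. *)
Lemma functional_top phi m f s :
  functional phi (gx AD ord_max ^+ m * gat AD ord_max f * gP AD s) = dval (phi s) m f.
Proof.
rewrite /functional !rmorphM rmorphXn !lendM rho_x rho_T rho_P.
have -> w : (gx coind_data ord_max ^+ m) w 1%g = (gx D ord_max ^+ m) (w 1%g).
  elim: m w => [|m IH] w; first by rewrite !expr0.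
  by rewrite !exprSr !lendM IH coind_x_at1.
rewrite dval_Xn_max mT_at1.
have -> : iter m psi 1 = 1 :> F by elim: m => //= m ->; rewrite rmorph1.
by rewrite [gT D _](_ : _ = gat D ord_max f) // dval_dat_max mul1r mPE mulg1.
Qed.

(** An equivariant function is determined by its values on coset
    representatives, and these are arbitrary. *)
Definition extend (v : 'I_n.+1 -> V) : M := fun s =>
  dP HR (unlift_perm (tau (s^-1%g ord_max) * s)%g) (v (s^-1%g ord_max)).

Lemma dPM s t : dP HR s * dP HR t = dP HR (t * s)%g.
Proof.
apply: lendP => v; apply/funext => a; apply/funext => b.
by rewrite lendM !lmulE mulrA (gPM (al_P HR)).
Qed.

Lemma dP1 : dP HR 1%g = 1.
Proof.
apply: lendP => v; apply/funext => a; apply/funext => b.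
by rewrite !lmulE (gP1 (al_P HR)) mul1r.
Qed.

Lemma extend_equiv v : equivariant (extend v).
Proof.
move=> i i' s ii; rewrite /extend.
have -> : ((s * lftp (tperm i i'))^-1%g) ord_max = s^-1%g ord_max.
  by rewrite invMg permM lift_permV lift_perm_id.
set j := s^-1%g ord_max; rewrite mulgA -lendM dPM; congr (dP HR _ _).
rewrite -[RHS]lift_permK; congr unlift_perm.
by rewrite -(lift_permM _ ord_max) unlift_permK ?tau_coset.
Qed.

Lemma extend_tau v j : extend v (tau j) = v j.
Proof.
rewrite /extend tpermV tpermR tperm2 -(lift_perm1 ord_max) lift_permK.
by rewrite dP1.
Qed.

Lemma extend_level v v' a f : (forall j b, v j a b = v' j a b) ->
  forall s, dval (extend v s) a f = dval (extend v' s) a f.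
Proof.
move=> E s; rewrite !dval_lmul; congr (_ * _).
by apply: eq_bigr => b _; rewrite E.
Qed.

End Functional.

(** * Gradings *)

Section Grading.
Variables (k : comNzRingType) (F : frobeniusSuperalgebra k).
Local Notation homog := (@Defs.comp k F).
Local Notation delta := (maxdeg F).
Variables (n : nat) (A : pzRingType) (D : gdata F n A) (HD : afflaws D).

(** The grading of any ring with such generators; for the cyclotomic quotient
    it is [cyc_comp]. *)
Inductive gcomp : int -> bool -> A -> Prop :=
| gcomp_x i : gcomp delta%:Z false (gx D i)
| gcomp_ten (m : 'I_n -> nat) p (f : {ffun 'I_n -> F}) :
    (forall i, homog (m i) (p i) (f i)) ->
    gcomp (\sum_(i < n) m i)%N%:Z (\big[addb/false]_(i < n) p i) (gT D f)
| gcomp_perm s : gcomp 0 false (gP D s)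
| gcomp_scal c : gcomp 0 false (gsc D c)
| gcomp0 m p : gcomp m p 0
| gcompD m p a b : gcomp m p a -> gcomp m p b -> gcomp m p (a + b)
| gcompM m p m' p' a b : gcomp m p a -> gcomp m' p' b ->
    gcomp (m + m') (p (+) p') (a * b).

Lemma gcomp_cast m p m' p' a : gcomp m p a -> m = m' -> p = p' -> gcomp m' p' a.
Proof. by move=> H <- <-. Qed.

Lemma gcomp1 : gcomp 0 false 1.
Proof. by rewrite -(rmorph1 (gsc D)); apply: gcomp_scal. Qed.

Lemma gcompZ m p c a : gcomp m p a -> gcomp m p (gsc D c * a).
Proof.
by move=> H; apply: gcomp_cast (gcompM (gcomp_scal c) H) _ _; rewrite ?add0r.
Qed.

Lemma gcompN m p a : gcomp m p a -> gcomp m p (- a).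
Proof.
by move=> H; rewrite -mulN1r -(rmorphN1 (gsc D)); apply: gcompZ.
Qed.

Lemma gcomp_sum m p (I : Type) (s : seq I) (P : pred I) (E : I -> A) :
  (forall i, P i -> gcomp m p (E i)) -> gcomp m p (\sum_(i <- s | P i) E i).
Proof.
by move=> HE; elim/big_rec: _ => [|i x Pi Hx]; [apply: gcomp0|apply: gcompD (HE _ Pi) Hx].
Qed.

Lemma gcompX m a e : gcomp m false a -> gcomp (m *+ e) false (a ^+ e).
Proof.
move=> H; elim: e => [|e IH]; first exact: gcomp1.
by rewrite exprS mulrS; apply: gcomp_cast (gcompM H IH) _ _.
Qed.

Lemma gcomp_at i m p f : homog m p f -> gcomp m%:Z p (gat D i f).
Proof.
move=> Hf.
have := @gcomp_ten (fun l => if l == i then m else 0%N) (single i p) (upd [ffun=> 1] i f).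
move=> H; apply: gcomp_cast (H _) _ _.
- move=> l; rewrite !ffunE /single; case: eqP => // _; exact: comp1.
- by rewrite -big_mkcond big_pred1_eq.
- by rewrite (bigD1 i) //= big1 /single ?eqxx ?addbF //= => l /negPf->.
Qed.

Inductive hsum : A -> Prop :=
| hsum0 : hsum 0
| hsumD m p a b : gcomp m p a -> hsum b -> hsum (a + b).

Lemma hsum_gcomp m p a : gcomp m p a -> hsum a.
Proof. by move=> H; rewrite -[a]addr0; apply: hsumD H hsum0. Qed.

Lemma hsum_add a b : hsum a -> hsum b -> hsum (a + b).
Proof.
move=> Ha Hb; elim: Ha => [|m p {}a c H _ IH]; first by rewrite add0r.
by rewrite -addrA; apply: hsumD H IH.
Qed.

Lemma hsum_mul a b : hsum a -> hsum b -> hsum (a * b).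
Proof.
move=> Ha Hb; elim: Ha => [|m p {}a c H _ IH]; first by rewrite mul0r; apply: hsum0.
rewrite mulrDl; apply: hsum_add IH; elim: Hb => [|m' p' {}b b' H' _ IH'].
  by rewrite mulr0; apply: hsum0.
by rewrite mulrDr; apply: hsumD (gcompM H H') IH'.
Qed.

Lemma hsum_all : generated D -> forall a, hsum a.
Proof.
move=> HG; apply: (HG).
- by move=> c; apply: hsum_gcomp (gcomp_scal c).
- by move=> i; apply: hsum_gcomp (gcomp_x i).
- elim/multilinear_ind => [f i u v a Hu Hv|p f Hf].
    rewrite (gTL (al_T HD)); apply: hsum_add Hv.
    by apply: hsum_mul Hu; apply: hsum_gcomp (gcomp_scal a).
  have [m Hm] := boolp.choice Hf; exact: hsum_gcomp (gcomp_ten Hm).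
- by move=> s; apply: hsum_gcomp (gcomp_perm s).
- exact: hsum_add.
- exact: hsum_mul.
Qed.

End Grading.

(** * Adding a strand *)

Section Tower.
Variables (k : comNzRingType) (F : frobeniusSuperalgebra k).
Local Notation homog := (@Defs.comp k F).
Local Notation psi := (nakayama F).
Local Notation delta := (maxdeg F).
Variables (n : nat) (An AN : pzRingType).
Variables (Dn : gdata F n An) (DN : gdata F n.+1 AN).
Variable (iota : {rmorphism An -> AN}).
Local Notation lft := (lift ord_max).
Local Notation lftp := (lift_perm ord_max ord_max).

(** An algebra on [n] strands mapping to one on [n.+1] strands, compatibly
    with the generators. This covers the affine algebras and their cyclotomic
    quotients alike. *)
Record tower : Prop := Tower {
  tw_n : afflaws Dn;
  tw_N : afflaws DN;
  tw_gn : generated Dn;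
  tw_gN : generated DN;
  tw_sc : forall c, iota (gsc Dn c) = gsc DN c;
  tw_x : forall i, iota (gx Dn i) = gx DN (lft i);
  tw_T : forall f, iota (gT Dn f) = gT DN (ten_widen f);
  tw_P : forall s, iota (gP Dn s) = gP DN (lftp s)
}.

Hypothesis W : tower.
Let Hn := tw_n W.
Let HN := tw_N W.
Let HT := al_T HN.
Let HA := xlaws_at (al_X HN).
Let HP := al_P HN.
Let HS := al_SX HN.
Local Notation sc := (gsc DN).
Local Notation P := (gP DN).
Local Notation X_ := (gx DN).
Local Notation X := (gx DN ord_max).
Local Notation at_ := (gat DN).
Local Notation atm := (gat DN ord_max).
Local Notation tel := (gtel DN).
Implicit Types (y : An) (z w : AN) (m : int) (p : bool).

Lemma iota_at i f : iota (gat Dn i f) = at_ (lft i) f.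
Proof. by rewrite /gat (tw_T W) ten_widen_upd ten_widen1. Qed.

Lemma lift_neq_max (i : 'I_n) : lft i != ord_max.
Proof. by rewrite eq_sym neq_lift. Qed.

(** Of the generators only permutations are not immediate, and adjacent
    transpositions of the first [n] indices do not move the last one. *)
Lemma X_iota y : X * iota y = iota y * X.
Proof.
elim/(tw_gn W): y => [c|i|f|s|a b Ha Hb|a b Ha Hb].
- by rewrite (tw_sc W) (gscC HT).
- by rewrite (tw_x W) (gxC (al_X HN)).
- rewrite (tw_T W) (gT_x HT HA) ten_widen_max rmorph1; congr (_ * gT _ _).
  by rewrite -[LHS](upd_id _ ord_max) ten_widen_max.
- rewrite (tw_P W); elim/perm_adj_ind: s => [|i i' s ii IH].
    by rewrite lift_perm1 (gP1 HP) mul1r mulr1.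
  rewrite -(lift_permM _ ord_max) -(gPM HP) mulrA IH -!mulrA; congr (_ * _).
  have ii' : lft i' = (lft i).+1 :> nat by rewrite !lift_max.
  by rewrite lift_tperm_max (gPx_far HS ii' (neq_lift _ _) (neq_lift _ _)).
- by rewrite rmorphD mulrDl mulrDr Ha Hb.
- by rewrite rmorphM mulrA Ha -mulrA Hb mulrA.
Qed.

Lemma Xn_iota a y : X ^+ a * iota y = iota y * X ^+ a.
Proof. by elim: a => [|a IH]; rewrite ?mul1r ?mulr1 // exprS -mulrA IH !mulrA X_iota. Qed.

Lemma at_Xn i a f : at_ i f * X_ i ^+ a = X_ i ^+ a * at_ i (iter a psi f).
Proof.
elim: a f => [|a IH] f; first by rewrite mulr1 mul1r.
by rewrite exprS mulrA (gat_x_same HA) -mulrA IH mulrA iterSr.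
Qed.

Lemma at_Xn_far i j a f : i != j -> at_ i f * X_ j ^+ a = X_ j ^+ a * at_ i f.
Proof.
move=> ij; elim: a => [|a IH]; first by rewrite mulr1 mul1r.
by rewrite exprS mulrA (gat_x_far HA) // -mulrA IH mulrA.
Qed.

Lemma iter_psi_homog a (m : nat) p f : homog m p f -> homog m p (iter a psi f).
Proof. by move=> Hf; elim: a => //= a; apply: nakayama_homog. Qed.

Lemma atm_P s f : atm f * P (lftp s) = P (lftp s) * atm f.
Proof. by rewrite (gP_at HT HP) lift_perm_id. Qed.

(** The last tensor factor supercommutes with everything on the first [n]
    strands. *)
Lemma atm_iota m p (m' : nat) q y f : gcomp Dn m p y -> homog m' q f ->
  atm f * iota y = sc ((-1) ^+ (p && q)) * (iota y * atm f).
Proof.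
move=> Hy Hf; elim: Hy => {m p y}.
- by move=> i; rewrite (tw_x W) (gat_x_far HA) ?neq_lift // rmorph1 mul1r.
- move=> m p g Hg; rewrite (gT_prod (al_T Hn)) rmorph_prod /=.
  rewrite (_ : \big[addb/false]_i p i = \big[addb/false]_(i <- enum 'I_n) p i); last first.
    by rewrite big_enum.
  elim: (enum _) => [|l s IH]; first by rewrite !big_nil rmorph1 !mul1r mulr1.
  rewrite !big_cons iota_at mulrA (gat_comm HT (neq_lift _ _) Hf (Hg l)) -!mulrA IH.
  rewrite (scCA HT) mulrA -rmorphM -signr_addb andbC -andb_addl -/(_ && _) !mulrA.
  by [].
- by move=> s; rewrite (tw_P W) atm_P rmorph1 mul1r.
- by move=> c; rewrite (tw_sc W) rmorph1 mul1r (gscC HT).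
- by move=> m p; rewrite rmorph0 mulr0 mul0r mulr0.
- by move=> m p a b _ Ha _ Hb; rewrite rmorphD mulrDr Ha Hb mulrDl mulrDr.
- move=> m p m1 p1 a b _ Ha _ Hb.
  rewrite rmorphM mulrA Ha -!mulrA Hb (scCA HT) mulrA -rmorphM -signr_addb.
  by rewrite -andb_addl.
Qed.

(** The corrections that arise when a polynomial generator crosses a
    permutation. *)
Inductive telsum : AN -> Prop :=
| telsum_gen l l' s : telsum (tel l l' * P s)
| telsum0 : telsum 0
| telsumD z w : telsum z -> telsum w -> telsum (z + w)
| telsumN z : telsum z -> telsum (- z).

Lemma telsum_P s z : telsum z -> telsum (P s * z).
Proof.
elim=> {z} [l l' t||z w _ Hz _ Hw|z _ Hz].
- rewrite mulrA (gP_tel HT HP) -mulrA (gPM HP); exact: telsum_gen.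
- by rewrite mulr0; apply: telsum0.
- by rewrite mulrDr; apply: telsumD.
- by rewrite mulrN; apply: telsumN.
Qed.

Lemma telsum_Pr s z : telsum z -> telsum (z * P s).
Proof.
elim=> {z} [l l' t||z w _ Hz _ Hw|z _ Hz].
- rewrite -mulrA (gPM HP); exact: telsum_gen.
- by rewrite mul0r; apply: telsum0.
- by rewrite mulrDl; apply: telsumD.
- by rewrite mulNr; apply: telsumN.
Qed.

Lemma P_x s i : exists2 w, telsum w & P s * X_ i = X_ (s i) * P s + w.
Proof.
elim/perm_adj_ind: s i => [|j j' s jj IH] i.
  by exists 0; [exact: telsum0|rewrite (gP1 HP) perm1 mul1r mulr1 addr0].
rewrite -(gPM HP); have [w0 H0 E0] : exists2 w, telsum w &
    P (tperm j j') * X_ i = X_ (tperm j j' i) * P (tperm j j') + w.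
  case: tpermP => [->|->|/eqP ij /eqP ij'].
  - exists (- tel j j'); last by rewrite (gPx HS).
    by apply: telsumN; rewrite -[tel _ _]mulr1 -(gP1 HP); apply: telsum_gen.
  - exists (tel j' j); last by rewrite (gPx_succ HN).
    by rewrite -[tel _ _]mulr1 -(gP1 HP); apply: telsum_gen.
  - by exists 0; [exact: telsum0|rewrite (gPx_far HS) ?addr0].
have [w1 H1 E1] := IH (tperm j j' i).
exists (w1 * P (tperm j j') + P s * w0).
  by apply: telsumD; [apply: telsum_Pr|apply: telsum_P].
by rewrite -mulrA E0 mulrDr mulrA E1 mulrDl permM addrA -mulrA.
Qed.

Lemma x_P s i : exists2 w, telsum w & X_ i * P s = P s * X_ (s^-1%g i) + w.
Proof.
have [w Hw E] := P_x s (s^-1%g i); exists (- w); first exact: telsumN.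
by rewrite E permKV addrK.
Qed.

(** Spanned over [A_n] on the left by [x_(n+1) ^+ a' * f_(n+1) * P s] with [a'
    < a]. The degree and the parity are recorded, since they yield the degree
    of the trace. *)
Inductive lfil (a : nat) : int -> bool -> AN -> Prop :=
| lfil_gen a' y f s m p my py mf pf : (a' < a)%N -> gcomp Dn my py y -> homog mf pf f ->
    m = my + (a' * delta + mf)%N%:Z -> p = py (+) pf ->
    lfil a m p (iota y * X ^+ a' * atm f * P s)
| lfil0 m p : lfil a m p 0
| lfilD m p z w : lfil a m p z -> lfil a m p w -> lfil a m p (z + w).

Lemma lfil_le a a' m p z : (a <= a')%N -> lfil a m p z -> lfil a' m p z.
Proof.
move=> aa; elim=> {m p z}.
- move=> a1 y f s m p my py mf pf lt Hy Hf em ep.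
  exact: lfil_gen (leq_trans lt aa) Hy Hf em ep.
- by move=> m p; apply: lfil0.
- by move=> m p z w _ Hz _ Hw; apply: lfilD.
Qed.

Lemma lfil_cast a m p m' p' z : lfil a m p z -> m = m' -> p = p' -> lfil a m' p' z.
Proof. by move=> H <- <-. Qed.

Lemma lfil_iota a m p m1 p1 y z : gcomp Dn m1 p1 y -> lfil a m p z ->
  lfil a (m1 + m) (p1 (+) p) (iota y * z).
Proof.
move=> Hy; elim=> {m p z}.
- move=> a1 y' f s m p my py mf pf lt Hy' Hf -> ->.
  rewrite !mulrA -rmorphM; apply: lfil_gen lt (gcompM Hy Hy') Hf _ _.
    by rewrite addrA.
  by rewrite addbA.
- by move=> m p; rewrite mulr0; apply: lfil0.
- by move=> m p z w _ Hz _ Hw; rewrite mulrDr; apply: lfilD.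
Qed.

Lemma lfilN a m p z : lfil a m p z -> lfil a m p (- z).
Proof.
move=> H; rewrite -mulN1r -(rmorphN1 sc) -(tw_sc W).
by apply: lfil_cast (lfil_iota (gcomp_scal Dn _) H) _ _; rewrite ?add0r.
Qed.

Lemma lfil_sc a m p c z : lfil a m p z -> lfil a m p (z * sc c).
Proof.
move=> H; rewrite -(gscC HT) -(tw_sc W).
by apply: lfil_cast (lfil_iota (gcomp_scal Dn _) H) _ _; rewrite ?add0r.
Qed.

Lemma lfil_P a m p s z : lfil a m p z -> lfil a m p (z * P s).
Proof.
elim=> {m p z}.
- move=> a1 y f t m p my py mf pf lt Hy Hf em ep.
  by rewrite -mulrA (gPM HP); apply: lfil_gen lt Hy Hf em ep.
- by move=> m p; rewrite mul0r; apply: lfil0.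
- by move=> m p z w _ Hz _ Hw; rewrite mulrDl; apply: lfilD.
Qed.

Lemma lfil_at a m p i (m1 : nat) p1 f z : homog m1 p1 f -> lfil a m p z ->
  lfil a (m + m1%:Z) (p (+) p1) (z * at_ i f).
Proof.
move=> Hf; elim=> {m p z}.
- move=> a1 y g s m p my py mg pg lt Hy Hg -> ->.
  rewrite -mulrA (gP_at HT HP) mulrA.
  case: (unliftP ord_max (s i)) => [j ->|->]; last first.
    rewrite -[_ * atm g * _]mulrA (gatM HT).
    apply: lfil_gen lt Hy (compM Hg Hf) _ _; last by rewrite addbA.
    by rewrite -addrA -PoszD addnA.
  rewrite -[_ * atm g * _]mulrA (gat_comm HT (neq_lift _ _) Hg Hf).
  rewrite -iota_at -(tw_sc W) !mulrA -[_ * X ^+ _ * _]mulrA Xn_iota.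
  rewrite mulrA -[_ * X ^+ _ * _]mulrA Xn_iota mulrA -!rmorphM.
  have := gcompM (gcompM Hy (gcomp_scal Dn ((-1) ^+ (pg && p1)))) (gcomp_at Dn j Hf).
  move=> Hy'; apply: lfil_gen lt Hy' Hg _ _.
    by rewrite addr0 -!addrA [m1%:Z + _]addrC.
  by rewrite addbF -!addbA [p1 (+) _]addbC.
- by move=> m p; rewrite mul0r; apply: lfil0.
- by move=> m p z w _ Hz _ Hw; rewrite mulrDl; apply: lfilD.
Qed.

Lemma lfil_T a m p (m1 : 'I_n.+1 -> nat) (p1 : 'I_n.+1 -> bool) (f : {ffun 'I_n.+1 -> F}) z :
  (forall i, homog (m1 i) (p1 i) (f i)) -> lfil a m p z ->
  lfil a (m + (\sum_i m1 i)%N%:Z) (p (+) \big[addb/false]_i p1 i) (z * gT DN f).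
Proof.
move=> Hf; rewrite (gT_prod HT) -[X in (X)%:Z]big_enum -big_enum /=.
elim: (enum _) m p z => [|l s IH] m p z Hz.
  by rewrite !big_nil mulr1 addr0 addbF.
rewrite !big_cons mulrA PoszD addrA addbA; apply: IH.
exact: lfil_at.
Qed.

Lemma lfil_sum a m p (I : Type) (s : seq I) (Q : pred I) (E : I -> AN) :
  (forall i, Q i -> lfil a m p (E i)) -> lfil a m p (\sum_(i <- s | Q i) E i).
Proof.
by move=> HE; elim/big_rec: _ => [|i x Pi Hx]; [apply: lfil0|apply: lfilD (HE _ Pi) Hx].
Qed.

Lemma lfil_telsum a m p z w : telsum w -> lfil a m p z ->
  lfil a (m + delta%:Z) p (z * w).
Proof.
move=> Hw Hz; elim: Hw => {w} [l l' s||w w' _ H _ H'|w _ H].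
- rewrite mulrA; apply: lfil_P; rewrite /gtel mulr_sumr; apply: lfil_sum => b _.
  rewrite mulrA; apply: lfil_cast (lfil_at l' (fdualH b) (lfil_at l (fbasisH b) Hz)) _ _.
    by rewrite -addrA -PoszD subnKC // fdeg_le.
  by rewrite -addbA addbb addbF.
- by rewrite mulr0; apply: lfil0.
- by rewrite mulrDr; apply: lfilD.
- by rewrite mulrN; apply: lfilN.
Qed.

Lemma lfil_top a (m : nat) p f : homog m p f -> lfil a.+1 (a * delta + m)%N%:Z p (X ^+ a * atm f).
Proof.
move=> Hf; have := lfil_gen 1%g (ltnSn a) (gcomp1 Dn) Hf erefl erefl.
by rewrite rmorph1 mul1r (gP1 HP) mulr1 add0r.
Qed.

Lemma lfil_x a m p i z : lfil a m p z -> lfil a.+1 (m + delta%:Z) p (z * X_ i).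
Proof.
elim=> {m p z}.
- move=> a1 y f s m p my py mf pf lt Hy Hf -> ->.
  have [w Hw E] := P_x s i; rewrite -mulrA E mulrDr; apply: lfilD; last first.
    rewrite -[_ * atm f]mulrA -mulrA.
    have H1 := lfil_telsum Hw (lfil_top a1 Hf).
    have := lfil_iota Hy H1; rewrite !mulrA addrA.
    by apply: lfil_le; apply: leqW.
  rewrite mulrA; case: (unliftP ord_max (s i)) => [j ->|->].
    rewrite -[_ * atm f * _]mulrA (gat_x_far HA) ?neq_lift // -(tw_x W) mulrA.
    rewrite -[_ * X ^+ _ * _]mulrA Xn_iota mulrA -rmorphM.
    have Hy' := gcompM Hy (gcomp_x Dn j).
    apply: lfil_gen (leqW lt) Hy' Hf _ _; last by rewrite addbF.
    by rewrite -!addrA [delta%:Z + _]addrC.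
  rewrite -[_ * atm f * _]mulrA (gat_x_same HA) mulrA -[_ * X ^+ _ * _]mulrA -exprSr.
  apply: lfil_gen _ Hy (nakayama_homog Hf) _ _ => //.
  by rewrite -!addrA -!PoszD mulSn addnAC [(delta + _)%N]addnC addnAC.
- by move=> m p; rewrite mul0r; apply: lfil0.
- by move=> m p z w _ Hz _ Hw; rewrite mulrDl; apply: lfilD.
Qed.

Lemma lfil1 : lfil 1 0 false 1.
Proof. by have := lfil_top 0 (@comp1 _ F); rewrite mul1r (gat1 HT). Qed.

(** Multiplication on the right by a generator raises the filtration by at
    most one, so every element is reached from [1]. *)
Lemma lfil_gcomp m p z : gcomp DN m p z -> exists a, lfil a m p z.
Proof.
suff H : gcomp DN m p z -> forall a m' p' w, lfil a m' p' w ->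
    exists a', lfil a' (m' + m) (p' (+) p) (w * z).
  move=> /H/(_ _ _ _ _ lfil1)[a Ha]; exists a.
  by move: Ha; rewrite mul1r add0r addFb.
elim=> {m p z}.
- by move=> i a m' p' w Hw; exists a.+1; rewrite addbF; apply: lfil_x.
- by move=> m p f Hf a m' p' w Hw; exists a; apply: lfil_T.
- by move=> s a m' p' w Hw; exists a; rewrite addr0 addbF; apply: lfil_P.
- by move=> c a m' p' w Hw; exists a; rewrite addr0 addbF; apply: lfil_sc.
- by move=> m p a m' p' w _; exists a; rewrite mulr0; apply: lfil0.
- move=> m p z z' _ Hz _ Hz' a m' p' w Hw.
  have [a1 H1] := Hz _ _ _ _ Hw; have [a2 H2] := Hz' _ _ _ _ Hw.
  exists (maxn a1 a2); rewrite mulrDr; apply: lfilD.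
    by apply: lfil_le H1; apply: leq_maxl.
  by apply: lfil_le H2; apply: leq_maxr.
- move=> m p m1 p1 z z' _ Hz _ Hz' a m' p' w Hw.
  have [a1 H1] := Hz _ _ _ _ Hw; have [a2 H2] := Hz' _ _ _ _ H1.
  by exists a2; rewrite mulrA addrA addbA.
Qed.

End Tower.

(** * The cyclotomic polynomial *)

Section CyclotomicPolynomial.
Variables (k : comNzRingType) (F : frobeniusSuperalgebra k).
Local Notation homog := (@Defs.comp k F).
Local Notation psi := (nakayama F).
Local Notation delta := (maxdeg F).
Variables (n : nat) (A : pzRingType) (D : gdata F n A) (HD : afflaws D).
Variables (theta : nat) (C : nat -> seq F).
Hypothesis HC : cyclotomic_datum theta C.
Variable i : 'I_n.
Let HT := al_T HD.
Let HA := xlaws_at (al_X HD).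
Local Notation X := (gx D i).
Local Notation at_ := (gat D i).

Definition gchi : A :=
  \prod_(1 <= j < theta.+1) \prod_(c <- C j) (X ^+ j - at_ c).

Lemma gchi_comm z : GRing.comm z X ->
  (forall m c, homog m false c -> GRing.comm z (at_ c)) -> GRing.comm z gchi.
Proof.
move=> zX zc; rewrite /gchi big_nat; apply: commr_prod => j /andP[j0 jt].
rewrite big_seq; apply: commr_prod => c cC; apply: commrB; first exact: commrX.
by have [Hc _ _] := HC (introT andP (conj j0 jt)) cC; apply: zc Hc.
Qed.

Lemma gchi_X : GRing.comm X gchi.
Proof.
rewrite /gchi big_nat; apply: commr_prod => j /andP[j0 jt].
rewrite big_seq; apply: commr_prod => c cC; apply: commrB; first exact: commrX.
have [_ _ Hc] := HC (introT andP (conj j0 jt)) cC.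
by rewrite /GRing.comm (gat_x_same HA) Hc.
Qed.

(** Each factor [x ^+ j - c] of [chi] has the same effect as [x ^+ j], as [c]
    is twisted central for the power [j] of [psi]. *)
Lemma at_gchi f : at_ f * gchi = gchi * at_ (iter (level theta C) psi f).
Proof.
have H1 j c g : (1 <= j < theta.+1)%N -> c \in C j ->
    at_ g * (X ^+ j - at_ c) = (X ^+ j - at_ c) * at_ (iter j psi g).
  move=> jt cC; have [_ [_ tw] _] := HC jt cC.
  have XE : at_ g * X ^+ j = X ^+ j * at_ (iter j psi g).
    elim: (j) g => [|e IH] g; first by rewrite mulr1 mul1r.
    by rewrite exprS mulrA (gat_x_same HA) -mulrA IH mulrA iterSr.
  rewrite mulrBr mulrBl XE !(gatM HT); congr (_ - at_ _).
  elim/homog_ind: g {XE} => [|m p g g' Hg IH].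
    by rewrite mul0r (_ : iter j psi 0 = 0) ?mulr0 //; elim: (j) => //= e ->; rewrite linear0.
  have -> : iter j psi (g + g') = iter j psi g + iter j psi g'.
    by elim: (j) => //= e ->; rewrite linearD.
  by rewrite mulrDl mulrDr IH (tw _ _ _ Hg) scale1r.
have H2 (s : seq F) j g : (1 <= j < theta.+1)%N -> {subset s <= C j} ->
    at_ g * (\prod_(c <- s) (X ^+ j - at_ c)) =
    (\prod_(c <- s) (X ^+ j - at_ c)) * at_ (iter (j * size s) psi g).
  move=> jt; elim: s g => [|c s IH] g sC; first by rewrite big_nil muln0 mul1r mulr1.
  rewrite !big_cons mulrA H1 ?sC ?mem_head // -mulrA IH ?mulrA; last first.
    by move=> x xs; apply: sC; rewrite inE xs orbT.
  by rewrite mulnS addnC iterD.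
have H3 (s : seq nat) g : {in s, forall j, (1 <= j < theta.+1)%N} ->
    at_ g * (\prod_(j <- s) \prod_(c <- C j) (X ^+ j - at_ c)) =
    (\prod_(j <- s) \prod_(c <- C j) (X ^+ j - at_ c)) *
      at_ (iter (\sum_(j <- s) j * size (C j)) psi g).
  elim: s g => [|j s IH] g Hs; first by rewrite !big_nil mul1r mulr1.
  rewrite !big_cons mulrA H2 ?Hs ?mem_head // -mulrA IH ?mulrA; last first.
    by move=> x xs; apply: Hs; rewrite inE xs orbT.
  by rewrite addnC iterD.
apply: H3 => j; rewrite mem_index_iota; by [].
Qed.

(** Elements of degree [d * delta] that involve [x ^+ a] for [a < d] only. *)
Inductive low (d : nat) : A -> Prop :=
| low_gen a g : (a < d)%N -> homog ((d - a) * delta)%N false g -> low d (X ^+ a * at_ g)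
| low0 : low d 0
| lowD z w : low d z -> low d w -> low d (z + w).

Lemma lowN d z : low d z -> low d (- z).
Proof.
elim=> {z} [a g lt Hg||z w _ Hz _ Hw].
- by rewrite -mulrN -(gatN HT); apply: low_gen lt (homogN Hg).
- by rewrite oppr0; apply: low0.
- by rewrite opprD; apply: lowD.
Qed.

Lemma low_factor j d c w : (0 < j)%N -> homog (j * delta)%N false c -> psi c = c ->
  low d (w - X ^+ d) -> low (j + d) ((X ^+ j - at_ c) * w - X ^+ (j + d)).
Proof.
move=> j0 Hc cc Hw.
have -> : (X ^+ j - at_ c) * w - X ^+ (j + d) =
    X ^+ j * (w - X ^+ d) - at_ c * (w - X ^+ d) - at_ c * X ^+ d.
  by rewrite mulrBl !mulrBr exprD -[RHS]addrA -opprD subrK addrAC.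
have cX e : at_ c * X ^+ e = X ^+ e * at_ c.
  elim: e => [|e IH]; first by rewrite mulr1 mul1r.
  by rewrite exprS mulrA (gat_x_same HA) cc -mulrA IH mulrA.
apply: lowD; last first.
  rewrite cX -mulrN -(gatN HT); apply: low_gen; last by rewrite addnK; apply: homogN.
  by rewrite -{1}[d]add0n ltn_add2r.
elim: Hw => {w} [a g lt Hg||z w _ Hz _ Hw].
- apply: lowD.
    rewrite mulrA -exprD; apply: low_gen; first by rewrite ltn_add2l.
    by rewrite subnDl.
  apply: lowN; rewrite mulrA cX -mulrA (gatM HT); apply: low_gen.
    by apply: leq_trans lt (leq_addl _ _).
  by rewrite -addnBA 1?ltnW // mulnDl; apply: (compM Hc Hg).
- by rewrite !mulr0 subrr; apply: low0.
- rewrite !mulrDr opprD addrACA; exact: lowD.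
Qed.

(** Each factor of [chi] is [x ^+ j] plus an element of degree [j * delta]
    that commutes with [x]. *)
Lemma gchi_low : low (level theta C) (gchi - X ^+ level theta C).
Proof.
have H2 (s : seq F) j d w : (1 <= j < theta.+1)%N -> {subset s <= C j} ->
    low d (w - X ^+ d) ->
    low (j * size s + d) ((\prod_(c <- s) (X ^+ j - at_ c)) * w - X ^+ (j * size s + d)).
  move=> jt; elim: s => [|c s IH] sC Hw; first by rewrite big_nil muln0 mul1r.
  have cC : c \in C j by apply: sC; rewrite mem_head.
  have [Hc _ cc] := HC jt cC; have /andP[j0 _] := jt.
  rewrite big_cons -mulrA mulnS -addnA; apply: low_factor => //.
  by apply: IH => // x xs; apply: sC; rewrite inE xs orbT.
have H3 (s : seq nat) : {in s, forall j, (1 <= j < theta.+1)%N} ->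
    low (\sum_(j <- s) j * size (C j))
     (\prod_(j <- s) \prod_(c <- C j) (X ^+ j - at_ c) - X ^+ (\sum_(j <- s) j * size (C j))).
  elim: s => [|j s IH] Hs; first by rewrite !big_nil subrr; apply: low0.
  rewrite !big_cons; apply: H2 => //; first by apply: Hs; rewrite mem_head.
  by apply: IH => x xs; apply: Hs; rewrite inE xs orbT.
apply: H3 => j; rewrite mem_index_iota; by [].
Qed.

End CyclotomicPolynomial.

(** * One-sided spanning families *)

Section Leading.
Variables (k : comNzRingType) (F : frobeniusSuperalgebra k).
Local Notation homog := (@Defs.comp k F).
Local Notation delta := (maxdeg F).
Variables (n : nat) (An AN : pzRingType).
Variables (Dn : gdata F n An) (DN : gdata F n.+1 AN).
Variable (iota : {rmorphism An -> AN}).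
Local Notation lft := (lift ord_max).
Hypothesis W : tower Dn DN iota.
Let HN := tw_N W.
Let HT := al_T HN.
Let HA := xlaws_at (al_X HN).
Let HP := al_P HN.
Local Notation P := (gP DN).
Local Notation X_ := (gx DN).
Local Notation X := (gx DN ord_max).
Local Notation at_ := (gat DN).
Local Notation atm := (gat DN ord_max).
Local Notation tP j := (gP DN (tau j)).
Local Notation lfil := (lfil Dn DN iota).
Implicit Types (y : An) (z w : AN) (m : int) (p : bool) (j : 'I_n.+1).

Lemma tau_j j : tau j j = ord_max. Proof. by rewrite /tau tpermL. Qed.
Lemma tau_max j : tau j ord_max = j. Proof. by rewrite /tau tpermR. Qed.

Lemma tPtP j : tP j * tP j = 1. Proof. exact: (gPtt HP). Qed.

Lemma tP_at j f : tP j * at_ j f = atm f * tP j.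
Proof. by rewrite (gP_at HT HP) tau_j. Qed.
Lemma tP_atm j f : tP j * atm f = at_ j f * tP j.
Proof. by rewrite (gP_at HT HP) tau_max. Qed.

Lemma tP_max : tP ord_max = 1.
Proof. by rewrite /tau tperm1 (gP1 HP). Qed.

Lemma lfil_telsumL a w : telsum DN w -> lfil a.+1 (a.+1 * delta)%N%:Z false (X ^+ a * w).
Proof.
move=> Hw; have := lfil_telsum W Hw (lfil_top W a (@comp1 _ F)).
by rewrite (gat1 HT) mulr1 addn0 -PoszD mulSn addnC.
Qed.

Lemma lead_P j a : lfil a (a * delta)%N%:Z false (tP j * X_ j ^+ a - X ^+ a * tP j).
Proof.
elim: a => [|a IH]; first by rewrite mulr1 mul1r subrr; apply: lfil0.
have [w Hw E] := P_x W (tau j) j.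
have -> : tP j * X_ j ^+ a.+1 - X ^+ a.+1 * tP j =
    (tP j * X_ j ^+ a - X ^+ a * tP j) * X_ j + X ^+ a * w.
  rewrite mulrBl -addrA -mulrA -exprSr; congr (_ + _).
  by rewrite -mulrA E tau_j mulrDr opprD exprSr -!mulrA subrK.
apply: lfilD; last exact: lfil_telsumL.
by apply: lfil_cast (lfil_x W j IH) _ _; rewrite // -PoszD mulSn addnC.
Qed.

Definition leftgen j a f : AN := tP j * X_ j ^+ a * at_ j f.

(** The elements [e j a f] agree with [x_(n+1) ^+ a * f_(n+1) * tau j] up to
    smaller exponents of [x_(n+1)], so that they span the algebra over [A_n]. *)
Definition leading (e : 'I_n.+1 -> nat -> F -> AN) := forall j a (m : nat) p f,
  homog m p f -> lfil a (a * delta + m)%N%:Z p (e j a f - X ^+ a * atm f * tP j).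

Lemma leftgen_leading : leading leftgen.
Proof.
move=> j a m p f Hf; rewrite /leftgen.
have -> : X ^+ a * atm f * tP j = X ^+ a * tP j * at_ j f.
  by rewrite -!mulrA tP_at.
rewrite -mulrBl.
by apply: lfil_cast (lfil_at W j Hf (lead_P j a)) _ _; rewrite ?PoszD ?addFb.
Qed.

Lemma lfil_lead j a (m : nat) p f : homog m p f ->
  lfil a.+1 (a * delta + m)%N%:Z p (X ^+ a * atm f * tP j).
Proof. by move=> Hf; apply: (lfil_P W); apply: (lfil_top W). Qed.

Lemma leading_lfil e j a (m : nat) p f : leading e -> homog m p f ->
  lfil a.+1 (a * delta + m)%N%:Z p (e j a f).
Proof.
move=> He Hf; rewrite -[e j a f](subrK (X ^+ a * atm f * tP j)).
by apply: lfilD (lfil_lead j a Hf); apply: lfil_le (He _ _ _ _ _ Hf).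
Qed.

Inductive lspan (e : 'I_n.+1 -> nat -> F -> AN) : AN -> Prop :=
| lspan_gen j a y f : lspan e (iota y * e j a f)
| lspan0 : lspan e 0
| lspanD z w : lspan e z -> lspan e w -> lspan e (z + w).

Lemma lspan_iota e y z : lspan e z -> lspan e (iota y * z).
Proof.
elim=> {z} [j a y' f||z w _ Hz _ Hw].
- by rewrite mulrA -rmorphM; apply: lspan_gen.
- by rewrite mulr0; apply: lspan0.
- by rewrite mulrDr; apply: lspanD.
Qed.

Lemma lspanN e z : lspan e z -> lspan e (- z).
Proof. by move=> H; rewrite -mulN1r -(rmorphN1 iota); apply: lspan_iota. Qed.

Lemma P_coset s : exists h j, P s = iota (gP Dn h) * tP j.
Proof.
pose j := s^-1%g ord_max.
have [h Eh] := unlift_perm_ex (tau_coset s); exists h, j.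
by rewrite (tw_P W) (gPM HP) Eh mulgA /tau tperm2 mul1g.
Qed.

Lemma P_coset_r s : exists h j, P s = tP j * iota (gP Dn h).
Proof.
pose j := s ord_max.
have E : (s * tau j)%g ord_max = ord_max by rewrite permM tau_j.
have [h Eh] := unlift_perm_ex E; exists h, j.
by rewrite (tw_P W) (gPM HP) Eh -mulgA /tau tperm2 mulg1.
Qed.

Lemma atm_iotaP f h : atm f * iota (gP Dn h) = iota (gP Dn h) * atm f.
Proof. by rewrite (tw_P W) (atm_P W). Qed.

(** Subtraction of the generator with the same leading term lowers the
    exponent. *)
Lemma lfil_lspan e a m p z : leading e -> lfil a m p z -> lspan e z.
Proof.
move=> He; elim/ltn_ind: a m p z => a IH m p z; elim=> {m p z}.
- move=> a1 y f s m p my py mf pf lt Hy Hf _ _.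
  have [h [j ->]] := P_coset s.
  have -> : iota y * X ^+ a1 * atm f * (iota (gP Dn h) * tP j) =
      iota (y * gP Dn h) * (X ^+ a1 * atm f * tP j).
    rewrite rmorphM -!mulrA; congr (_ * _); rewrite [atm f * (_ * _)]mulrA atm_iotaP.
    by rewrite -mulrA mulrA (Xn_iota W) -mulrA.
  apply: lspan_iota.
  rewrite -[X in lspan e X](subKr (e j a1 f)); apply: lspanD.
    by rewrite -[e j a1 f]mul1r -(rmorph1 iota); apply: lspan_gen.
  by apply: lspanN; apply: IH lt _ _ _ (He _ _ _ _ _ Hf).
- by move=> *; apply: lspan0.
- by move=> m p z w _ Hz _ Hw; apply: lspanD.
Qed.

Lemma lspan_all e z : leading e -> lspan e z.
Proof.
move=> He; elim: (hsum_all HN (tw_gN W) z) => [|m p {}z w Hz _ IH]; first exact: lspan0.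
apply: lspanD IH; have [a Ha] := lfil_gcomp W Hz; exact: lfil_lspan Ha.
Qed.

(** The same filtration with [A_n] on the right, without degrees. *)
Inductive rfil (a : nat) : AN -> Prop :=
| rfil_gen a' s f y (m : nat) p : (a' < a)%N -> homog m p f ->
    rfil a (P s * X ^+ a' * atm f * iota y)
| rfil0 : rfil a 0
| rfilD z w : rfil a z -> rfil a w -> rfil a (z + w).

Lemma rfil_le a a' z : (a <= a')%N -> rfil a z -> rfil a' z.
Proof.
move=> aa; elim=> {z} [a1 s f y m p lt Hf||z w _ Hz _ Hw].
- exact: rfil_gen (leq_trans lt aa) Hf.
- exact: rfil0.
- exact: rfilD.
Qed.

Lemma rfil_iota a z y : rfil a z -> rfil a (z * iota y).
Proof.
elim=> {z} [a1 s f y' m p lt Hf||z w _ Hz _ Hw].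
- by rewrite -mulrA -rmorphM; apply: rfil_gen lt Hf.
- by rewrite mul0r; apply: rfil0.
- by rewrite mulrDl; apply: rfilD.
Qed.

Lemma rfilN a z : rfil a z -> rfil a (- z).
Proof. by move=> H; rewrite -mulrN1 -(rmorphN1 iota); apply: rfil_iota. Qed.

Lemma rfil_P a s z : rfil a z -> rfil a (P s * z).
Proof.
elim=> {z} [a1 t f y m p lt Hf||z w _ Hz _ Hw].
- by rewrite !mulrA (gPM HP); apply: rfil_gen lt Hf.
- by rewrite mulr0; apply: rfil0.
- by rewrite mulrDr; apply: rfilD.
Qed.

Lemma rfil_at a i (m : nat) p f z : homog m p f -> rfil a z -> rfil a (at_ i f * z).
Proof.
move=> Hf; elim=> {z} [a1 s g y m1 p1 lt Hg||z w _ Hz _ Hw].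
- have -> : at_ i f * (P s * X ^+ a1 * atm g * iota y) =
      P s * (at_ (s^-1%g i) f * X ^+ a1 * atm g * iota y).
    by rewrite !mulrA -{1}(permKV s i) -(gP_at HT HP).
  case: (unliftP ord_max (s^-1%g i)) => [j ->|->].
    have -> : P s * (at_ (lft j) f * X ^+ a1 * atm g * iota y) =
        P s * X ^+ a1 * atm g * iota (gsc Dn ((-1) ^+ (p && p1)) * (gat Dn j f * y)).
      rewrite !rmorphM (tw_sc W) (iota_at W) (at_Xn_far W) ?lift_neq_max //.
      rewrite -!mulrA; congr (_ * (_ * _)).
      by rewrite mulrA (gat_comm HT (lift_neq_max j) Hf Hg) -!mulrA (scCA HT).
    exact: rfil_gen lt Hg.
  rewrite (at_Xn W) -[X ^+ a1 * _ * _]mulrA (gatM HT) !mulrA.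
  exact: rfil_gen lt (compM (iter_psi_homog a1 Hf) Hg).
- by rewrite mulr0; apply: rfil0.
- by rewrite mulrDr; apply: rfilD.
Qed.

Lemma rfil_sum a (I : Type) (s : seq I) (Q : pred I) (E : I -> AN) :
  (forall i, Q i -> rfil a (E i)) -> rfil a (\sum_(i <- s | Q i) E i).
Proof.
by move=> HE; elim/big_rec: _ => [|i x Pi Hx]; [apply: rfil0|apply: rfilD (HE _ Pi) Hx].
Qed.

Lemma rfil_telsum a z w : telsum DN w -> rfil a z -> rfil a (w * z).
Proof.
move=> Hw Hz; elim: Hw => {w} [l l' s||w w' _ H _ H'|w _ H].
- rewrite -mulrA /gtel mulr_suml; apply: rfil_sum => b _.
  rewrite -mulrA; apply: rfil_at (fbasisH b) _; apply: rfil_at (fdualH b) _.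
  exact: rfil_P.
- by rewrite mul0r; apply: rfil0.
- by rewrite mulrDl; apply: rfilD.
- by rewrite mulNr; apply: rfilN.
Qed.

Lemma rfil_top a (m : nat) p f : homog m p f -> rfil a.+1 (X ^+ a * atm f).
Proof.
move=> Hf; have := @rfil_gen a.+1 a 1%g f 1 m p (ltnSn a) Hf.
by rewrite (gP1 HP) mul1r rmorph1 mulr1.
Qed.

Lemma rfil_x a i z : rfil a z -> rfil a.+1 (X_ i * z).
Proof.
elim=> {z} [a1 s f y m p lt Hf||z w _ Hz _ Hw].
- have [w Hw E] := x_P W s i.
  rewrite !mulrA E !mulrDl; apply: rfilD; last first.
    rewrite -!mulrA; apply: rfil_telsum Hw _; rewrite mulrA; apply: rfil_iota.
    by apply: rfil_le (rfil_top a1 Hf); apply: leqW.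
  rewrite -[_ * _ * X ^+ a1]mulrA; case: (unliftP ord_max (s^-1%g i)) => [j ->|->].
    have -> : P s * (X_ (lft j) * X ^+ a1) * atm f * iota y =
        P s * X ^+ a1 * atm f * iota (gx Dn j * y).
      rewrite rmorphM -(tw_x W) -(Xn_iota W) -!mulrA; congr (_ * (_ * _)).
      by rewrite (tw_x W) mulrA -(gat_x_far HA) ?neq_lift // -mulrA.
    exact: rfil_gen (leqW lt) Hf.
  by rewrite -exprS; apply: rfil_gen Hf.
- by rewrite mulr0; apply: rfil0.
- by rewrite mulrDr; apply: rfilD.
Qed.

Definition rightgen j a f : AN := X_ j ^+ a * at_ j f * tP j.

Lemma rightgen_lead j a (m : nat) p f : homog m p f ->
  rfil a (rightgen j a f - tP j * (X ^+ a * atm f)).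
Proof.
move=> Hf; rewrite /rightgen -mulrA -tP_atm.
elim: a => [|a IH]; first by rewrite !mul1r subrr; apply: rfil0.
have [w Hw E] := x_P W (tau j) j.
have -> : X_ j ^+ a.+1 * (tP j * atm f) - tP j * (X ^+ a.+1 * atm f) =
   X_ j * (X_ j ^+ a * (tP j * atm f) - tP j * (X ^+ a * atm f)) + w * (X ^+ a * atm f).
  rewrite mulrBr -addrA !mulrA -exprS; congr (_ + _).
  by rewrite E /tau tpermV tpermL exprS !mulrA !mulrDl !opprD subrK.
by apply: rfilD (rfil_telsum Hw (rfil_top a Hf)); apply: rfil_x.
Qed.

Inductive rspan : AN -> Prop :=
| rspan_gen j a f y : rspan (rightgen j a f * iota y)
| rspan0 : rspan 0
| rspanD z w : rspan z -> rspan w -> rspan (z + w).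

Lemma rspan_iota y z : rspan z -> rspan (z * iota y).
Proof.
elim=> {z} [j a f y'||z w _ Hz _ Hw].
- by rewrite -mulrA -rmorphM; apply: rspan_gen.
- by rewrite mul0r; apply: rspan0.
- by rewrite mulrDl; apply: rspanD.
Qed.

Lemma rspanN z : rspan z -> rspan (- z).
Proof. by move=> H; rewrite -mulrN1 -(rmorphN1 iota); apply: rspan_iota. Qed.

Lemma rfil_rspan a z : rfil a z -> rspan z.
Proof.
elim/ltn_ind: a z => a IH z; elim=> {z} [a1 s f y m p lt Hf||z w _ Hz _ Hw].
- have [h [j ->]] := P_coset_r s.
  have -> : tP j * iota (gP Dn h) * X ^+ a1 * atm f * iota y =
      tP j * (X ^+ a1 * atm f) * iota (gP Dn h * y).
    rewrite rmorphM -!mulrA; congr (_ * _); rewrite mulrA -(Xn_iota W) -mulrA.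
    by congr (_ * _); rewrite mulrA -atm_iotaP -mulrA.
  apply: rspan_iota.
  rewrite -[X in rspan X](subKr (rightgen j a1 f)); apply: rspanD.
    by rewrite -[rightgen _ _ _]mulr1 -(rmorph1 iota); apply: rspan_gen.
  by apply: rspanN; apply: IH lt _ (rightgen_lead j a1 Hf).
- exact: rspan0.
- exact: rspanD.
Qed.

Lemma rfil_all z : exists a, rfil a z.
Proof.
suff H : forall a w, rfil a w -> exists a', rfil a' (z * w).
  have H1 : rfil 1 1 by have := rfil_top 0 (@comp1 _ F); rewrite mul1r (gat1 HT).
  by have [a Ha] := H _ _ H1; exists a; rewrite -[z]mulr1.
elim/(tw_gN W): z => [c|i|f|s|z z' Hz Hz'|z z' Hz Hz'] a w Hw.
- by exists a; rewrite (gscC HT) -(tw_sc W); apply: rfil_iota.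
- by exists a.+1; apply: rfil_x.
- exists a; rewrite (gT_prod HT); elim: (enum _) => [|l s IH].
    by rewrite big_nil mul1r.
  rewrite big_cons -mulrA; elim/homog_ind: (f l) => [|m p g g' Hg IHg].
    by rewrite (gat0 HT) mul0r; apply: rfil0.
  by rewrite (gatD HT) mulrDl; apply: rfilD IHg; apply: rfil_at Hg IH.
- by exists a; apply: rfil_P.
- have [a1 H1] := Hz _ _ Hw; have [a2 H2] := Hz' _ _ Hw.
  exists (maxn a1 a2); rewrite mulrDl; apply: rfilD.
    by apply: rfil_le H1; apply: leq_maxl.
  by apply: rfil_le H2; apply: leq_maxr.
- have [a1 H1] := Hz' _ _ Hw; have [a2 H2] := Hz _ _ H1.
  by exists a2; rewrite -mulrA.
Qed.

Lemma rspan_all z : rspan z.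
Proof. by have [a /rfil_rspan] := rfil_all z. Qed.

End Leading.

(** * Two-sided filtration and the ideal of the cyclotomic polynomial *)

Section Mackey.
Variables (k : comNzRingType) (F : frobeniusSuperalgebra k).
Local Notation homog := (@Defs.comp k F).
Local Notation psi := (nakayama F).
Local Notation delta := (maxdeg F).
Variables (n : nat) (An AN : pzRingType).
Variables (Dn : gdata F n An) (DN : gdata F n.+1 AN).
Variable (iota : {rmorphism An -> AN}).
Local Notation lft := (lift ord_max).
Hypothesis W : tower Dn DN iota.
Let Hn := tw_n W.
Let HN := tw_N W.
Let HT := al_T HN.
Let HA := xlaws_at (al_X HN).
Local Notation sc := (gsc DN).
Local Notation P := (gP DN).
Local Notation X_ := (gx DN).
Local Notation X := (gx DN ord_max).
Local Notation at_ := (gat DN).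
Local Notation atm := (gat DN ord_max).
Local Notation tP j := (gP DN (tau j)).
Local Notation lfil := (lfil Dn DN iota).
Implicit Types (y : An) (z w : AN) (p : bool).

(** The bimodule spanned by the two kinds of summands of the decomposition,
    with exponents of [x_(n+1)] less than [m] in the first kind. *)
Inductive bifil (m : nat) : AN -> Prop :=
| bifil_poly a f y (mf : nat) pf my py : (a < m)%N -> homog mf pf f -> gcomp Dn my py y ->
    bifil m (X ^+ a * atm f * iota y)
| bifil_perm (j : 'I_n) y y' my py my' py' : gcomp Dn my py y -> gcomp Dn my' py' y' ->
    bifil m (iota y * tP (lft j) * iota y')
| bifil0 : bifil m 0
| bifilD z w : bifil m z -> bifil m w -> bifil m (z + w).

Lemma bifil_le a a' z : (a <= a')%N -> bifil a z -> bifil a' z.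
Proof.
move=> aa; elim=> {z} [c f y mf pf my py lt Hf Hy|j y y' my py my' py' Hy Hy'||z w _ Hz _ Hw].
- exact: bifil_poly (leq_trans lt aa) Hf Hy.
- exact: bifil_perm Hy Hy'.
- exact: bifil0.
- exact: bifilD.
Qed.

Lemma iota_atm my py (m : nat) q y f : gcomp Dn my py y -> homog m q f ->
  iota y * atm f = sc ((-1) ^+ (py && q)) * (atm f * iota y).
Proof.
by move=> Hy Hf; rewrite (atm_iota W Hy Hf) mulrA sc_signK mul1r.
Qed.

Lemma bifil_iotal m y z : bifil m z -> bifil m (iota y * z).
Proof.
move=> Hz; elim: (hsum_all Hn (tw_gn W) y) => {y} [|m0 p0 y y1 Hy _ IH].
  by rewrite rmorph0 mul0r; apply: bifil0.
rewrite rmorphD mulrDl; apply: bifilD IH.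
elim: Hz => {z} [c f y' mf pf my py lt Hf Hy'|j y2 y' my py my' py' Hy2 Hy'||z w _ Hz _ Hw].
- have -> : iota y * (X ^+ c * atm f * iota y') =
      X ^+ c * atm f * iota (gsc Dn ((-1) ^+ (p0 && pf)) * (y * y')).
    rewrite !rmorphM (tw_sc W) !mulrA -(Xn_iota W) -!mulrA; congr (_ * _).
    by rewrite mulrA (iota_atm Hy Hf) -mulrA (scCA HT) -mulrA.
  by apply: bifil_poly lt Hf (gcompZ _ (gcompM Hy Hy')).
- by rewrite !mulrA -rmorphM; apply: bifil_perm (gcompM Hy Hy2) Hy'.
- by rewrite mulr0; apply: bifil0.
- by rewrite mulrDr; apply: bifilD.
Qed.

Lemma bifil_iotar m y z : bifil m z -> bifil m (z * iota y).
Proof.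
move=> Hz; elim: (hsum_all Hn (tw_gn W) y) => {y} [|m0 p0 y y1 Hy _ IH].
  by rewrite rmorph0 mulr0; apply: bifil0.
rewrite rmorphD mulrDr; apply: bifilD IH.
elim: Hz => {z} [c f y' mf pf my py lt Hf Hy'|j y2 y' my py my' py' Hy2 Hy'||z w _ Hz _ Hw].
- by rewrite -!mulrA -rmorphM mulrA; apply: bifil_poly lt Hf (gcompM Hy' Hy).
- by rewrite -!mulrA -rmorphM mulrA; apply: bifil_perm Hy2 (gcompM Hy' Hy).
- by rewrite mul0r; apply: bifil0.
- by rewrite mulrDl; apply: bifilD.
Qed.

Lemma bifilN m z : bifil m z -> bifil m (- z).
Proof. by move=> H; rewrite -mulN1r -(rmorphN1 iota); apply: bifil_iotal. Qed.

Lemma bifil_sc m c z : bifil m z -> bifil m (sc c * z).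
Proof. by move=> H; rewrite -(tw_sc W); apply: bifil_iotal. Qed.

Lemma bifil_atl m (mg : nat) pg g z : homog mg pg g -> bifil m z -> bifil m (atm g * z).
Proof.
move=> Hg; elim=> {z} [c f y' mf pf my py lt Hf Hy'|j y y' my py my' py' Hy Hy'||z w _ Hz _ Hw].
- rewrite !mulrA (at_Xn W) -[X ^+ c * _ * _]mulrA (gatM HT).
  exact: bifil_poly lt (compM (iter_psi_homog c Hg) Hf) Hy'.
- rewrite !mulrA (atm_iota W Hy Hg) -!mulrA; apply: bifil_sc.
  rewrite (mulrA (atm g)) -(tP_at W) -(iota_at W) -mulrA -rmorphM mulrA.
  exact: bifil_perm Hy (gcompM (gcomp_at Dn j Hg) Hy').
- by rewrite mulr0; apply: bifil0.
- by rewrite mulrDr; apply: bifilD.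
Qed.

Lemma bifil_atr m (mg : nat) pg g z : homog mg pg g -> bifil m z -> bifil m (z * atm g).
Proof.
move=> Hg; elim=> {z} [c f y mf pf my py lt Hf Hy|j y y' my py my' py' Hy Hy'||z w _ Hz _ Hw].
- rewrite -mulrA (iota_atm Hy Hg) (scCA HT); apply: bifil_sc.
  rewrite mulrA -[X ^+ c * _ * _]mulrA (gatM HT).
  exact: bifil_poly lt (compM Hf Hg) Hy.
- rewrite -mulrA (iota_atm Hy' Hg) (scCA HT); apply: bifil_sc.
  rewrite mulrA -[iota y * _ * _]mulrA (tP_atm W) -(iota_at W) mulrA -rmorphM.
  exact: bifil_perm (gcompM Hy (gcomp_at Dn j Hg)) Hy'.
- by rewrite mul0r; apply: bifil0.
- by rewrite mulrDl; apply: bifilD.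
Qed.

Lemma bifil_sum a (I : Type) (s : seq I) (Q : pred I) (E : I -> AN) :
  (forall i, Q i -> bifil a (E i)) -> bifil a (\sum_(i <- s | Q i) E i).
Proof.
by move=> HE; elim/big_rec: _ => [|i x Pi Hx]; [apply: bifil0|apply: bifilD (HE _ Pi) Hx].
Qed.

Lemma bifil_tau m (j : 'I_n) : bifil m (tP (lft j)).
Proof.
have := bifil_perm m j (gcomp1 Dn) (gcomp1 Dn).
by rewrite rmorph1 mul1r mulr1.
Qed.

Lemma bifil1 : bifil 1 1.
Proof.
have := bifil_poly (ltnSn 0) (@comp1 _ F) (gcomp1 Dn).
by rewrite rmorph1 mulr1 mul1r (gat1 HT).
Qed.

Lemma bifil_P s : bifil 1 (P s).
Proof.
have [h [j ->]] := P_coset W s; apply: bifil_iotal.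
case: (unliftP ord_max j) => [j' ->|->]; first exact: bifil_tau.
by rewrite (tP_max W); apply: bifil1.
Qed.

Lemma bifil_telsum w : telsum DN w -> bifil 1 w.
Proof.
elim=> {w} [l l' s||z w _ Hz _ Hw|z _ Hz].
- rewrite /gtel mulr_suml; apply: bifil_sum => b _; rewrite -mulrA.
  have at_bifil i (m : nat) p f z : homog m p f -> bifil 1 z -> bifil 1 (at_ i f * z).
    move=> Hf Hz; case: (unliftP ord_max i) => [j ->|->]; last exact: bifil_atl Hf Hz.
    by rewrite -(iota_at W); apply: bifil_iotal.
  exact: at_bifil (fbasisH b) (at_bifil _ _ _ _ _ (fdualH b) (bifil_P s)).
- exact: bifil0.
- exact: bifilD.
- exact: bifilN.
Qed.

Lemma bifil_Xl m z : bifil m z -> bifil m.+1 (X * z).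
Proof.
elim=> {z} [c f y mf pf my py lt Hf Hy|j y y' my py my' py' Hy Hy'||z w _ Hz _ Hw].
- by rewrite !mulrA -exprS; apply: bifil_poly Hf Hy.
- rewrite !mulrA (X_iota W) -!mulrA; apply: bifil_iotal.
  have [w Hw E] := x_P W (tau (lft j)) ord_max.
  rewrite mulrA E /tau tpermV tpermR mulrDl; apply: bifilD.
    by rewrite -mulrA -(tw_x W) -rmorphM; apply: bifil_iotar; apply: bifil_tau.
  by apply: bifil_iotar; apply: bifil_le (bifil_telsum Hw).
- by rewrite mulr0; apply: bifil0.
- by rewrite mulrDr; apply: bifilD.
Qed.

Lemma bifil_Xr m z : bifil m z -> bifil m.+1 (z * X).
Proof.
elim=> {z} [c f y mf pf my py lt Hf Hy|j y y' my py my' py' Hy Hy'||z w _ Hz _ Hw].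
- rewrite -mulrA -(X_iota W) mulrA -[_ * atm f * X]mulrA (gat_x_same HA) mulrA -exprSr.
  by apply: bifil_poly (nakayama_homog Hf) Hy.
- rewrite -!mulrA -(X_iota W); apply: bifil_iotal.
  have [w Hw E] := P_x W (tau (lft j)) ord_max.
  rewrite mulrA E /tau tpermR mulrDl; apply: bifilD.
    by rewrite -(tw_x W); apply: bifil_iotar; apply: bifil_iotal; apply: bifil_tau.
  by apply: bifil_iotar; apply: bifil_le (bifil_telsum Hw).
- by rewrite mul0r; apply: bifil0.
- by rewrite mulrDl; apply: bifilD.
Qed.

Lemma bifil_Xnl m a z : bifil m z -> bifil (a + m) (X ^+ a * z).
Proof.
move=> Hz; elim: a => [|a IH]; first by rewrite mul1r.
by rewrite exprS -mulrA; apply: bifil_Xl.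
Qed.

Lemma bifil_Xnr m a z : bifil m z -> bifil (a + m) (z * X ^+ a).
Proof.
move=> Hz; elim: a => [|a IH]; first by rewrite mulr1.
by rewrite exprSr mulrA; apply: bifil_Xr.
Qed.

Lemma lfil_bifil a m p z : lfil a m p z -> bifil a z.
Proof.
elim=> {m p z} [a1 y f s m p my py mf pf lt Hy Hf _ _|m p|m p z w _ Hz _ Hw].
- rewrite -!mulrA; apply: bifil_iotal; apply: (bifil_le lt).
  by rewrite -addn1; apply: bifil_Xnl; apply: bifil_atl Hf _; apply: bifil_P.
- exact: bifil0.
- exact: bifilD.
Qed.

Variables (theta : nat) (C : nat -> seq F).
Hypothesis HC : cyclotomic_datum theta C.
Local Notation d := (level theta C).
Local Notation chi := (gchi DN theta C ord0).
Local Notation tP0 := (gP DN (tau ord0)).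

(** Up to factors that commute past [chi] to the outside, the elements [u *
    chi * v] of the ideal are combinations of these. *)
Definition zgen a f : AN := tP0 * (chi * X_ ord0 ^+ a * at_ ord0 f) * tP0.

(** Replacing [chi] by [x_1 ^+ d] changes the element by lower exponents, and
    [tau_1 * x_1 ^+ (d + a)] leads with [x_(n+1) ^+ (d + a) * tau_1]. *)
Lemma zgen_lead a (m : nat) p f : homog m p f ->
  lfil (d + a) ((d + a) * delta + m)%N%:Z p (zgen a f - X ^+ (d + a) * atm f).
Proof.
move=> Hf.
have -> : zgen a f - X ^+ (d + a) * atm f =
    (leftgen DN ord0 (d + a) f - X ^+ (d + a) * atm f * tP0) * tP0
    + tP0 * ((chi - X_ ord0 ^+ d) * X_ ord0 ^+ a * at_ ord0 f) * tP0.
  rewrite /zgen /leftgen mulrBl -[_ * tP0 * tP0]mulrA (tPtP W) mulr1.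
  rewrite addrAC; congr (_ - _); rewrite -mulrDl; congr (_ * _).
  rewrite -[tP0 * _ * _]mulrA -mulrDr; congr (_ * _); rewrite exprD -!mulrDl.
  by rewrite addrC subrK.
apply: lfilD; first by apply: (lfil_P W); apply: (leftgen_leading W).
apply: (lfil_P W).
elim: (gchi_low HN HC ord0) => [c g lt Hg||z w _ Hz _ Hw].
- have -> : tP0 * (X_ ord0 ^+ c * at_ ord0 g * X_ ord0 ^+ a * at_ ord0 f) =
      leftgen DN ord0 (c + a) (iter a psi g * f).
    rewrite /leftgen -!mulrA; congr (_ * _); rewrite (mulrA (at_ _ g)) (at_Xn W).
    by rewrite -mulrA (gatM HT) exprD !mulrA.
  have Hh := compM (iter_psi_homog a Hg) Hf.
  have := leading_lfil W ord0 (c + a) (leftgen_leading W) Hh => H.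
  have lt' : (c + a < d + a)%N by rewrite ltn_add2r.
  apply: lfil_cast (lfil_le lt' H) _ _ => //.
  congr (Posz _); rewrite addnA -mulnDl; congr (_ * _ + _)%N.
  by rewrite addnAC subnKC // ltnW.
- by rewrite !mul0r mulr0; apply: lfil0.
- by rewrite !mulrDl mulrDr; apply: lfilD.
Qed.

(** A spanning family over [A_n] that contains the elements on which the trace
    must vanish for the sake of the ideal of [chi]. *)
Definition cgen (j : 'I_n.+1) a f : AN :=
  if (j == ord_max) && (d <= a)%N then zgen (a - d) f else leftgen DN j a f.

Lemma cgen_leading : leading Dn DN iota cgen.
Proof.
move=> j a m p f Hf; rewrite /cgen; case: ifP => [/andP[/eqP-> da]|_].
  by have := zgen_lead (a - d) Hf; rewrite subnKC // (tP_max W) mulr1.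
exact: (leftgen_leading W).
Qed.

(** It contains the double coset summand by [perm_kspan], and the trace is
    prescribed on its generators. *)
Inductive kspan : AN -> Prop :=
| kspan_gen (j : 'I_n) a y f : kspan (iota y * leftgen DN (lft j) a f)
| kspan0 : kspan 0
| kspanD z w : kspan z -> kspan w -> kspan (z + w).

Lemma leftgen_linear j a (c : k) f g :
  leftgen DN j a (c *: f + g) = sc c * leftgen DN j a f + leftgen DN j a g.
Proof. by rewrite /leftgen (gat_linear HT) mulrDr (scCA HT). Qed.

Lemma cgen_linear j a (c : k) f g : cgen j a (c *: f + g) = sc c * cgen j a f + cgen j a g.
Proof.
rewrite /cgen; case: ifP => _; last exact: leftgen_linear.
by rewrite /zgen (gat_linear HT) !mulrDr mulrDl !(scCA HT) -[sc c * _ * _]mulrA.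
Qed.

End Mackey.

(** * The double coset summand *)

Section Restriction.
Variables (k : comNzRingType) (F : frobeniusSuperalgebra k).
Variables (n : nat) (A0 A1 A2 : pzRingType).
Variables (D0 : gdata F n A0) (D1 : gdata F n.+1 A1) (D2 : gdata F n.+2 A2).
Variables (io : {rmorphism A0 -> A1}) (iota : {rmorphism A1 -> A2}).
Hypotheses (W0 : tower D0 D1 io) (W : tower D1 D2 iota).
Local Notation lft := (lift ord_max).
Let HN := tw_N W.
Let HT := al_T HN.
Let HP := al_P HN.
Let HS := al_SX HN.
Local Notation tP j := (gP D2 (tau j)).
Local Notation s_ := (tP (lft ord_max)).

(** The last transposition moves none of the first [n] strands. *)
Lemma s_comm y : s_ * iota (io y) = iota (io y) * s_.
Proof.
elim/(tw_gn W0): y => [c|i|f|s|a b Ha Hb|a b Ha Hb].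
- by rewrite (tw_sc W0) (tw_sc W) (gscC HT).
- rewrite (tw_x W0) (tw_x W) (gPx_far HS) ?lift_max //.
    by rewrite (inj_eq lift_inj) lift_neq_max.
  exact: lift_neq_max.
- rewrite (tw_T W0) (gT_prod (al_T (tw_n W))) rmorph_prod; elim: (enum _) => [|l s IH].
    by rewrite !big_nil mulr1 mul1r.
  rewrite !big_cons mulrA.
  have -> : s_ * iota (gat D1 l (ten_widen f l)) = iota (gat D1 l (ten_widen f l)) * s_.
    case: (unliftP ord_max l) => [l' ->|->]; last first.
      by rewrite ten_widen_max (gat1 (al_T (tw_n W))) rmorph1 mulr1 mul1r.
    rewrite (iota_at W) (gP_at HT HP) /tau tpermD //.
      by rewrite (inj_eq lift_inj) neq_lift.
    exact: neq_lift.
  by rewrite -mulrA IH mulrA.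
- rewrite (tw_P W0) (tw_P W) (gP_tperm HP) !lift_perm_lift !lift_perm_id //.
- by rewrite !rmorphD mulrDr mulrDl Ha Hb.
- by rewrite !rmorphM mulrA Ha -mulrA Hb mulrA.
Qed.

Lemma tau_lift (j : 'I_n.+1) : tP (lft j) = iota (gP D1 (tau j)) * s_ * iota (gP D1 (tau j)).
Proof.
rewrite (tw_P W) lift_tperm_max {2}/tau (gP_tperm HP) tpermR tpermD ?lift_neq_max //.
by rewrite -mulrA (gPtt HP) mulr1.
Qed.

(** On the right of the last transposition, [A_n] is replaced by a spanning
    family over [A_(n-1)], which commutes with that transposition. This turns
    double coset elements into left multiples of [leftgen]. *)
Lemma perm_kspan (j : 'I_n.+1) y y' : kspan D2 iota (iota y * tP (lft j) * iota y').
Proof.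
rewrite tau_lift !mulrA -[_ * _ * iota y']mulrA -!rmorphM.
move: (y * _) (_ * y') => {}y {}y'.
elim: (lspan_all W0 y' (leftgen_leading W0)) => [l a u f||z w _ Hz _ Hw].
- rewrite rmorphM mulrA -[iota y * _ * _]mulrA s_comm mulrA -rmorphM -mulrA.
  suff -> : s_ * iota (leftgen D1 l a f) =
      iota (gP D1 (tau l)) * leftgen D2 (lft l) a f.
    by rewrite mulrA -rmorphM; apply: kspan_gen.
  rewrite /leftgen !rmorphM rmorphXn (tw_x W) (iota_at W) (tw_P W) !mulrA.
  congr (_ * _ * _); rewrite lift_tperm_max {2}/tau [RHS](gP_tperm HP) tpermL tpermD ?lift_neq_max //.
- by rewrite rmorph0 mulr0; apply: kspan0.
- by rewrite rmorphD mulrDr; apply: kspanD.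
Qed.

End Restriction.

(** * The affine and the cyclotomic inclusions *)

Section Towers.
Variables (k : comNzRingType) (F : frobeniusSuperalgebra k).

Lemma affine_tower n : tower (aff_data F n) (aff_data F n.+1) (@affine_incl k F n).
Proof.
split.
- exact: aff_afflaws.
- exact: aff_afflaws.
- exact: aff_generated.
- exact: aff_generated.
- move=> c; rewrite /= /affine_incl (quo_liftE (@affine_incl_subproof k F n)) /=.
  by rewrite free_inclA.
- by move=> i; apply: affine_incl_gen.
- by move=> f; apply: affine_incl_gen.
- by move=> s; apply: affine_incl_gen.
Qed.

Variables (theta : nat) (C : nat -> seq F).

Lemma cyc_tower n :
  tower (cyc_data theta C n) (cyc_data theta C n.+1) (@cyc_incl k F theta C n).
Proof.
split.
- exact: cyc_afflaws.
- exact: cyc_afflaws.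
- exact: cyc_generated.
- exact: cyc_generated.
- by move=> c; apply: cyc_incl_scal.
- by move=> i; apply: cyc_incl_gen.
- by move=> f; apply: cyc_incl_gen.
- by move=> s; apply: cyc_incl_gen.
Qed.

End Towers.

(** * Functionals with prescribed values *)

Section Solve.
Variables (k : comNzRingType) (F : frobeniusSuperalgebra k).
Local Notation bas := (@fbasis k F).
Variables (n : nat) (R : pzRingType) (DR : gdata F n R) (HR : afflaws DR).
Variable eta : {rmorphism affine F n -> R}.
Local Notation AD := (aff_data F n.+1).
Local Notation A0 := (aff_data F n).
Hypotheses (eta_sc : forall c, eta (gsc A0 c) = gsc DR c)
  (eta_x : forall i, eta (gx A0 i) = gx DR i)
  (eta_T : forall f, eta (gT A0 f) = gT DR f)
  (eta_P : forall s, eta (gP A0 s) = gP DR s).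
Local Notation iota := (@affine_incl k F n).
Local Notation lfil := (lfil A0 AD iota).
Let W := affine_tower F n.
Local Notation X := (gx AD ord_max).
Local Notation atm := (gat AD ord_max).
Local Notation lead j a f := (X ^+ a * atm f * gP AD (tau j)).

Lemma functional_iota phi y z : equivariant HR phi ->
  functional HR phi (iota y * z) = eta y * functional HR phi z.
Proof.
move=> Hphi; elim/(@aff_generated k F n): y z => [c|i|f|s|a b Ha Hb|a b Ha Hb] z.
- by rewrite (tw_sc W) eta_sc functional_sc.
- by rewrite (tw_x W) eta_x functional_x.
- by rewrite (tw_T W) eta_T functional_T.
- by rewrite (tw_P W) eta_P functional_P.
- by rewrite !rmorphD !mulrDl functionalD Ha Hb.
- by rewrite !rmorphM -!mulrA Ha Hb.
Qed.

Lemma functional0 phi : functional HR phi 0 = 0.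
Proof.
by apply: (@addrI _ (functional HR phi 0)); rewrite -functionalD !addr0.
Qed.

(** On the filtration step [a] a functional depends only on the prescribed
    values of exponent less than [a]. *)
Lemma functional_level phi phi' a m p z : equivariant HR phi -> equivariant HR phi' ->
  (forall s c f, (c < a)%N -> dval (phi s) c f = dval (phi' s) c f) ->
  lfil a m p z -> functional HR phi z = functional HR phi' z.
Proof.
move=> H H' E; elim=> {m p z} [c y f s m p my py mf pf lt _ _ _ _|m p|m p z w _ Hz _ Hw].
- rewrite -!mulrA !functional_iota //; congr (_ * _).
  by rewrite !mulrA !functional_top E.
- by rewrite !functional0.
- by rewrite !functionalD Hz Hw.
Qed.

Variables (e : 'I_n.+1 -> nat -> F -> affine F n.+1)
  (presc : 'I_n.+1 -> nat -> F -> R).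
Hypotheses (He : leading A0 AD iota e)
  (Hel : forall j a c f g, e j a (c *: f + g) = gsc AD c * e j a f + e j a g)
  (Hpl : forall j a c f g, presc j a (c *: f + g) = gsc DR c * presc j a f + presc j a g).

(** Triangular solution of the equations [T (e j a f) = presc j a f], by
    recursion on the exponent [a]: the contribution of smaller exponents is
    already fixed. *)
Fixpoint approx (m : nat) : 'I_n.+1 -> dvec DR :=
  if m is m'.+1 then fun j a b =>
    if a == m' then
      presc j a (bas b) -
      functional HR (extend HR (approx m')) (e j a (bas b) - lead j a (bas b))
    else approx m' j a b
  else fun _ _ _ => 0.

Definition solution : 'I_n.+1 -> dvec DR := fun j a b => approx a.+1 j a b.

Lemma approx_solution m j a b : (a < m)%N -> approx m j a b = solution j a b.
Proof.
elim: m => // m IH; rewrite ltnS leq_eqVlt => /orP[/eqP->//|lt] /=.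
by rewrite ltn_eqF // IH.
Qed.

Lemma functional_solution j a f :
  functional HR (extend HR solution) (e j a f) = presc j a f.
Proof.
set T := functional _ _.
have TZ c z : T (gsc AD c * z) = gsc DR c * T z by apply: functional_sc.
have TD z w : T (z + w) = T z + T w by apply: functionalD.
have lin (E : F -> R) (EL : forall c f g, E (c *: f + g) = gsc DR c * E f + E g) g :
    E g = \sum_b gsc DR (coord b g) * E (bas b).
  have E0 : E 0 = 0 by have := EL (-1) 0 0; rewrite scaler0 addr0 rmorphN1 mulN1r addNr.
  have ED h h' : E (h + h') = E h + E h' by rewrite -[h in LHS]scale1r EL rmorph1 mul1r.
  rewrite {1}(coordP g) (big_morph E ED E0); apply: eq_bigr => b _.
  by rewrite -[_ *: _]addr0 EL E0 addr0.
rewrite (lin (fun g => T (e j a g))); last by move=> c g h; rewrite Hel TD TZ.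
rewrite [RHS]lin; last exact: Hpl.
apply: eq_bigr => b _; congr (_ * _).
rewrite -[e j a (bas b)](subrK (lead j a (bas b))) TD.
have -> : T (lead j a (bas b)) = solution j a b.
  by rewrite /T functional_top extend_tau dval_bas.
have -> : T (e j a (bas b) - lead j a (bas b)) =
    functional HR (extend HR (approx a)) (e j a (bas b) - lead j a (bas b)).
  apply: (functional_level _ _ _ (He j a (fbasisH b))); try exact: extend_equiv.
  move=> s c g lt; apply: extend_level => j' b'; by rewrite approx_solution.
by rewrite /solution /= eqxx addrC subrK.
Qed.

(** The family [e] behaves as a basis over [A_n] as far as the existence of
    functionals is concerned. *)
Lemma solve : exists T : affine F n.+1 -> R,
  [/\ forall z w, T (z + w) = T z + T w,
      forall y z, T (iota y * z) = eta y * T z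
    & forall j a f, T (e j a f) = presc j a f].
Proof.
exists (functional HR (extend HR solution)); split.
- exact: functionalD.
- by move=> y z; apply: functional_iota; apply: extend_equiv.
- exact: functional_solution.
Qed.

End Solve.

(** * The polynomial generators in terms of the first one *)

Section FixedIndex.
Variables (k : comNzRingType) (F : frobeniusSuperalgebra k).
Variables (n : nat) (A : pzRingType) (D : gdata F n.+1 A) (HD : afflaws D).
Let HT := al_T HD.
Let HP := al_P HD.
Let HS := al_SX HD.
Local Notation P := (gP D).
Local Notation X_ := (gx D).
Local Notation tel := (gtel D).

(** Adjacent transpositions of the indices other than the first one generate
    the stabilizer. *)
Lemma P_fix0_x (s : {perm 'I_n.+1}) : s ord0 = ord0 -> P s * X_ ord0 = X_ ord0 * P s.
Proof.
move=> /unlift_perm_ex[h <-]; elim/perm_adj_ind: h => [|i i' h ii IH].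
  by rewrite lift_perm1 (gP1 HP) mul1r mulr1.
rewrite -(lift_permM _ ord0) -(gPM HP) -mulrA.
have -> : lift_perm ord0 ord0 (tperm i i') = tperm (lift ord0 i) (lift ord0 i').
  apply/permP => l; case: (unliftP ord0 l) => [m ->|->].
    by rewrite lift_perm_lift (inj_tperm _ _ _ (@lift_inj _ _)).
  by rewrite lift_perm_id tpermD // eq_sym neq_lift.
rewrite (gPx_far HS) ?neq_lift //; last by rewrite !lift0 ii.
by rewrite mulrA IH mulrA.
Qed.

(** Induction on [j], conjugating by an adjacent transposition, which adds one
    teleporter. *)
Lemma x_jucys_murphy (j : 'I_n.+1) :
  X_ j = P (tperm ord0 j) * X_ ord0 * P (tperm ord0 j)
         + \sum_(l < n.+1 | (l < j)%N) tel l j * P (tperm l j).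
Proof.
case: j => m lt; elim: m lt => [|m IH] lt.
  have -> : Ordinal lt = ord0 by apply: val_inj.
  by rewrite tperm1 (gP1 HP) mul1r mulr1 big_pred0 ?addr0.
have lt' : (m < n.+1)%N by apply: ltnW.
set j' := Ordinal lt; set j := Ordinal lt'.
have jj : j' = j.+1 :> nat by [].
have -> : X_ j' = P (tperm j j') * X_ j * P (tperm j j') + tel j j' * P (tperm j j').
  by rewrite (gPx HS) // mulrBl subrK -mulrA (gPtt HP) mulr1.
set S := P (tperm j j'); have SS : S * S = 1 by apply: (gPtt HP).
have jN : j != j' by rewrite -val_eqE /= neq_ltn ltnSn.
have E0 : S * (P (tperm ord0 j) * X_ ord0 * P (tperm ord0 j)) * S =
    P (tperm ord0 j') * X_ ord0 * P (tperm ord0 j').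
  have [->|j0] := eqVneq ord0 j.
    by rewrite tperm1 (gP1 HP) mul1r mulr1.
  have j0' : j != ord0 by rewrite eq_sym.
  have j'0 : j' != ord0 by [].
  have E1 : S * P (tperm ord0 j) = P (tperm ord0 j') * S.
    by rewrite [LHS](gP_tperm HP) tpermL tpermD.
  have E2 : P (tperm ord0 j) * S = S * P (tperm ord0 j').
    by rewrite [RHS](gP_tperm HP) tpermR tpermD.
  have E3 : S * X_ ord0 = X_ ord0 * S by apply: P_fix0_x; rewrite tpermD.
  rewrite !mulrA E1 -!mulrA E2 !mulrA -[_ * S * X_ ord0]mulrA E3 -!mulrA.
  by rewrite (mulrA S S) SS mul1r.
rewrite [X_ j]IH -/j mulrDr mulrDl E0 -addrA; congr (_ + _).
rewrite [RHS](bigD1 j) ?jj //= [RHS]addrC; congr (_ + _).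
rewrite mulr_sumr mulr_suml; apply: eq_big => [l|l lj].
  by rewrite ltnS [RHS]andbC ltn_neqAle.
have nl : l != j by rewrite -val_eqE /= ltn_eqF.
have nl' : l != j' by rewrite -val_eqE /= ltn_eqF // ltnW.
have E4 : S * P (tperm l j) = P (tperm l j') * S.
  by rewrite [LHS](gP_tperm HP) tpermL tpermD // eq_sym.
rewrite !mulrA (gP_tel HT HP) tpermL tpermD 1?eq_sym // -!mulrA (mulrA S) E4.
by rewrite -mulrA SS mulr1.
Qed.

End FixedIndex.

(** * The trace on the affine algebra *)

Section AffineTrace.
Variables (k : comNzRingType) (F : frobeniusSuperalgebra k).
Local Notation homog := (@Defs.comp k F).
Local Notation psi := (nakayama F).
Variables (theta : nat) (C : nat -> seq F).
Hypothesis HC : cyclotomic_datum theta C.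
Local Notation d := (level theta C).
Hypothesis d_gt0 : (0 < d)%N.
Variables (n : nat) (An A R : pzRingType).
Variables (A0 : gdata F n An) (AD : gdata F n.+1 A) (DR : gdata F n R).
Variables (iota : {rmorphism An -> A}) (eta : {rmorphism An -> R}).
Hypotheses (W : tower A0 AD iota) (HR : afflaws DR).
Hypothesis eta_sc : forall c, eta (gsc A0 c) = gsc DR c.
Local Notation lft := (lift ord_max).
Local Notation lftp := (lift_perm ord_max ord_max).
Let H0 := tw_n W.
Let HN := tw_N W.
Let HT := al_T HN.
Let HA := xlaws_at (al_X HN).
Let HP := al_P HN.
Local Notation sc := (gsc AD).
Local Notation P := (gP AD).
Local Notation X_ := (gx AD).
Local Notation X := (gx AD ord_max).
Local Notation at_ := (gat AD).
Local Notation atm := (gat AD ord_max).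
Local Notation tel := (gtel AD).
Local Notation tP j := (gP AD (tau j)).
Local Notation tP0 := (gP AD (tau ord0)).
Local Notation chi := (gchi AD theta C ord0).
Local Notation bifil := (bifil A0 AD iota).
Implicit Types (y : An) (z w u v : A).

Hypothesis Hk : forall (j : 'I_n) y y', kspan AD iota (iota y * tP (lft j) * iota y').

(** The values of the trace on [cgen]. *)
Definition trace_value (j : 'I_n.+1) a f : R :=
  if (j == ord_max) && (a == d.-1) then gsc DR (ftr F f) else 0.

Lemma trace_value_linear j a (c : k) f g :
  trace_value j a (c *: f + g) = gsc DR c * trace_value j a f + trace_value j a g.
Proof.
rewrite /trace_value; case: ifP => _; last by rewrite mulr0 addr0.
by rewrite linearP [LHS]rmorphD [X in X + _]rmorphM.
Qed.

Lemma trace_valueC j a f (r : R) : trace_value j a f * r = r * trace_value j a f.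
Proof.
rewrite /trace_value; case: ifP => _; last by rewrite mul0r mulr0.
by rewrite (gscC (al_T HR)).
Qed.

Lemma trace_value_odd j a (m : nat) f : homog m true f -> trace_value j a f = 0.
Proof.
by move=> Hf; rewrite /trace_value (ftr_even Hf) rmorph0 if_same.
Qed.

Variable T : A -> R.
Hypotheses (TD : forall z w, T (z + w) = T z + T w)
  (Tl : forall y z, T (iota y * z) = eta y * T z)
  (Te : forall j a f, T (cgen AD theta C j a f) = trace_value j a f).

Lemma atrace0 : T 0 = 0.
Proof. by apply: (@addrI _ (T 0)); rewrite -TD !addr0. Qed.

Lemma atraceN z : T (- z) = - T z.
Proof. by apply: (@addrI _ (T z)); rewrite -TD !subrr atrace0. Qed.

Lemma atrace_sc c z : T (sc c * z) = gsc DR c * T z.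
Proof. by rewrite -(tw_sc W) Tl eta_sc. Qed.

(** For [a < d] the element is a member of [cgen]. *)
Lemma atrace_poly a f : (a < d)%N -> T (X ^+ a * atm f) = trace_value ord_max a f.
Proof.
move=> ad; rewrite -Te /cgen eqxx leqNgt ad /= /leftgen.
by rewrite (tP_max W) mul1r.
Qed.

Lemma atrace_zgen a f : T (zgen AD theta C a f) = 0.
Proof.
have := Te ord_max (d + a) f; rewrite /cgen eqxx leq_addr addKn => ->.
rewrite /trace_value eqxx /=; case: eqP => // E.
by have := leq_addr a d; rewrite E -ltnS prednK // ltnn.
Qed.

Lemma atrace_left (j : 'I_n) a f : T (leftgen AD (lft j) a f) = 0.
Proof.
have := Te (lft j) a f; rewrite /cgen /trace_value.
by rewrite (negPf (lift_neq_max j)).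
Qed.

(** The double coset elements are left combinations of members of [cgen] with
    value zero. *)
Lemma atrace_perm (j : 'I_n) y y' : T (iota y * tP (lft j) * iota y') = 0.
Proof.
elim: (Hk j y y') => [l a y0 f||z w _ Hz _ Hw].
- by rewrite Tl atrace_left mulr0.
- exact: atrace0.
- by rewrite TD Hz Hw addr0.
Qed.

(** [iota y] moves to the left with a sign if [y] and [f] are odd; but then
    [tr f = 0]. *)
Lemma atrace_polyr a f y : (a < d)%N -> T (X ^+ a * atm f * iota y) = T (X ^+ a * atm f) * eta y.
Proof.
move=> ad; rewrite atrace_poly //.
elim: (hsum_all (tw_n W) (tw_gn W) y) => {y} [|m p y y1 Hy _ IH].
  by rewrite !rmorph0 !mulr0 atrace0.
rewrite !rmorphD !mulrDr TD IH; congr (_ + _).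
elim/homog_ind: f {IH} => [|m' q f g Hf IH].
  by rewrite (gat0 HT) mulr0 mul0r atrace0 /trace_value linear0 rmorph0 if_same mul0r.
rewrite (gatD HT) mulrDr mulrDl TD IH.
rewrite -[f in RHS]scale1r trace_value_linear rmorph1 mul1r mulrDl; congr (_ + _).
rewrite -mulrA (atm_iota W Hy Hf) (scCA HT) [X ^+ a * _]mulrA (Xn_iota W) -[iota y * _ * _]mulrA atrace_sc Tl atrace_poly //.
case: q Hf => Hf; last by rewrite andbF rmorph1 mul1r trace_valueC.
by rewrite (trace_value_odd _ _ Hf) !mulr0 mul0r.
Qed.

Lemma atrace_bifil m z : (m < d)%N -> bifil m z -> T z = 0.
Proof.
move=> md; elim=> {z} [a f y mf pf my py lt Hf Hy|j y y' my py my' py' Hy Hy'||z w _ Hz _ Hw].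
- have ad := ltn_trans lt md; rewrite atrace_polyr // atrace_poly // /trace_value.
  rewrite eqxx /=; case: eqP => [E|_]; last by rewrite mul0r.
  by move: lt; rewrite E -ltnS prednK // => /leq_trans/(_ md); rewrite ltnn.
- exact: atrace_perm.
- exact: atrace0.
- by rewrite TD Hz Hw addr0.
Qed.

Lemma P_fix0_chi (s : {perm 'I_n.+1}) : s ord0 = ord0 -> P s * chi = chi * P s.
Proof.
move=> s0; apply: (gchi_comm HC).
  exact: P_fix0_x.
by move=> m c _; rewrite /GRing.comm (gP_at HT HP) s0.
Qed.

Lemma P_fix0_Xn (s : {perm 'I_n.+1}) a : s ord0 = ord0 ->
  P s * X_ ord0 ^+ a = X_ ord0 ^+ a * P s.
Proof. by move=> s0; apply: commrX; apply: P_fix0_x. Qed.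

Lemma x_chi (i : 'I_n.+1) : i != ord0 -> X_ i * chi = chi * X_ i.
Proof.
move=> i0; apply: (gchi_comm HC); first exact: gxC (al_X HN) _ _.
by move=> m c _; rewrite /GRing.comm (gat_x_far HA) // eq_sym.
Qed.

Lemma at_chi_far (i : 'I_n.+1) f : i != ord0 -> at_ i f * chi = chi * at_ i f.
Proof.
move=> i0; apply: (gchi_comm HC); first by rewrite /GRing.comm (gat_x_far HA).
by move=> m c Hc; rewrite /GRing.comm (gat_comm_even HT _ _ Hc) // eq_sym.
Qed.

(** The part of [zgen] between the two transpositions. If [n > 0] it comes
    from [A_n]. *)
Definition core a f : A := chi * X_ ord0 ^+ a * at_ ord0 f.

Lemma zgenE a f : zgen AD theta C a f = tP0 * core a f * tP0. Proof. by []. Qed.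

Lemma core_P (s : {perm 'I_n.+1}) a f : s ord0 = ord0 -> P s * core a f = core a f * P s.
Proof.
move=> s0; rewrite /core !mulrA P_fix0_chi // -!mulrA; congr (_ * _).
by rewrite mulrA P_fix0_Xn // -mulrA (gP_at HT HP) s0.
Qed.

Lemma core_x (i : 'I_n.+1) a f : i != ord0 -> X_ i * core a f = core a f * X_ i.
Proof.
move=> i0; rewrite /core !mulrA x_chi // -!mulrA; congr (_ * _).
rewrite (gat_x_far HA) 1?eq_sym // !mulrA; congr (_ * _).
by apply: commrX; apply: gxC (al_X HN) _ _.
Qed.

Lemma core_at (i : 'I_n.+1) a (m : nat) p f (m' : nat) q g : i != ord0 ->
  homog m p f -> homog m' q g ->
  at_ i g * core a f = sc ((-1) ^+ (q && p)) * (core a f * at_ i g).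
Proof.
move=> i0 Hf Hg; rewrite /core !mulrA at_chi_far // -[chi * _ * _]mulrA.
rewrite (at_Xn_far W) // -!mulrA (gat_comm HT i0 Hg Hf).
by rewrite !(scCA HT).
Qed.

Lemma core_tel (i j : 'I_n.+1) a f : i != ord0 -> j != ord0 ->
  tel i j * core a f = core a f * tel i j.
Proof.
move=> i0 j0; elim/homog_ind: f => [|m p f g Hf IH].
  by rewrite /core (gat0 HT) !mulr0 mul0r.
have -> : core a (f + g) = core a f + core a g by rewrite /core (gatD HT) mulrDr.
rewrite mulrDr mulrDl IH; congr (_ + _).
rewrite /gtel mulr_sumr mulr_suml; apply: eq_bigr => b _.
rewrite -mulrA (core_at _ j0 Hf (fdualH b)) (scCA HT).
rewrite [at_ i (fbasis b) * (core a f * _)]mulrA (core_at _ i0 Hf (fbasisH b)).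
by rewrite -!mulrA [LHS]mulrA sc_signK mul1r.
Qed.

(** The other polynomial generators arise from the first one by conjugation
    with adjacent transpositions, up to teleporters. *)
Lemma generated_x1 (Q : An -> Prop) :
  (forall c, Q (gsc A0 c)) -> (forall i : 'I_n, i = 0%N :> nat -> Q (gx A0 i)) ->
  (forall i (m : nat) p f, homog m p f -> Q (gat A0 i f)) -> (forall s, Q (gP A0 s)) ->
  (forall a b, Q a -> Q b -> Q (a + b)) ->
  (forall a b, Q a -> Q b -> Q (a * b)) -> forall a, Q a.
Proof.
move=> Qs Qx Qat QP QD QM.
have HT0 := al_T H0.
have Q1 : Q 1 by rewrite -(rmorph1 (gsc A0)).
have Q0 : Q 0 by rewrite -(rmorph0 (gsc A0)).
have Qat' i f : Q (gat A0 i f).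
  elim/homog_ind: f => [|m p f g Hf IH]; first by rewrite (gat0 HT0).
  by rewrite (gatD HT0); apply: QD IH; apply: (Qat) Hf.
have QT f : Q (gT A0 f).
  rewrite (gT_prod HT0); elim: (enum _) => [|l s IH]; first by rewrite big_nil.
  by rewrite big_cons; apply: (QM).
have Qtel (i j : 'I_n) : Q (gtel A0 i j).
  by rewrite /gtel; elim/big_rec: _ => // b z _ Hz; apply: (QD) => //; apply: (QM); apply: Qat'.
have Qx' i : Q (gx A0 i).
  case: i => m lt; elim: m lt => [|m IH] lt; first exact: (Qx).
  have lt' : (m < n)%N by apply: ltnW.
  set j' := Ordinal lt; set j := Ordinal lt'.
  have -> : gx A0 j' = gP A0 (tperm j j') * gx A0 j * gP A0 (tperm j j')
      + gtel A0 j j' * gP A0 (tperm j j').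
    by rewrite (gPx (al_SX H0)) // mulrBl subrK -mulrA (gPtt (al_P H0)) mulr1.
  apply: (QD); last by apply: (QM); [apply: Qtel|apply: (QP)].
  apply: (QM); last exact: (QP).
  by apply: (QM); [exact: (QP)|exact: IH].
exact: (tw_gn W).
Qed.

Lemma gchi_iota (i : 'I_n) : iota (gchi A0 theta C i) = gchi AD theta C (lft i).
Proof.
rewrite /gchi rmorph_prod; apply: eq_bigr => j _; rewrite rmorph_prod.
by apply: eq_bigr => c _; rewrite rmorphB rmorphXn (tw_x W) (iota_at W).
Qed.

Lemma core_iota a f : (0 < n)%N -> exists y, core a f = iota y.
Proof.
move=> n0; have E0 : ord0 = lft (Ordinal n0) by apply: val_inj; rewrite /= /bump leqNgt n0.
exists (gchi A0 theta C (Ordinal n0) * gx A0 (Ordinal n0) ^+ a * gat A0 (Ordinal n0) f).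
rewrite !rmorphM rmorphXn /= (tw_x W) (iota_at W) -E0 /core; congr (_ * _ * _).
by rewrite gchi_iota -E0.
Qed.

Lemma tau0_P s : tP0 * P (lftp s) = P (tau ord0 * lftp s * tau ord0)%g * tP0.
Proof. by rewrite !(gPM HP) !mulgA /tau tperm2 mul1g. Qed.

(** Conjugation by the transposition [tau_1] of the first and last index turns
    a permutation that fixes the last index into one that fixes the first
    index, which commutes with [core]. *)
Lemma zgen_P a f s : zgen AD theta C a f * P (lftp s) = P (lftp s) * zgen AD theta C a f.
Proof.
have fix0 : (tau ord0 * lftp s * tau ord0)%g ord0 = ord0.
  by rewrite !permM (tau_j ord0) lift_perm_id (tau_max ord0).
have EP := core_P a f fix0; rewrite !zgenE; move: (core a f) EP => Q EP.
rewrite -[LHS]mulrA tau0_P mulrA -[tP0 * Q * _]mulrA -EP !mulrA; congr (_ * _ * _).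
by rewrite !(gPM HP) -!mulgA /tau tperm2 mulg1.
Qed.

Lemma zgen_at a (m : nat) p f (i : 'I_n) (m' : nat) q g : homog m p f -> homog m' q g ->
  zgen AD theta C a f * at_ (lft i) g =
  sc ((-1) ^+ (q && p)) * (at_ (lft i) g * zgen AD theta C a f).
Proof.
move=> Hf Hg; set i' := tau ord0 (lft i).
have i'0 : i' != ord0.
  rewrite -(inj_eq (@perm_inj _ (tau ord0))) /i' /tau tpermK tpermL.
  exact: lift_neq_max.
have EQ : core a f * at_ i' g = sc ((-1) ^+ (q && p)) * (at_ i' g * core a f).
  by rewrite (core_at _ i'0 Hf Hg) mulrA sc_signK mul1r.
rewrite !zgenE; move: (core a f) EQ => Q EQ.
rewrite -[LHS]mulrA (gP_at HT HP) -/i' mulrA -[tP0 * Q * _]mulrA EQ (scCA HT).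
rewrite -[LHS]mulrA; congr (_ * _); rewrite !mulrA (gP_at HT HP).
by rewrite /i' /tau tpermK.
Qed.

(** The heart of right linearity. Moving [x_1] from the right of [zgen] to the
    left creates two terms, one with a teleporter on each side. Both are of
    the second kind up to multiplication by [F_(n+1)], so that the trace kills
    them. *)
Lemma atrace_zgen_x a f (i : 'I_n) : i = 0%N :> nat -> T (zgen AD theta C a f * X_ (lft i)) = 0.
Proof.
move=> i0; have n0 : (0 < n)%N by apply: leq_ltn_trans (ltn_ord i).
have E0 : lft i = ord0 by apply: val_inj; rewrite /= /bump i0 leqNgt n0.
have max0 : ord_max != ord0 :> 'I_n.+1 by rewrite -E0 neq_lift.
have HQP (s : {perm 'I_n.+1}) : s ord0 = ord0 -> P s * core a f = core a f * P s by apply: core_P.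
have HQX : X * core a f = core a f * X by apply: core_x.
have HQt (l : 'I_n.+1) : l != ord0 -> tel l ord_max * core a f = core a f * tel l ord_max.
  by move=> l0; apply: core_tel.
have [yQ EQ] := core_iota a f n0.
have := atrace_zgen a f; rewrite zgenE.
move: (core a f) HQP HQX HQt EQ => Q HQP HQX HQt EQ TQ.
pose Y : A := \sum_(l < n.+1 | (l < @ord_max n)%N && (l != ord0))
  tel l ord_max * P (tperm l ord_max).
have XE : X = tP0 * X_ ord0 * tP0 + tel ord0 ord_max * tP0 + Y.
  by rewrite {1}(x_jucys_murphy HN ord_max) (bigD1 ord0) //= addrA.
have YQ : Y * Q = Q * Y.
  rewrite /Y mulr_sumr mulr_suml; apply: eq_bigr => l /andP[_ l0].
  rewrite -mulrA HQP; last by rewrite tpermD.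
  by rewrite mulrA HQt // -mulrA.
have EX1 : tP0 * X_ ord0 = X * tP0 - tel ord0 ord_max - Y * tP0.
  rewrite {1}XE !mulrDl -!mulrA (tPtP W) !mulr1.
  by rewrite [RHS]addrAC addrK addrK.
have EX2 : tP0 * X = X_ ord0 * tP0 + tP0 * tel ord0 ord_max * tP0 + tP0 * Y.
  by rewrite XE !mulrDr !mulrA (tPtP W) mul1r.
have Ez : tP0 * Q * tP0 * X_ ord0 = X_ ord0 * (tP0 * Q * tP0)
    + tel ord_max ord0 * Q * tP0 - tP0 * Q * tel ord0 ord_max.
  rewrite -[LHS]mulrA EX1 !mulrBr.
  have -> : tP0 * Q * (X * tP0) = X_ ord0 * (tP0 * Q * tP0)
      + tP0 * tel ord0 ord_max * tP0 * Q * tP0 + tP0 * Y * Q * tP0.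
    by rewrite !mulrA -[tP0 * Q * X]mulrA -HQX mulrA EX2 !mulrDl.
  have -> : tP0 * tel ord0 ord_max * tP0 * Q * tP0 = tel ord_max ord0 * Q * tP0.
    rewrite (gP_tel HT HP) (tau_j ord0) (tau_max ord0) -[_ * tP0 * tP0]mulrA (tPtP W).
    by rewrite mulr1.
  have -> : tP0 * Q * (Y * tP0) = tP0 * Y * Q * tP0.
    by rewrite -!mulrA (mulrA Q) -YQ -!mulrA.
  by rewrite addrAC addrK.
rewrite E0 Ez TD atraceN TD.
have -> : T (X_ ord0 * (tP0 * Q * tP0)) = 0.
  by rewrite -{1}E0 -(tw_x W) Tl TQ mulr0.
have -> : T (tel ord_max ord0 * Q * tP0) = 0.
  apply: (atrace_bifil d_gt0); rewrite /gtel -mulrA mulr_suml; apply: bifil_sum => b _.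
  rewrite -mulrA; apply: (bifil_atl W (fbasisH b)).
  by rewrite -E0 -(iota_at W) EQ; do 2!apply: (bifil_iotal W); apply: bifil_tau.
have -> : T (tP0 * Q * tel ord0 ord_max) = 0; last by rewrite addr0 subrr.
apply: (atrace_bifil d_gt0); rewrite /gtel mulr_sumr; apply: bifil_sum => b _.
rewrite mulrA; apply: (bifil_atr W (fdualH b)).
by rewrite -E0 -(iota_at W) EQ; do 2!apply: (bifil_iotar W); apply: bifil_tau.
Qed.

Lemma zgenD a f g : zgen AD theta C a (f + g) = zgen AD theta C a f + zgen AD theta C a g.
Proof. by rewrite /zgen (gatD HT) mulrDr mulrDr mulrDl. Qed.

Lemma zgen0 a : zgen AD theta C a 0 = 0.
Proof. by rewrite /zgen (gat0 HT) !mulr0 mul0r. Qed.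

(** By left linearity it suffices to consider the members of [cgen], of which
    only [zgen] is not covered by the preceding lemmas. *)
Lemma atrace_rgen y : (forall a f, T (zgen AD theta C a f * iota y) = 0) ->
  forall z, T (z * iota y) = T z * eta y.
Proof.
move=> Hz z; elim: (lspan_all W z (cgen_leading W HC)) => {z} [j a y0 f||z w _ IHz _ IHw].
- rewrite -mulrA !Tl -mulrA; congr (_ * _).
  rewrite /cgen; case: (unliftP ord_max j) => [j' ->|->].
    rewrite (negPf (lift_neq_max j')) /= atrace_left mul0r.
    rewrite /leftgen -(tw_x W) -(iota_at W) -rmorphXn -!mulrA -!rmorphM.
    by have := atrace_perm j' 1 ((gx A0 j' ^+ a) * (gat A0 j' f * y)); rewrite rmorph1 mul1r.
  rewrite eqxx /=; case: leqP => [da|ad]; first by rewrite Hz atrace_zgen mul0r.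
  by rewrite /leftgen (tP_max W) mul1r atrace_polyr.
- by rewrite mul0r atrace0 mul0r.
- by rewrite mulrDl !TD mulrDl IHz IHw.
Qed.

Lemma atrace_right z y : T (z * iota y) = T z * eta y.
Proof.
elim/generated_x1: y z => [c|i i0|i m p g Hg|s|y y' Hy Hy'|y y' Hy Hy'].
- apply: atrace_rgen => a f.
  by rewrite (tw_sc W) -(gscC HT) atrace_sc atrace_zgen mulr0.
- by apply: atrace_rgen => a f; rewrite (tw_x W) atrace_zgen_x.
- apply: atrace_rgen => a; elim/homog_ind => [|m' q f f' Hf IH].
    by rewrite zgen0 mul0r atrace0.
  rewrite zgenD mulrDl TD IH addr0 (iota_at W) (zgen_at _ _ Hf Hg) atrace_sc.
  by rewrite -(iota_at W) Tl atrace_zgen !mulr0.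
- by apply: atrace_rgen => a f; rewrite (tw_P W) zgen_P -(tw_P W) Tl atrace_zgen mulr0.
- by move=> z; rewrite !rmorphD !mulrDr TD Hy Hy'.
- by move=> z; rewrite !rmorphM !mulrA Hy' Hy.
Qed.

Hypothesis eta_chi : forall i : 'I_n, i = 0%N :> nat -> eta (gchi A0 theta C i) = 0.

Lemma chi_iota : (0 < n)%N -> exists2 y, chi = iota y & eta y = 0.
Proof.
move=> n0; exists (gchi A0 theta C (Ordinal n0)); last exact: eta_chi.
rewrite gchi_iota; congr (gchi _ _ _ _); apply: val_inj.
by rewrite /= /bump leqNgt n0.
Qed.

Lemma tau_fix0 (j : 'I_n.+1) : j != ord0 -> (0 < n)%N /\ tau j ord0 = ord0.
Proof.
move=> j0; have n0 : (0 < n)%N.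
  by rewrite lt0n; apply: contra j0 => /eqP n0; rewrite -val_eqE /= -leqn0 -n0 -ltnS.
by split=> //; rewrite /tau tpermD // -val_eqE /= -lt0n.
Qed.

(** Expanding [v] in the right and [u] in the left spanning family, [chi]
    commutes to one side and dies in [R], unless the first index is involved
    on both sides; then the product is a [zgen]. *)
Lemma atrace_ideal u v : T (u * chi * v) = 0.
Proof.
elim: (rspan_all W v) => {v} [j a f y||v w _ Hv _ Hw]; last first.
- by rewrite mulrDr TD Hv Hw addr0.
- by rewrite mulr0 atrace0.
rewrite mulrA atrace_right; have [->|j0] := eqVneq j ord0; last first.
  have [n0 t0] := tau_fix0 j0; have [y0 E y00] := chi_iota n0.
  have -> : u * chi * rightgen AD j a f = u * rightgen AD j a f * chi.
    rewrite -!mulrA; congr (_ * _); rewrite /rightgen -!mulrA P_fix0_chi //.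
    rewrite (mulrA (at_ j f)) at_chi_far // !mulrA; congr (_ * _ * _).
    by apply: commrX; apply: commr_sym; apply: x_chi.
  by rewrite E atrace_right y00 mulr0 mul0r.
suff -> : T (u * chi * rightgen AD ord0 a f) = 0 by rewrite mul0r.
elim: (lspan_all W u (leftgen_leading W)) => {u} [l b y0 g||u w _ Hu _ Hw]; last first.
- by rewrite !mulrDl TD Hu Hw addr0.
- by rewrite !mul0r atrace0.
rewrite (_ : _ * rightgen _ _ _ _ =
  iota y0 * (leftgen AD l b g * (chi * rightgen AD ord0 a f))); last by rewrite !mulrA.
rewrite Tl; have [->|l0] := eqVneq l ord0.
  have -> : leftgen AD ord0 b g * (chi * rightgen AD ord0 a f) =
      zgen AD theta C (b + a) (iter a psi (iter d psi g) * f).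
    rewrite /leftgen /rightgen /zgen exprD -(gatM HT) !mulrA; congr (_ * _ * _).
    rewrite -!mulrA; congr (_ * _).
    rewrite (mulrA (at_ ord0 g)) (at_gchi HN HC) !mulrA -[_ * at_ _ _ * _]mulrA.
    rewrite (at_Xn W) !mulrA; congr (_ * _ * _).
    by apply/esym/commrX/commr_sym; apply: gchi_X HC _.
  by rewrite atrace_zgen mulr0.
have [n0 t0] := tau_fix0 l0; have [y1 E y10] := chi_iota n0.
rewrite mulrA.
have -> : leftgen AD l b g * chi = chi * leftgen AD l b g.
  rewrite /leftgen -!mulrA at_chi_far // !mulrA -P_fix0_chi // -!mulrA; congr (_ * _).
  rewrite !mulrA; congr (_ * _).
  by apply/esym/commrX/commr_sym; apply: x_chi.
by rewrite -mulrA E Tl y10 mul0r mulr0.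
Qed.

End AffineTrace.

(** * Dual bases over a cyclotomic quotient *)

Section CyclotomicReduction.
Variables (k : comNzRingType) (F : frobeniusSuperalgebra k).
Local Notation homog := (@Defs.comp k F).
Local Notation psi := (nakayama F).
Local Notation tr := (ftr F).
Local Notation bas := (@fbasis k F).
Local Notation dual := (@fdual k F).
Local Notation delta := (maxdeg F).
Variables (theta : nat) (C : nat -> seq F).
Hypothesis HC : cyclotomic_datum theta C.
Local Notation d := (level theta C).
Hypothesis d_gt0 : (0 < d)%N.
Variables (n : nat) (An AN : pzRingType).
Variables (Dn : gdata F n An) (DN : gdata F n.+1 AN).
Variable (iota : {rmorphism An -> AN}).
Hypothesis W : tower Dn DN iota.
Local Notation lft := (lift ord_max).
Let HN := tw_N W.
Let HT := al_T HN.
Let HP := al_P HN.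
Local Notation P := (gP DN).
Local Notation X_ := (gx DN).
Local Notation X := (gx DN ord_max).
Local Notation at_ := (gat DN).
Local Notation atm := (gat DN ord_max).
Local Notation tP j := (gP DN (tau j)).
Local Notation tP0 := (gP DN (tau ord0)).
Local Notation chi := (gchi DN theta C ord0).
Local Notation bifil := (bifil Dn DN iota).
Local Notation lfil := (lfil Dn DN iota).
Local Notation rfil := (rfil DN iota).
Implicit Types (y : An) (z w u v : AN).

(** The leading term of [zgen] for the filtration with [A_n] on the right. *)
Lemma rzgen_lead a (m : nat) p f : homog m p f ->
  rfil (d + a) (zgen DN theta C a f - X ^+ (d + a) * atm f).
Proof.
move=> Hf.
have -> : zgen DN theta C a f - X ^+ (d + a) * atm f =
    tP0 * (rightgen DN ord0 (d + a) f - tP0 * (X ^+ (d + a) * atm f))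
    + tP0 * ((chi - X_ ord0 ^+ d) * X_ ord0 ^+ a * at_ ord0 f * tP0).
  rewrite mulrBr mulrA (tPtP W) mul1r addrAC -mulrDr; congr (_ - _).
  rewrite /zgen -mulrA; congr (_ * _).
  by rewrite /rightgen exprD -!mulrDl addrC subrK.
apply: rfilD; first by apply: (rfil_P W); apply: (rightgen_lead W) Hf.
apply: (rfil_P W).
elim: (gchi_low HN HC ord0) => [c g lt Hg||z w _ Hz _ Hw].
- have -> : X_ ord0 ^+ c * at_ ord0 g * X_ ord0 ^+ a * at_ ord0 f * tP0 =
      rightgen DN ord0 (c + a) (iter a psi g * f).
    rewrite /rightgen -!mulrA; rewrite (mulrA (at_ _ g)) (at_Xn W).
    by rewrite -(gatM HT) exprD !mulrA.
  have Hh := compM (iter_psi_homog a Hg) Hf.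
  have lt' : (c + a < d + a)%N by rewrite ltn_add2r.
  apply: (rfil_le lt').
  rewrite -[rightgen _ _ _ _](subrK (tP0 * (X ^+ (c + a) * atm (iter a psi g * f)))).
  apply: rfilD; first by apply: rfil_le (rightgen_lead W _ _ Hh); apply: leqnSn.
  by apply: (rfil_P W); apply: (rfil_top W) Hh.
- by rewrite !mul0r; apply: rfil0.
- by rewrite !mulrDl; apply: rfilD.
Qed.

Hypothesis chi0 : chi = 0.

Lemma zgen_eq0 a f : zgen DN theta C a f = 0.
Proof. by rewrite /zgen chi0 !mul0r mulr0 mul0r. Qed.

(** In the quotient [zgen] vanishes, so its leading term is a combination of
    smaller exponents. *)
Lemma lfil_reduce a m p z : lfil a m p z -> lfil d m p z.
Proof.
elim/ltn_ind: a m p z => a IH m p z; elim=> {m p z}.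
- move=> a1 y f s m p my py mf pf lt Hy Hf -> ->.
  case: (ltnP a1 d) => da; first exact: lfil_gen da Hy Hf erefl erefl.
  apply: IH lt _ _ _ _; apply: (lfil_P W).
  rewrite -!mulrA; apply: (lfil_iota Hy).
  have := zgen_lead W HC (a1 - d) Hf; rewrite zgen_eq0 sub0r subnKC // => H.
  by rewrite -[_ * _]opprK; apply: (lfilN W).
- by move=> m p; apply: lfil0.
- by move=> m p z w _ Hz _ Hw; apply: lfilD.
Qed.

Lemma rfil_reduce a z : rfil a z -> rfil d z.
Proof.
elim/ltn_ind: a z => a IH z; elim=> {z} [a1 s f y m p lt Hf||z w _ Hz _ Hw].
- case: (ltnP a1 d) => da; first exact: rfil_gen da Hf.
  apply: IH lt _ _; apply: rfil_iota.
  rewrite -!mulrA; apply: (rfil_P W).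
  have := rzgen_lead (a1 - d) Hf; rewrite zgen_eq0 sub0r subnKC // => H.
  by rewrite -[_ * _]opprK; apply: rfilN.
- exact: rfil0.
- exact: rfilD.
Qed.

Lemma lfil_d m p z : gcomp DN m p z -> lfil d m p z.
Proof. by move=> Hz; have [a /lfil_reduce] := lfil_gcomp W Hz. Qed.

Lemma rfil_d z : rfil d z.
Proof. by have [a /rfil_reduce] := rfil_all W z. Qed.

Lemma bifil_d z : bifil d z.
Proof.
elim: (hsum_all HN (tw_gN W) z) => [|m p {}z w Hz _ IH]; first exact: bifil0.
by apply: bifilD IH; apply: (lfil_bifil W) (lfil_d Hz).
Qed.

Variable T : AN -> An.
Hypotheses (TD : forall z w, T (z + w) = T z + T w)
  (Tl : forall y z, T (iota y * z) = y * T z)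
  (Tr : forall y z, T (z * iota y) = T z * y)
  (T_poly : forall a f, (a < d)%N ->
     T (X ^+ a * atm f) = if a == d.-1 then gsc Dn (tr f) else 0)
  (T_perm : forall j : 'I_n, T (tP (lft j)) = 0).

Lemma ctrace0 : T 0 = 0.
Proof. by apply: (@addrI _ (T 0)); rewrite -TD !addr0. Qed.

Lemma ctraceN z : T (- z) = - T z.
Proof. by apply: (@addrI _ (T z)); rewrite -TD !subrr ctrace0. Qed.

Lemma ctrace_sum (I : Type) (s : seq I) (Q : pred I) (E : I -> AN) :
  T (\sum_(i <- s | Q i) E i) = \sum_(i <- s | Q i) T (E i).
Proof. exact: (big_morph T TD ctrace0). Qed.

(** The trace picks out exponent [d - 1] and kills the second kind of
    summands. *)
Lemma ctrace_bifil m z : (m < d)%N -> bifil m z -> T z = 0.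
Proof.
move=> md; elim=> {z} [a f y mf pf my py lt Hf Hy|j y y' my py my' py' Hy Hy'||z w _ Hz _ Hw].
- have ad := ltn_trans lt md; rewrite Tr T_poly //.
  case: eqP => [E|_]; last by rewrite mul0r.
  by move: lt; rewrite E -ltnS prednK // => /leq_trans/(_ md); rewrite ltnn.
- by rewrite Tr Tl T_perm mulr0 mul0r.
- exact: ctrace0.
- by rewrite TD Hz Hw addr0.
Qed.

(** For [j] not the last index, the element lies in [bifil a], where the trace
    vanishes as [a < d]. *)
Lemma ctrace_lead a j (m : nat) p f : (a < d)%N -> homog m p f ->
  T (X ^+ a * atm f * tP j) = if (a == d.-1) && (j == ord_max) then gsc Dn (tr f) else 0.
Proof.
move=> ad Hf; case: (unliftP ord_max j) => [j' ->|->]; last first.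
  by rewrite (tP_max W) mulr1 T_poly // eqxx andbT.
rewrite (negPf (lift_neq_max j')) andbF; apply: ctrace_bifil ad _.
rewrite -mulrA -[a in bifil a]addn0; apply: (bifil_Xnl W); apply: (bifil_atl W Hf).
exact: bifil_tau.
Qed.

Lemma lead_P_iota a f h j : X ^+ a * atm f * (iota (gP Dn h) * tP j) =
  iota (gP Dn h) * (X ^+ a * atm f * tP j).
Proof.
rewrite !mulrA -(Xn_iota W) -!mulrA; congr (_ * _).
by rewrite !mulrA (atm_iotaP W).
Qed.

(** On the exponent [d - 1] the trace form of [F] removes degree [delta] from
    [F_(n+1)], besides the degree [(d - 1) * delta] of the power of [x_(n+1)]. *)
Lemma ctrace_homog m p z : gcomp DN m p z -> gcomp Dn (m - (d * delta)%N%:Z) p (T z).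
Proof.
move=> /lfil_d; elim=> {m p z} [a1 y f s m p my py mf pf lt Hy Hf -> ->|m p|m p z w _ Hz _ Hw].
- have [h [j ->]] := P_coset W s.
  rewrite -!mulrA Tl (mulrA (X ^+ a1)) lead_P_iota Tl (ctrace_lead _ lt Hf).
  case: ifP => [/andP[/eqP-> _]|_]; last by rewrite !mulr0; apply: gcomp0.
  have [E|ne] := eqVneq mf delta; last first.
    by rewrite (ftr_maxdeg Hf (elimN eqP ne)) rmorph0 !mulr0; apply: gcomp0.
  case: pf Hf => Hf.
    by rewrite (ftr_even Hf) rmorph0 !mulr0; apply: gcomp0.
  have H := gcompM Hy (gcompM (gcomp_perm Dn h) (gcomp_scal Dn (tr f))).
  apply: gcomp_cast H _ _; last by rewrite !addbF.
  by rewrite E addnC -mulSn prednK // addrK !addr0.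
- by rewrite ctrace0; apply: gcomp0.
- by rewrite TD; apply: gcompD.
Qed.

(** If [tr f = 1], the trace recovers [y] from [x_(n+1) ^+ (d - 1) * f_(n+1) *
    y]. *)
Lemma iota_inj : injective iota.
Proof.
suff H y : iota y = 0 -> y = 0.
  by move=> y y' E; apply/eqP; rewrite -subr_eq0; apply/eqP/H; rewrite rmorphB E subrr.
move=> y0; have [f f1] : exists f, tr f = 1.
  case: (posnP (frank F)) => [r0|r0].
    have /eqP[] := oner_neq0 F; rewrite (coordP 1) big1 // => b _.
    by have := ltn_ord b; rewrite {2}r0.
  by pose b := Ordinal r0; exists (dual b * bas b); rewrite fdualP eqxx.
have := Tr y (X ^+ d.-1 * atm f).
rewrite y0 mulr0 ctrace0 T_poly ?prednK // eqxx f1 rmorph1 mul1r.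
by move=> <-.
Qed.

Local Notation I := ('I_n.+1 * 'I_d * 'I_(frank F))%type.
Implicit Types J K L : I.
Local Notation ja J := (nat_of_ord J.1.2).

(** The exponents in [ugen] and [vgen] add up to [d - 1] for equal indices,
    which is where the trace lives. *)
Definition ugen J : AN := tP J.1.1 * atm (bas J.2) * X ^+ ja J.
Definition vgen J : AN := X ^+ (d.-1 - ja J) * atm (dual J.2) * tP J.1.1.

Lemma ja_le J : (ja J <= d.-1)%N.
Proof. by rewrite -ltnS prednK. Qed.

Lemma vgen_span z : exists y : I -> An, z = \sum_J iota (y J) * vgen J.
Proof.
elim: (hsum_all HN (tw_gN W) z) => {z} [|m p z w Hz _ [y2 E2]].
  by exists (fun _ => 0); rewrite big1 // => J _; rewrite rmorph0 mul0r.
suff [y1 E1] : exists y : I -> An, z = \sum_J iota (y J) * vgen J.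
  exists (fun J => y1 J + y2 J); rewrite E1 E2 -big_split; apply: eq_bigr => J _.
  by rewrite rmorphD mulrDl.
elim: (lfil_d Hz) => {m p z w Hz y2 E2} [a1 y f s m p my py mf pf lt _ Hf _ _|_ _|_ _ z w _ [y1 E1] _ [y2 E2]].
- have [h [j ->]] := P_coset W s.
  have lt' : (d.-1 - a1 < d)%N by rewrite (leq_ltn_trans (leq_subr _ _)) ?prednK.
  exists (fun J => if (J.1 == (j, Ordinal lt')) then
     y * gP Dn h * gsc Dn (tr (f * bas J.2)) else 0).
  rewrite -!mulrA (mulrA (X ^+ a1)) lead_P_iota mulrA -rmorphM.
  rewrite [in LHS](dual_expand f) (gat_sum HT) mulr_sumr mulr_suml mulr_sumr.
  rewrite (bigID (fun J => J.1 == (j, Ordinal lt'))) /= [X in _ = _ + X]big1 ?addr0; last first.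
    by move=> J /negPf->; rewrite rmorph0 mul0r.
  rewrite (reindex_onto (fun b => (j, Ordinal lt', b)) (fun J => J.2)) /=; last first.
    by move=> [q b] /= /eqP->.
  apply: eq_big => [b|b _]; first by rewrite !eqxx.
  rewrite eqxx (gatZ HT) [in RHS]rmorphM -[RHS]mulrA; congr (_ * _).
  rewrite (tw_sc W) /vgen /= subKn; last by rewrite -ltnS prednK.
  by rewrite (scCA HT) !mulrA.
- by exists (fun _ => 0); rewrite big1 // => J _; rewrite rmorph0 mul0r.
- exists (fun J => y1 J + y2 J); rewrite E1 E2 -big_split; apply: eq_bigr => J _.
  by rewrite rmorphD mulrDl.
Qed.

Hypothesis psi_order : nakayama_order F theta.

(** The only place where the finite order of [psi] enters: powers of [x] can
    be moved to the right of [F]. *)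
Lemma iter_psi_surj a f : exists g, iter a psi g = f.
Proof.
(* The inverse of the [a]-th power of [psi]. *)
have [t0 pt _] := psi_order; exists (iter (a * theta - a) psi f).
rewrite -iterD subnKC ?leq_pmulr //; elim: a => // a IH.
by rewrite mulSn iterD IH pt.
Qed.

Lemma ftr_iter_psi a f : tr (iter a psi f) = tr f.
Proof.
elim: a => //= a <-; elim/homog_ind: (iter a psi f) => [|m p g h Hg IH].
  by rewrite !linear0.
rewrite !linearD /= IH; congr (_ + _).
have := nakayamaP (@comp1 _ F) Hg.
have := nakayamaP Hg (@comp1 _ F); rewrite andbF !mul1r mulr1 => ->.
by [].
Qed.

Lemma ugen_span z : exists y : I -> An, z = \sum_J ugen J * iota (y J).
Proof.
elim: (rfil_d z) => {z} [a s f y m p lt Hf||z w _ [y1 E1] _ [y2 E2]].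
- have [h [j ->]] := P_coset_r W s.
  have [g Eg] := iter_psi_surj a f.
  exists (fun J => if (J.1 == (j, Ordinal lt)) then
     gsc Dn (coord J.2 g) * (gP Dn h * y) else 0).
  have -> : tP j * iota (gP Dn h) * X ^+ a * atm f * iota y =
      tP j * (X ^+ a * atm f) * iota (gP Dn h * y).
    rewrite rmorphM -!mulrA; congr (_ * _); rewrite mulrA -(Xn_iota W) -mulrA.
    by congr (_ * _); rewrite mulrA -(atm_iotaP W) -mulrA.
  rewrite -Eg -(at_Xn W) (gat_coord HT) mulr_suml mulr_sumr mulr_suml.
  rewrite (bigID (fun J => J.1 == (j, Ordinal lt))) /= [X in _ = _ + X]big1 ?addr0; last first.
    by move=> J /negPf->; rewrite rmorph0 mulr0.
  rewrite (reindex_onto (fun b => (j, Ordinal lt, b)) (fun J => J.2)) /=; last first.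
    by move=> [q b] /= /eqP->.
  apply: eq_big => [b|b _]; first by rewrite !eqxx.
  by rewrite eqxx [in RHS]rmorphM (tw_sc W) /ugen /= -!mulrA !(scCA HT).
- by exists (fun _ => 0); rewrite big1 // => J _; rewrite rmorph0 mulr0.
- exists (fun J => y1 J + y2 J); rewrite E1 E2 -big_split; apply: eq_bigr => J _.
  by rewrite rmorphD mulrDr.
Qed.

(** A permutation outside [S_n] lies in the double coset of the last
    transposition. *)
Lemma bifil_P_move m (s : {perm 'I_n.+1}) : s ord_max != ord_max -> bifil m (P s).
Proof.
move=> sm; have [h Eh] := unlift_perm_ex (tau_coset s).
have -> : P s = iota (gP Dn h) * tP (s^-1%g ord_max).
  by rewrite (tw_P W) (gPM HP) Eh mulgA /tau tperm2 mul1g.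
apply: (bifil_iotal W); case: (unliftP ord_max (s^-1%g ord_max)) => [l ->|E].
  exact: bifil_tau.
by move: sm; rewrite -{1}E permKV eqxx.
Qed.

(** If the exponent of [J] is at most that of [K], the product has exponents
    at most [d - 1]. For distinct transpositions [tau i] and [tau j] their
    product moves the last index, so that the exponent [d - 1] does not occur;
    for equal ones they cancel and the dual bases of [F] remain. *)
Lemma gram_unitriangular K J : (ja J <= ja K)%N -> T (vgen K * ugen J) = (K == J)%:R.
Proof.
move: K J => [[i a'] b'] [[j a] b]; rewrite /vgen /ugen /= => le.
have a'd : (a' <= d.-1)%N by rewrite -ltnS prednK.
have [E|ij] := eqVneq i j; last first.
  rewrite (_ : (_ == _) = false); last by rewrite !xpair_eqE (negPf ij).
  have lt : (a + (d.-1 - a') < d)%N.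
    by rewrite -[X in (_ < X)%N](prednK d_gt0) ltnS -[X in (_ <= X)%N](subnKC a'd) leq_add2r.
  apply: ctrace_bifil lt _; rewrite !mulrA; apply: (bifil_Xnr W).
  apply: (bifil_atr W (fbasisH b)); rewrite -!mulrA -[X in bifil X]addn0.
  apply: (bifil_Xnl W); apply: (bifil_atl W (fdualH b')); rewrite (gPM HP).
  apply: bifil_P_move; rewrite permM (tau_max j).
  by rewrite -(tau_j i) (inj_eq perm_inj) eq_sym.
have -> : X ^+ (d.-1 - a') * atm (dual b') * tP i * (tP j * atm (bas b) * X ^+ a) =
    X ^+ (d.-1 - a' + a) * atm (iter a psi (dual b' * bas b)).
  rewrite E -!mulrA (mulrA (tP j)) (tPtP W) mul1r (mulrA (atm _)) (gatM HT).
  by rewrite (at_Xn W) mulrA -exprD.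
have le' : (d.-1 - a' + a <= d.-1)%N by rewrite -{2}(subnK a'd) leq_add2l.
rewrite T_poly; last by rewrite -[X in (_ < X)%N](prednK d_gt0) ltnS.
rewrite ftr_iter_psi fdualP !xpair_eqE E eqxx /=.
have -> : (d.-1 - a' + a == d.-1)%N = (a' == a).
  by rewrite -{2}(subnK a'd) eqn_add2l eq_sym.
by case: (_ == _); case: (_ == _); rewrite ?rmorph1 ?rmorph0.
Qed.

(** Inversion of the unitriangular Gram matrix, by recursion on the number of
    larger exponents. *)
Fixpoint vdual (m : nat) K : AN :=
  if m is m'.+1 then
    vgen K - \sum_(L | (ja K < ja L)%N) iota (T (vgen K * ugen L)) * vdual m' L
  else 0.

Lemma vdualP m K J : (d - ja K <= m)%N -> T (vdual m K * ugen J) = (K == J)%:R.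
Proof.
elim: m K => [|m IH] K; first by rewrite leqn0 subn_eq0 leqNgt ltn_ord.
move=> le /=; rewrite mulrBl TD ctraceN mulr_suml ctrace_sum.
have -> : \sum_(L | (ja K < ja L)%N) T (iota (T (vgen K * ugen L)) * vdual m L * ugen J) =
    \sum_(L | (ja K < ja L)%N) T (vgen K * ugen L) * (L == J)%:R.
  apply: eq_bigr => L KL; rewrite -mulrA Tl IH // -ltnS.
  by apply: leq_trans le; apply: ltn_sub2l.
have [JK|KJ] := leqP (ja J) (ja K).
  rewrite gram_unitriangular // big1 ?subr0 // => L KL; have [E|] := eqVneq L J; last by rewrite mulr0.
  by move: KL; rewrite E ltnNge JK.
rewrite (bigD1 J) //= eqxx mulr1 big1 ?addr0 => [|L /andP[_ /negPf->]]; last by rewrite mulr0.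
by rewrite subrr; case: eqP KJ => // ->; rewrite ltnn.
Qed.

Definition udeg J : nat := (ja J * delta + fdeg J.2)%N.
Definition vdeg J : nat := ((d.-1 - ja J) * delta + (delta - fdeg J.2))%N.

Lemma vudeg J : (vdeg J + udeg J = d * delta)%N.
Proof.
rewrite /vdeg /udeg addnACA -mulnDl subnK ?ja_le // subnK ?fdeg_le //.
by rewrite addnC -mulSn prednK.
Qed.

Lemma X_homog a : gcomp DN (a * delta)%N%:Z false (X ^+ a).
Proof.
apply: gcomp_cast (gcompX a (gcomp_x DN ord_max)) _ _ => //.
by rewrite -mulr_natr natz -PoszM mulnC.
Qed.

Lemma ugen_homog J : gcomp DN (udeg J)%:Z (fpar J.2) (ugen J).
Proof.
have H := gcompM (gcompM (gcomp_perm DN (tau J.1.1)) (gcomp_at DN ord_max (fbasisH J.2))) (X_homog (ja J)).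
by apply: gcomp_cast H _ _; rewrite ?addbF // add0r addrC.
Qed.

Lemma vgen_homog J : gcomp DN (vdeg J)%:Z (fpar J.2) (vgen J).
Proof.
have H := gcompM (gcompM (X_homog (d.-1 - ja J)) (gcomp_at DN ord_max (fdualH J.2))) (gcomp_perm DN (tau J.1.1)).
by apply: gcomp_cast H _ _; rewrite ?addbF // addr0.
Qed.

Lemma iota_homog m p y : gcomp Dn m p y -> gcomp DN m p (iota y).
Proof.
elim=> {m p y} [i|m p f Hf|s|c|m p|m p a b _ Ha _ Hb|m p m' p' a b _ Ha _ Hb].
- by rewrite (tw_x W); apply: gcomp_x.
- rewrite (tw_T W).
  have := @gcomp_ten k F n.+1 AN DN (fun j => if unlift ord_max j is Some i then m i else 0%N)
    (par_widen p) (ten_widen f).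
  move=> H; apply: gcomp_cast (H _) _ _.
  + move=> j; case: (unliftP ord_max j) => [i ->|->].
      by rewrite par_widen_lift ten_widen_lift.
    by rewrite par_widen_max ten_widen_max; apply: comp1.
  + rewrite big_ord_recr /= unlift_none addn0; congr (Posz _); apply: eq_bigr => i _.
    by rewrite (_ : widen_ord _ i = lft i) ?liftK //; apply: val_inj; rewrite /= /bump leqNgt ltn_ord.
  + rewrite big_ord_recr /= par_widen_max addbF; apply: eq_bigr => i _.
    rewrite (_ : widen_ord _ i = lft i) ?par_widen_lift //.
    by apply: val_inj; rewrite /= /bump leqNgt ltn_ord.
- by rewrite (tw_P W); apply: gcomp_perm.
- by rewrite (tw_sc W); apply: gcomp_scal.
- by rewrite rmorph0; apply: gcomp0.
- by rewrite rmorphD; apply: gcompD.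
- by rewrite rmorphM; apply: gcompM.
Qed.

(** All entries of the Gram matrix have the degree that makes the terms of the
    recursion homogeneous of the same degree. *)
Lemma vdual_homog m K : gcomp DN (vdeg K)%:Z (fpar K.2) (vdual m K).
Proof.
elim: m K => [|m IH] K /=; first exact: gcomp0.
apply: gcompD (vgen_homog K) _; apply: gcompN; apply: gcomp_sum => L _.
have H := gcompM (iota_homog (ctrace_homog (gcompM (vgen_homog K) (ugen_homog L)))) (IH L).
apply: gcomp_cast H _ _; last by rewrite -addbA addbb addbF.
by have := vudeg L; lia.
Qed.

Local Notation vd := (vdual d).

Lemma dual_left z : z = \sum_J ugen J * iota (T (vd J * z)).
Proof.
have [y E] := ugen_span z; rewrite {1}E; apply: eq_bigr => J _; congr (_ * iota _).
rewrite E mulr_sumr ctrace_sum (bigD1 J) //= mulrA Tr vdualP ?leq_subr // eqxx mul1r.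
rewrite big1 ?addr0 // => K KJ; rewrite mulrA Tr vdualP ?leq_subr //.
by rewrite eq_sym (negPf KJ) mul0r.
Qed.

(** The coefficients with respect to [vgen] vanish in order of increasing
    exponents, as the Gram matrix is unitriangular. *)
Lemma ctrace_nondeg z : (forall J, T (z * ugen J) = 0) -> z = 0.
Proof.
have [y ->] := vgen_span z => H.
suff y0 a J : ja J = a -> y J = 0 by apply: big1 => J _; rewrite (y0 _ _ erefl) rmorph0 mul0r.
elim/ltn_ind: a J => a IH J Ja; have := H J.
rewrite mulr_suml ctrace_sum (bigD1 J) //= -mulrA Tl gram_unitriangular // eqxx mulr1.
rewrite big1 ?addr0 // => K KJ; rewrite -mulrA Tl.
have [JK|KJ'] := leqP (ja J) (ja K); first by rewrite gram_unitriangular // (negPf KJ) mulr0.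
by rewrite (IH (ja K)) ?mul0r // -Ja.
Qed.

(** The difference of both sides pairs to zero with all [ugen]. *)
Lemma dual_right z : z = \sum_J iota (T (z * ugen J)) * vd J.
Proof.
apply/eqP; rewrite -subr_eq0; apply/eqP/ctrace_nondeg => J.
rewrite mulrBl TD ctraceN mulr_suml ctrace_sum (bigD1 J) //= -mulrA Tl vdualP ?leq_subr // eqxx mulr1.
rewrite big1 ?addr0 ?subrr // => K KJ.
by rewrite -mulrA Tl vdualP ?leq_subr // (negPf KJ) mulr0.
Qed.

Lemma dual_bases : exists (N : nat) (u v : 'I_N -> AN),
  [/\ forall i, exists m p, gcomp DN m p (u i),
      forall i, exists m p, gcomp DN m p (v i),
      forall z, z = \sum_(i < N) u i * iota (T (v i * z))
    & forall z, z = \sum_(i < N) iota (T (z * u i)) * v i].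
Proof.
pose e (i : 'I_#|{: I}|) : I := enum_val i.
have be : bijective e by apply: enum_val_bij.
exists #|{: I}|, (fun i => ugen (e i)), (fun i => vd (e i)); split=> [i|i|z|z].
- by exists (udeg (e i))%:Z, (fpar (e i).2); apply: ugen_homog.
- by exists (vdeg (e i))%:Z, (fpar (e i).2); apply: vdual_homog.
- by rewrite {1}(dual_left z) (reindex e) //; apply: onW_bij.
- by rewrite {1}(dual_right z) (reindex e) //; apply: onW_bij.
Qed.

End CyclotomicReduction.

(** * The trace of the cyclotomic quotient *)

Section Trace.
Variables (k : comNzRingType) (F : frobeniusSuperalgebra k).
Variables (theta : nat) (C : nat -> seq F).
Hypothesis HC : cyclotomic_datum theta C.
Local Notation d := (level theta C).
Hypothesis d_gt0 : (0 < d)%N.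
Variable n : nat.
Local Notation AD := (aff_data F n.+1).
Local Notation DR := (cyc_data theta C n).
Local Notation DA := (cyc_data theta C n.+1).
Local Notation R := (cyclotomic theta C n).
Local Notation A := (cyclotomic theta C n.+1).
Local Notation iota := (@cyc_incl k F theta C n).
Local Notation tr := (ftr F).
Local Notation eta := (toquo (@cyc_rel k F theta C n)).
Local Notation qN := (toquo (@cyc_rel k F theta C n.+1)).

Lemma affine_perm_kspan (j : 'I_n) y y' :
  kspan AD (@affine_incl k F n)
    (affine_incl y * gP AD (tau (lift ord_max j)) * affine_incl y').
Proof.
move: j y y'; case: n => [|m] j y y'; first by case: j.
exact: (perm_kspan (affine_tower F m) (affine_tower F m.+1)).
Qed.

Lemma gchi_eq0 m (i : 'I_m) : i = 0%N :> nat ->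
  toquo (@cyc_rel k F theta C m) (gchi (aff_data F m) theta C i) = 0.
Proof. by move=> i0; apply: toquo_eq0; exists i. Qed.

Lemma cyc_chi0 : gchi DA theta C ord0 = 0.
Proof.
apply: etrans (@gchi_eq0 n.+1 ord0 erefl); rewrite /gchi rmorph_prod.
apply: eq_bigr => j _; rewrite rmorph_prod; apply: eq_bigr => c _.
by rewrite rmorphB rmorphXn.
Qed.

(** The functional is prescribed to be [trace_value] on [cgen]. *)
Lemma affine_trace : exists T : affine F n.+1 -> R,
  [/\ forall z w, T (z + w) = T z + T w,
      forall y z, T (affine_incl y * z) = eta y * T z,
      forall j a f, T (cgen AD theta C j a f) = trace_value theta C DR j a f,
      forall z y, T (z * affine_incl y) = T z * eta y
    & forall u v, T (u * gchi AD theta C ord0 * v) = 0].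
Proof.
have HR := cyc_afflaws theta C n.
have W := affine_tower F n.
have [T [TD Tl Te]] := @solve k F n R DR HR eta (fun=> erefl) (fun=> erefl) (fun=> erefl)
  (fun=> erefl) _ (trace_value theta C DR) (cgen_leading W HC)
  (cgen_linear W theta C) (trace_value_linear theta C DR).
exists T; split=> //.
  exact: (atrace_right HC d_gt0 W HR _ affine_perm_kspan TD Tl Te).
by apply: (atrace_ideal HC d_gt0 W HR _ affine_perm_kspan TD Tl Te) => // i; apply: gchi_eq0.
Qed.

(** The trace on the affine algebra kills the ideal, hence factors through the
    quotient. *)
Lemma cyc_trace_ex : exists T : A -> R,
  [/\ forall z w, T (z + w) = T z + T w,
      forall y z, T (iota y * z) = y * T z,
      forall y z, T (z * iota y) = T z * y,
      forall a f, (a < d)%N -> T (gx DA ord_max ^+ a * gat DA ord_max f) =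
        if a == d.-1 then gsc DR (tr f) else 0
    & forall j : 'I_n, T (gP DA (tau (lift ord_max j))) = 0].
Proof.
have [T [TD Tl Te Tr Tchi]] := affine_trace.
have T0 : T 0 = 0 by apply: (@addrI _ (T 0)); rewrite -TD !addr0.
have TI a : ideal_gen (@cyc_rel k F theta C n.+1) a -> T a = 0.
  move=> Ia; suff H u v : T (u * a * v) = 0 by have := H 1 1; rewrite mul1r mulr1.
  elim: Ia u v => [s [i i0 ->]||b c _ Hb _ Hc|b c _ Hc|b c _ Hb] u v.
  - have -> : i = ord0 by apply: val_inj.
    exact: Tchi.
  - by rewrite mulr0 mul0r.
  - by rewrite mulrDr mulrDl TD Hb Hc addr0.
  - by rewrite mulrA; apply: Hc.
  - by rewrite mulrA -mulrA; apply: Hb.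
pose Tb (q : A) : R := T (generic_quotient.repr q).
have TbE a : Tb (qN a) = T a.
  rewrite /Tb -[generic_quotient.repr _](subrK a) TD TI ?add0r //.
  exact: repr_toquo.
have iotaE y : iota (eta y) = qN (affine_incl y).
  by rewrite /cyc_incl (quo_liftE (@cyc_incl_subproof k F theta C n)).
exists Tb; split.
- by elim/quoW=> z; elim/quoW=> w; rewrite -rmorphD !TbE TD.
- by elim/quoW=> y; elim/quoW=> z; rewrite iotaE -rmorphM !TbE Tl.
- by elim/quoW=> y; elim/quoW=> z; rewrite iotaE -rmorphM !TbE Tr.
- move=> a f ad.
  have -> : gx DA ord_max ^+ a * gat DA ord_max f = qN (gx AD ord_max ^+ a * gat AD ord_max f).
    by rewrite rmorphM rmorphXn.
  by rewrite TbE (atrace_poly (affine_tower F n) Te) // /trace_value eqxx.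
- move=> j; rewrite [gP DA _]/(qN (gP AD _)) TbE.
  have := atrace_left Te j 0 1.
  by rewrite /leftgen (gat1 (al_T (aff_afflaws F n.+1))) !mulr1.
Qed.

Local Notation X := (gx DA ord_max).
Local Notation atm := (gat DA ord_max).
Let W := cyc_tower theta C n.

Lemma add_span_add (V : nmodType) (Q : V -> Prop) u v :
  add_span Q u -> add_span Q v -> add_span Q (u + v).
Proof.
move=> Hu Hv; elim: Hu => [|u1 u2 H1 _ IH]; first by rewrite add0r.
by rewrite -addrA; apply: add_spanD.
Qed.

Lemma add_span1 (V : nmodType) (Q : V -> Prop) u : Q u -> add_span Q u.
Proof. by move=> Hu; rewrite -[u]addr0; apply: add_spanD Hu (add_span0 _). Qed.

Lemma trace_graphD (a b : A) (r s : R) :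
  trace_graph a r -> trace_graph b s -> trace_graph (a + b) (r + s).
Proof.
move=> [N1 [f1 [y1 [l1 [w1 [Hl1 Hw1 -> ->]]]]]] [N2 [f2 [y2 [l2 [w2 [Hl2 Hw2 -> ->]]]]]].
exists (N1 + N2)%N, (fun i : 'I_(N1 + N2) => match fintype.split i with inl j => f1 j | inr j => f2 j end).
exists (fun i : 'I_(N1 + N2) => match fintype.split i with inl j => y1 j | inr j => y2 j end).
exists (fun c => l1 c + l2 c), (w1 + w2); split.
- by move=> c cd; apply: add_span_add; [apply: Hl1|apply: Hl2].
- exact: add_span_add.
- rewrite big_split_ord big_split /= [LHS]addrACA; congr (_ + _).
  rewrite [LHS]addrACA; congr (_ + _ + _); apply: eq_bigr => i _.
    by rewrite (unsplitK (inl i)).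
  by rewrite (unsplitK (inr i)).
- rewrite big_split_ord /=; congr (_ + _); apply: eq_bigr => i _.
    by rewrite (unsplitK (inl i)).
  by rewrite (unsplitK (inr i)).
Qed.

Lemma trace_graph0 : @trace_graph k F theta C n 0 0.
Proof.
exists 0%N, (fun _ => 0), (fun _ => 0), (fun _ => 0), 0; split.
- by move=> b _; apply: add_span0.
- exact: add_span0.
- by rewrite !big_ord0 big1 ?addr0.
- by rewrite big_ord0.
Qed.

(** The two kinds of summands span the quotient, with exponents less than [d]. *)
Lemma trace_graph_ex (a : A) : exists r, trace_graph a r.
Proof.
elim: (bifil_d HC W cyc_chi0 a) => {a} [c f y mf pf my py lt _ _|j y y' my py my' py' _ _||a b _ [r Hr] _ [s Hs]].
- have [E|ne] := eqVneq c d.-1.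
    exists (cyc_scal theta C n (tr f) * y); exists 1%N, (fun _ => f), (fun _ => y), (fun _ => 0), 0.
    split; rewrite ?big_ord1 //.
    + by move=> b _; apply: add_span0.
    + exact: add_span0.
    + by rewrite big1 ?addr0 // E.
  exists 0; exists 0%N, (fun _ => 0), (fun _ => 0), (fun b => if b == c then X ^+ c * atm f * iota y else 0), 0.
  have cd : (c < d.-1)%N by rewrite ltn_neqAle ne -ltnS prednK.
  split; rewrite ?big_ord0 //.
  + move=> b _; case: eqP => [->|_]; last exact: add_span0.
    by apply: add_span1; exists f, y.
  + exact: add_span0.
  + rewrite (bigD1 (Ordinal cd)) //= eqxx big1 ?add0r ?addr0 // => b.
    by rewrite -val_eqE /= => /negPf->.
- exists 0; exists 0%N, (fun _ => 0), (fun _ => 0), (fun _ => 0), (iota y * gP DA (tau (lift ord_max j)) * iota y').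
  split; rewrite ?big_ord0 //.
  + by move=> b _; apply: add_span0.
  + apply: add_span1; move: (W) j y y'; case: (n) => [|m] W' j y y'; first by case: j.
    rewrite (tau_lift W') !mulrA -[_ * _ * cyc_incl y']mulrA -!rmorphM.
    exists (lift ord_max ord_max), (y * gP (cyc_data theta C m.+1) (tau j)), (gP (cyc_data theta C m.+1) (tau j) * y').
    by rewrite lift_max.
  + by rewrite big1 ?add0r.
- by exists 0; apply: trace_graph0.
- by exists (r + s); apply: trace_graphD.
Qed.

Variable T : A -> R.
Hypotheses (TD : forall z w, T (z + w) = T z + T w)
  (Tl : forall y z, T (iota y * z) = y * T z)
  (Tr : forall y z, T (z * iota y) = T z * y)
  (T_poly : forall a f, (a < d)%N -> T (X ^+ a * atm f) =
        if a == d.-1 then gsc DR (tr f) else 0)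
  (T_perm : forall j : 'I_n, T (gP DA (tau (lift ord_max j))) = 0).

(** A bimodule map that vanishes on the other summands reads off the component
    of exponent [d - 1]. *)
Lemma trace_graph_uniq (a : A) (r : R) : trace_graph a r -> r = T a.
Proof.
have T0 := ctrace0 TD.
move=> [N [f [y [l [w [Hl Hw -> ->]]]]]]; rewrite !TD !(ctrace_sum TD).
have span0 (Q : A -> Prop) z : (forall u, Q u -> T u = 0) -> add_span Q z -> T z = 0.
  by move=> HQ; elim=> {z} [|u v /HQ Hu _ Hv]; rewrite ?T0 // TD Hu Hv addr0.
rewrite [X in _ = _ + X + _]big1 => [|b _]; last first.
  apply: span0 (Hl b (ltn_ord b)) => u [g [y' ->]].
  have bd : (b < d.-1)%N := ltn_ord b.
  by rewrite Tr T_poly ?(ltn_eqF bd) ?mul0r // (leq_trans bd) ?leq_pred.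
rewrite (span0 _ w _ Hw) ?addr0 => [|u [i [y1 [y2 [iN ->]]]]]; last first.
  have ni : (i < n)%N by rewrite -[X in (_ < X)%N]iN.
  have -> : i = lift ord_max (Ordinal ni) by apply: val_inj; rewrite /= /bump leqNgt ni.
  by rewrite Tr Tl T_perm mulr0 mul0r.
by apply: eq_bigr => i _; rewrite Tr T_poly ?prednK // eqxx.
Qed.

Lemma cyc_traceE a : cyc_trace a = T a.
Proof.
apply: trace_graph_uniq; have [r Hr] := trace_graph_ex a.
exact: (@xgetPex _ 0 [set r | trace_graph a r]%classic (ex_intro _ r Hr)).
Qed.

End Trace.

Lemma gcomp_cyc_comp (k : comNzRingType) (F : frobeniusSuperalgebra k) theta
    (C : nat -> seq F) m e p a :
  gcomp (cyc_data theta C m) e p a <-> @cyc_comp k F theta C m e p a.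
Proof.
split; elim=> {e p a}.
- by move=> i; apply: cyc_comp_x.
- by move=> e p f Hf; apply: cyc_comp_ten.
- by move=> s; apply: cyc_comp_perm.
- by move=> c; apply: cyc_comp_scal.
- by move=> e p; apply: cyc_comp0.
- by move=> e p a b _ Ha _ Hb; apply: cyc_compD.
- by move=> e p e' p' a b _ Ha _ Hb; apply: cyc_compM.
- by move=> i; apply: (gcomp_x (cyc_data theta C m)).
- by move=> e p f Hf; apply: (gcomp_ten (cyc_data theta C m)).
- by move=> s; apply: (gcomp_perm (cyc_data theta C m)).
- by move=> c; apply: (gcomp_scal (cyc_data theta C m)).
- by move=> e p; apply: gcomp0.
- by move=> e p a b _ Ha _ Hb; apply: gcompD.
- by move=> e p e' p' a b _ Ha _ Hb; apply: gcompM.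
Qed.

Theorem theorem6p19 (k : comNzRingType) (p : nat) (char_k : ring_char k p)
    (char_k_neq2 : p <> 2%N)
    (F : frobeniusSuperalgebra k)
    (theta : nat) (psi_order : nakayama_order F theta)
    (char_k_theta : ~~ (p %| theta)%N)
    (psi_diag : nakayama_diagonalizable F)
    (C : nat -> seq F) (C_datum : cyclotomic_datum theta C)
    (level_pos : (0 < level theta C)%N)
    (n : nat) :
  frobenius_extension
    (@cyc_scal k F theta C n) (@cyc_scal k F theta C n.+1)
    (@cyc_comp k F theta C n) (@cyc_comp k F theta C n.+1)
    (@cyc_incl k F theta C n) (@cyc_trace k F theta C n).
Proof.
have [T [TD Tl Tr T_poly T_perm]] := cyc_trace_ex C_datum level_pos n.
have W := cyc_tower theta C n; have chi0 := cyc_chi0 theta C n.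
have -> : @cyc_trace k F theta C n = T.
  by apply/funext => a; apply: (cyc_traceE C_datum level_pos TD Tl Tr T_poly T_perm).
split.
- split.
  + exact: (iota_inj level_pos TD Tr T_poly).
  + exact: cyc_incl_scal.
  + by move=> m q y /gcomp_cyc_comp Hy; apply/gcomp_cyc_comp; apply: (iota_homog W Hy).
- by split=> // y a z; rewrite Tr Tl.
- exists (- (level theta C * maxdeg F)%N%:Z) => m q a /gcomp_cyc_comp Ha.
  apply/gcomp_cyc_comp.
  exact: (ctrace_homog C_datum level_pos W chi0 TD Tl Tr T_poly T_perm Ha).
- have [N [u [v [Hu Hv E1 E2]]]] := dual_bases C_datum level_pos W chi0 TD Tl Tr T_poly T_perm psi_order.
  exists N, u, v; split=> // i.
    by have [m [q /gcomp_cyc_comp H]] := Hu i; exists m, q.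
  by have [m [q /gcomp_cyc_comp H]] := Hv i; exists m, q.
Qed.
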